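(* Let $s\in(k-1,k)$ with $k\in\mathbb N$, and let $f$ be a given function. Let $u\in U$ be the solution of $$(D_+^su,D^kv)=(f,v)\quad\forall v\in V,$$ which is the weak form of the problem $D_+^{s+k}u=f$ in $\Lambda$, $u^{(l)}(\pm1)=0$, $l=0,\dots,k-1$, and let $u_N\in{}^+\mathcal F_N^{(-s,-k)}(\Lambda)$ be the solution of $$(D_+^su_N,D^kv_N)=(f,v_N)\quad\forall v_N\in{}^-\mathcal F_N^{(-k,-s)}(\Lambda).$$ If $u\in U\cap{}^+\mathcal B^m_{s,-k}(\Lambda)$ with $0\le m\le N$, then $$\|u-u_N\|_U\le cN^{-m}\big\|D_+^{s+m}u\big\|_{\omega^{(m,s-k+m)}}.$$ In particular, if $f^{(m-k)}\in L^2_{\omega^{(m,s-k+m)}}(\Lambda)$ for $m\ge k$, then $$\|u-u_N\|_U\le cN^{-m}\big\|f^{(m-k)}\big\|_{\omega^{(m,s-k+m)}}.$$ Here $c$ is a positive constant independent of $u$, $N$ and $m$.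
   Context: $\mathbb N=\{1,2,\dots\}$, $\Lambda=(-1,1)$, $D^k=d^k/dx^k$, $\omega^{(a,b)}(x)=(1-x)^a(1+x)^b$; $(\cdot,\cdot)$ is the $L^2(\Lambda)$ inner product, and $\|u\|_\varpi=(\int_\Lambda u^2\varpi\,dx)^{1/2}$ is the norm of $L^2_\varpi(\Lambda)$. $\mathcal P_N$ is the set of real polynomials of degree at most $N$. Right Riemann–Liouville derivative of order $\sigma\in[j-1,j)$, $j\in\mathbb N$: $$D_+^\sigma v(x)=\frac{(-1)^j}{\Gamma(j-\sigma)}\frac{d^j}{dx^j}\int_x^1\frac{v(y)}{(y-x)^{\sigma-j+1}}dy.$$ Solution and test spaces: $$U=\{u\in L^2_{\omega^{(-s,-k)}}(\Lambda):D_+^su\in L^2_{\omega^{(0,s-k)}}(\Lambda)\},\qquad V=\{v\in L^2_{\omega^{(-k,-s)}}(\Lambda):D^kv\in L^2_{\omega^{(0,k-s)}}(\Lambda)\},$$ with norms $$\|u\|_U=\big(\|u\|^2_{\omega^{(-s,-k)}}+\|D_+^su\|^2_{\omega^{(0,s-k)}}\big)^{1/2},\qquad \|v\|_V=\big(\|v\|^2_{\omega^{(-k,-s)}}+\|D^kv\|^2_{\omega^{(0,k-s)}}\big)^{1/2}.$$ Finite-dimensional spaces: $${}^+\mathcal F_N^{(-s,-k)}(\Lambda)=\{(1-x)^s\psi:\psi\in\mathcal P_N,\ \psi^{(l)}(-1)=0,\ 0\le l\le k-1\},$$ $${}^-\mathcal F_N^{(-k,-s)}(\Lambda)=\{(1+x)^s\psi:\psi\in\mathcal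 P_N,\ \psi^{(l)}(1)=0,\ 0\le l\le k-1\}.$$ Regularity space, for an integer $m\ge0$: $${}^+\mathcal B^m_{s,-k}(\Lambda)=\{u\in L^2_{\omega^{(-s,-k)}}(\Lambda):D_+^{s+l}u\in L^2_{\omega^{(l,s-k+l)}}(\Lambda)\text{ for }0\le l\le m\}.$$
   Formalization: The constant c may depend on m (independence of m is false: take m = N with D_+^s u a Jacobi polynomial combination of degrees N+1, N+2); the conditions u^(l)(±1)=0, l<k, are required of u explicitly, as limits of its weak derivatives. *)

(* Defs.v *)
(* MathComp / MathComp-Analysis. *)
From HB Require Import structures.
From mathcomp Require Import all_boot all_order all_algebra.
From mathcomp Require Import all_classical all_reals all_analysis.

Set Implicit Arguments.
Unset Strict Implicit.
Unset Printing Implicit Defensive.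

Import Order.TTheory GRing.Theory Num.Theory.
Import numFieldNormedType.Exports.

Local Open Scope classical_set_scope.
Local Open Scope ring_scope.

(* Functions on Lambda = (-1, 1) are total functions R -> R whose values
   outside Lambda are irrelevant. *)
Section Spaces.
Context {R : realType}.
Notation mu := (@lebesgue_measure R).
Implicit Types (u v f g w : R -> R).

Definition Lambda : set R := `]-1, 1[.

Definition omega (a b : R) : R -> R := fun x => (1 - x) `^ a * (1 + x) `^ b.

Definition inner f g : R := \int[mu]_(x in Lambda) (f x * g x).

Definition L2w (w : R -> R) : set (R -> R) :=
  [set u : R -> R | measurable_fun Lambda u /\
           mu.-integrable Lambda (fun x : R => (u x ^+ 2 * w x)%:E)].

(* Meaningful for u in L2w w. *)
Definition normw (w : R -> R) u : R :=
  Num.sqrt (\int[mu]_(x in Lambda) (u x ^+ 2 * w x)).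

(* phi is in C_c^oo(Lambda), extended by zero. *)
Definition test_function (phi : R -> R) : Prop :=
  (forall n x, derivable (derive1n n phi) x 1) /\
  exists a b : R, [/\ -1 < a, b < 1 & forall x, x \notin `[a, b] -> phi x = 0].

(* g is the j-th distributional derivative of w on Lambda. *)
Definition is_weak_derivative (j : nat) w g : Prop :=
  [/\ locally_integrable Lambda w, locally_integrable Lambda g &
      forall phi, test_function phi ->
        inner w (derive1n j phi) = (-1) ^+ j * inner g phi].

Definition weakly_derivable (j : nat) w : Prop :=
  exists g, is_weak_derivative j w g.

(* D^j w: a version of the weak derivative, unique up to a null set; it is the
   constant 0 when w is not weakly derivable, so every space below also
   requires weak derivability. *)
Definition weak_derivative (j : nat) w : R -> R :=
  xget (fun=> 0) [set g : R -> R | is_weak_derivative j w g].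

Definition Gamma (a : R) : R :=
  \int[mu]_(t in `]0, +oo[) (t `^ (a - 1) * expR (- t)).

(* The j with j - 1 <= sigma < j, for sigma >= 0. *)
Definition RL_order (sigma : R) : nat := (Num.truncn sigma).+1.

Definition RL_integral (sigma : R) v : R -> R := fun x =>
  \int[mu]_(y in `]x, 1[) (v y / (y - x) `^ (sigma - (RL_order sigma)%:R + 1)).

Definition RL_derivable (sigma : R) v : Prop :=
  weakly_derivable (RL_order sigma) (RL_integral sigma v).

(* D_+^sigma v, with d^j/dx^j taken in the weak sense. *)
Definition RL_derivative (sigma : R) v : R -> R := fun x =>
  (-1) ^+ RL_order sigma / Gamma ((RL_order sigma)%:R - sigma) *
  weak_derivative (RL_order sigma) (RL_integral sigma v) x.

Definition U (k : nat) (s : R) : set (R -> R) :=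
  [set u : R -> R | [/\ L2w (omega (- s) (- k%:R)) u, RL_derivable s u &
               L2w (omega 0 (s - k%:R)) (RL_derivative s u)]].

Definition V (k : nat) (s : R) : set (R -> R) :=
  [set v : R -> R | [/\ L2w (omega (- k%:R) (- s)) v, weakly_derivable k v &
               L2w (omega 0 (k%:R - s)) (weak_derivative k v)]].

Definition normU (k : nat) (s : R) u : R :=
  Num.sqrt (normw (omega (- s) (- k%:R)) u ^+ 2 +
            normw (omega 0 (s - k%:R)) (RL_derivative s u) ^+ 2).

Definition Fplus (k : nat) (s : R) (N : nat) : set (R -> R) :=
  [set u : R -> R | exists psi : {poly R},
    [/\ (size psi <= N.+1)%N,
        forall l, (l < k)%N -> (derivn l psi).[-1] = 0 &
        forall x, Lambda x -> u x = (1 - x) `^ s * psi.[x]]].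

Definition Fminus (k : nat) (s : R) (N : nat) : set (R -> R) :=
  [set v : R -> R | exists psi : {poly R},
    [/\ (size psi <= N.+1)%N,
        forall l, (l < k)%N -> (derivn l psi).[1] = 0 &
        forall x, Lambda x -> v x = (1 + x) `^ s * psi.[x]]].

Definition Bplus (m k : nat) (s : R) : set (R -> R) :=
  [set u : R -> R | L2w (omega (- s) (- k%:R)) u /\
    forall l, (l <= m)%N -> RL_derivable (s + l%:R) u /\
      L2w (omega l%:R (s - k%:R + l%:R)) (RL_derivative (s + l%:R) u)].

(* u^(l)(-1) = u^(l)(1) = 0 for 0 <= l <= k - 1: each of these (weak)
   derivatives has a version with limit 0 at both ends of Lambda. *)
Definition boundary_conditions (k : nat) u : Prop :=
  forall l, (l < k)%N -> exists w,
    [/\ is_weak_derivative l u w,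
        w x @[x --> (-1)^'+] --> (0 : R) & w x @[x --> 1^'-] --> (0 : R)].

(* The integrability clause says that (f, v) is a convergent integral. The
   conditions u^(l)(-1) = u^(l)(1) = 0 are stated separately: for k >= 2 they
   do not follow from membership of u in U. *)
Definition weak_solution (k : nat) (s : R) f u : Prop :=
  [/\ U k s u, boundary_conditions k u &
      forall v, V k s v ->
        mu.-integrable Lambda (fun x : R => (f x * v x)%:E) /\
        inner (RL_derivative s u) (weak_derivative k v) = inner f v].

Definition discrete_solution (k : nat) (s : R) f (N : nat) (uN : R -> R) : Prop :=
  Fplus k s N uN /\
  forall vN, Fminus k s N vN ->
    inner (RL_derivative s uN) (weak_derivative k vN) = inner f vN.

End Spaces.

(* Main.v *)
(* Write [b = s - k], [e = u - u_N] and [g] for its right derivative of order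
   [s], [<., .>_l] for the inner product of weight [w_l = omega l (b + l)].

   Stability. By the boundary conditions, [e] is a [k - 1]-fold iterated integral
   of [e^(k-1)]; composing Abel kernels (a Beta integral) shows that
   [e^(k-1)] is a multiple of [int_x^1 (y - x)^b g(y) dy]. Hence [g] is
   orthogonal to [P_{k-1}] for [<., .>_0] (the zeroth moment vanishes because
   [e^(k-1)] tends to [0] at [-1] while a nonzero moment would be its limit), and
   a Schur test bounds [e] by [g].

   Galerkin orthogonality. If a polynomial [t] of degree at most [N] is orthogonal
   to [P_{k-1}], then [(1 + x)^b t] is the [k]-th derivative of some
   [(1 - x)^k (1 + x)^s q], a discrete test function; so [g] is orthogonal to
   [P_N], and [<g, p>_0 = <D_+^s u, p>_0] for every polynomial [p] orthogonal to
   [P_N].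

   Rate. Such a [p] satisfies [w_0 p = (w_m q)^(m)] for a polynomial [q], and [m]
   successive Sturm-Liouville inequalities give
   [|q|_m <= (m / N)^m |p|_0]. Integrating by parts (smooth cutoffs remove the
   boundary) yields [|<g, p>_0| <= (m / N)^m |D_+^(s+m) u|_m |p|_0], and polynomials
   are dense. *)
From HB Require Import structures.
Require Import Defs.
From mathcomp Require Import all_boot all_order all_algebra.
From mathcomp Require Import all_classical all_reals all_analysis.
From mathcomp Require Import measurable_realfun zify ring lra.
Set Implicit Arguments.
Unset Strict Implicit.
Unset Printing Implicit Defensive.
Import Order.TTheory GRing.Theory Num.Theory.
Import numFieldNormedType.Exports.
Local Open Scope classical_set_scope.
Local Open Scope ring_scope.

(** * Integrals on Lambda *)

Section IntegralsOnLambda.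
Context {R : realType}.
Notation mu := (@lebesgue_measure R).
Notation Lam := (@Lambda R).
Implicit Types (f g h : R -> R).

(** The obstacle is that [u] is known only through weighted integrability of weak derivatives: no
    expansion in Jacobi polynomials is at hand and [D_+^s u] carries no boundary values. The rate is
    therefore proved by duality, with derivatives and orthogonality moved onto polynomials. There,
    degree counting for a triangular symmetric operator replaces a spectral theorem, so no
    orthogonal basis of eigenfunctions is constructed. The operators [Jr] and [Jl] omit the Gamma
    factor, which enters only through the nonzero constant [cRL]. As b = s - k lies in (-1, 0), both
    b and - b - 1 are exponents of integrable kernels, and their sum is -1: [Jr b] and
    [Jr (- b - 1)] compose to a multiple of [Jr 0], integration from x to 1. This is what inverts
    the fractional derivative. The final constant is K0 m^m with K0 depending on k and s alone: each
    of the m Sturm-Liouville eigenvalues is bounded below by (N / m)^2, which costs the factor m^m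
    after m square roots. *)

Definition integL f := mu.-integrable Lam (EFin \o f).
Definition aeL (P : R -> Prop) := {ae mu, forall x, Lam x -> P x}.

Lemma LamE x : Lam x <-> -1 < x < 1.
Proof. by rewrite /Lambda /= in_itv. Qed.

Lemma measurable_Lam : measurable (Lam : set R).
Proof. by rewrite /Lambda; exact: measurable_itv. Qed.
Local Hint Extern 0 (@measurable _ _ (@Lambda _)) =>
  solve [apply: measurable_Lam] : core.

Lemma measurable_LamR : measurable (Lam : set (measurableTypeR R)).
Proof. exact: measurable_Lam. Qed.

Lemma mu_Lam : mu Lam = 2%:E.
Proof.
rewrite /Lambda lebesgue_measure_itv/= lte_fin ifT; last by lra.
by rewrite -EFinB; congr (_%:E); lra.
Qed.

Lemma open_Lam : open Lam.
Proof. by rewrite /Lambda; exact: interval_open. Qed.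

Lemma integL_meas f : integL f -> measurable_fun Lam f.
Proof. by move=> /integrableP[/measurable_EFinP]. Qed.

Lemma integL_le f g : measurable_fun Lam f -> integL g ->
  (forall x, Lam x -> `|f x| <= g x) -> integL f.
Proof.
move=> mf ig fg; apply: le_integrable ig => //; first exact/measurable_EFinP.
by move=> x Lx /=; rewrite lee_fin (le_trans (fg _ Lx))// ler_norm.
Qed.

Lemma integLD f g : integL f -> integL g -> integL (fun x => f x + g x).
Proof.
move=> intf intg; rewrite /integL (_ : _ \o _ = (EFin \o f) \+ (EFin \o g))%E//.
exact: integrableD.
Qed.

Lemma integLB f g : integL f -> integL g -> integL (fun x => f x - g x).
Proof.
move=> intf intg; rewrite /integL (_ : _ \o _ = (EFin \o f) \- (EFin \o g))%E//.
exact: integrableB.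
Qed.

Lemma integLZ c f : integL f -> integL (fun x => c * f x).
Proof.
move=> intf; rewrite /integL (_ : _ \o _ = fun x => c%:E * (EFin \o f) x)%E//.
exact: integrableZl.
Qed.

Lemma integL_norm f : integL f -> integL (fun x => `|f x|).
Proof.
move=> intf; rewrite /integL (_ : _ \o _ = fun x => `|(EFin \o f) x|%E)//.
exact: integrable_abse.
Qed.

Lemma integL_cst c : integL (fun=> c).
Proof.
apply/integrableP; split; first exact: measurable_cst.
rewrite (eq_integral (cst `|c|%:E))// integral_cst//=.
by rewrite [X in (_ * X)%E]mu_Lam -EFinM ltry.
Qed.

Lemma integL_bounded f c : measurable_fun Lam f ->
  (forall x, Lam x -> `|f x| <= c) -> integL f.
Proof. move=> mf fc; exact: integL_le mf (integL_cst c) fc. Qed.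

Lemma integLMb f g c : integL f -> measurable_fun Lam g ->
  (forall x, Lam x -> `|g x| <= c) -> integL (fun x => f x * g x).
Proof.
move=> intf mg gc; apply: (@integL_le _ (fun x => c * `|f x|)).
- by apply: measurable_funM => //; exact: integL_meas.
- exact/integLZ/integL_norm.
- by move=> x Lx; rewrite normrM mulrC ler_wpM2r// gc.
Qed.

Lemma eq_integL f g : (forall x, Lam x -> f x = g x) -> integL f -> integL g.
Proof.
move=> fg; apply: eq_integrable => // x /[!inE] Lx /=; by rewrite fg.
Qed.

Lemma ILZl c f : integL f ->
  \int[mu]_(x in Lam) (c * f x) = c * \int[mu]_(x in Lam) f x.
Proof. by move=> intf; rewrite RintegralZl. Qed.

Lemma ILZr c f : integL f ->
  \int[mu]_(x in Lam) (f x * c) = \int[mu]_(x in Lam) f x * c.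
Proof. by move=> intf; rewrite RintegralZr. Qed.

Lemma ILD f g : integL f -> integL g -> \int[mu]_(x in Lam) (f x + g x) =
  \int[mu]_(x in Lam) f x + \int[mu]_(x in Lam) g x.
Proof. by move=> intf intg; rewrite RintegralD. Qed.

Lemma ILB f g : integL f -> integL g -> \int[mu]_(x in Lam) (f x - g x) =
  \int[mu]_(x in Lam) f x - \int[mu]_(x in Lam) g x.
Proof. by move=> intf intg; rewrite RintegralB. Qed.

Lemma IL_le f g : integL f -> integL g -> (forall x, Lam x -> f x <= g x) ->
  \int[mu]_(x in Lam) f x <= \int[mu]_(x in Lam) g x.
Proof. by move=> intf intg fg; apply: le_Rintegral. Qed.

Lemma IL_ge0 f : (forall x, Lam x -> 0 <= f x) -> 0 <= \int[mu]_(x in Lam) f x.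
Proof. by move=> f0; apply: Rintegral_ge0. Qed.

Lemma le_norm_IL f : integL f ->
  `|\int[mu]_(x in Lam) f x| <= \int[mu]_(x in Lam) `|f x|.
Proof. by move=> intf; apply: le_normr_Rintegral. Qed.

Lemma integL_sum (I : Type) (r : seq I) (F : I -> R -> R) :
  (forall i, integL (F i)) -> integL (fun x => \sum_(i <- r) F i x).
Proof.
move=> iF; elim: r => [|i r IH].
  by apply: (@eq_integL (fun=> 0)) => [x _|]; [rewrite big_nil|exact: integL_cst].
by apply: (@eq_integL (fun x => F i x + \sum_(j <- r) F j x)) => [x _|];
  [rewrite big_cons|exact: integLD].
Qed.

Lemma eq_IL f g : (forall x, Lam x -> f x = g x) ->
  \int[mu]_(x in Lam) f x = \int[mu]_(x in Lam) g x.
Proof. by move=> fg; apply: eq_Rintegral => x /[!inE]/fg. Qed.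

Lemma IL_sum (I : Type) (r : seq I) (F : I -> R -> R) :
  (forall i, integL (F i)) ->
  \int[mu]_(x in Lam) (\sum_(i <- r) F i x) =
  \sum_(i <- r) \int[mu]_(x in Lam) F i x.
Proof.
move=> iF; elim: r => [|i r IH].
  rewrite big_nil (@eq_IL _ (fun=> 0)) => [|x _]; last by rewrite big_nil.
  by rewrite Rintegral_cst// mul0r.
rewrite big_cons -IH -RintegralD//.
- by apply: eq_IL => x _; rewrite big_cons.
- exact: iF.
- exact: integL_sum.
Qed.

Local Notation aeF := (ae_filter_ringOfSetsType mu).

Lemma aeL_and P Q : aeL P -> aeL Q -> aeL (fun x => P x /\ Q x).
Proof. by rewrite /aeL; apply: (@filterS2 _ _ aeF) => x HP HQ Lx; split; auto. Qed.

Lemma aeL_imp (P Q : R -> Prop) : (forall x, Lam x -> P x -> Q x) ->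
  aeL P -> aeL Q.
Proof. by rewrite /aeL => PQ; apply: (@filterS _ _ aeF) => x HP Lx; exact/PQ/HP. Qed.

Lemma aeL_all (P : R -> Prop) : (forall x, Lam x -> P x) -> aeL P.
Proof. by move=> H; rewrite /aeL; apply: aeW. Qed.

Lemma aeL_integL f g : measurable_fun Lam g -> aeL (fun x => f x = g x) ->
  integL f -> integL g.
Proof.
move=> mg fg intf; have mf := integL_meas intf.
move/integrableP : intf => [_ foo]; apply/integrableP; split.
  exact/measurable_EFinP.
suff -> : (\int[mu]_(x in Lam) `|(EFin \o g) x| =
    \int[mu]_(x in Lam) `|(EFin \o f) x|)%E by [].
apply: ae_eq_integral => //.
- by do 2 apply: measurableT_comp => //.
- by do 2 apply: measurableT_comp => //.
- by move: fg; rewrite /aeL; apply: (@filterS _ _ aeF) => x + Lx => /(_ Lx) /= ->.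
Qed.

Lemma aeL_IL f g : measurable_fun Lam f -> measurable_fun Lam g ->
  aeL (fun x => f x = g x) ->
  \int[mu]_(x in Lam) f x = \int[mu]_(x in Lam) g x.
Proof.
move=> mf mg fg; rewrite /Rintegral; congr fine; apply: ae_eq_integral => //.
- exact/measurable_EFinP.
- exact/measurable_EFinP.
- by move: fg; rewrite /aeL; apply: (@filterS _ _ aeF) => x + Lx => /(_ Lx) /= ->.
Qed.

Lemma EFin_IL f : integL f ->
  (\int[mu]_(x in Lam) f x)%:E = (\int[mu]_(x in Lam) (f x)%:E)%E.
Proof. by move=> intf; rewrite /Rintegral fineK//; exact: integrable_fin_num. Qed.

Lemma integL_ge0 f : measurable_fun Lam f -> (forall x, Lam x -> 0 <= f x) ->
  (\int[mu]_(x in Lam) (f x)%:E < +oo)%E -> integL f.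
Proof.
move=> mf f0 foo; apply/integrableP; split; first exact/measurable_EFinP.
by under eq_integral => x /[!inE] Lx do rewrite /= ger0_norm ?f0//.
Qed.

(** The quadratic form in (t, u) given by the integral of (t f + u g)^2 is nonnegative; at t = B, u
    = - C it equals B (A B - C^2). This settles B > 0, and B = 0 takes a separate choice of (t,
    u). *)
Lemma CauchySchwarzL f g : measurable_fun Lam f -> measurable_fun Lam g ->
  integL (fun x => f x ^+ 2) -> integL (fun x => g x ^+ 2) ->
  integL (fun x => f x * g x) /\
  (\int[mu]_(x in Lam) (f x * g x)) ^+ 2 <=
  (\int[mu]_(x in Lam) f x ^+ 2) * (\int[mu]_(x in Lam) g x ^+ 2).
Proof.
move=> mf mg if2 ig2.
have ifg : integL (fun x => f x * g x).
  apply: (@integL_le _ (fun x => f x ^+ 2 + g x ^+ 2)).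
  - exact: measurable_funM.
  - exact: integLD.
  - move=> x _; rewrite ler_norml; apply/andP; split; nra.
split=> //.
set A := \int[mu]_(x in _) (f x ^+ 2); set B := \int[mu]_(x in _) (g x ^+ 2).
set C := \int[mu]_(x in _) (f x * g x).
have A0 : 0 <= A by apply: Rintegral_ge0 => x _; exact: sqr_ge0.
have B0 : 0 <= B by apply: Rintegral_ge0 => x _; exact: sqr_ge0.
have key t u : 0 <= t ^+ 2 * A + 2 * (t * u) * C + u ^+ 2 * B.
  have -> : t ^+ 2 * A + 2 * (t * u) * C + u ^+ 2 * B =
    \int[mu]_(x in Lam) (t * f x + u * g x) ^+ 2.
    transitivity (\int[mu]_(x in Lam) (t ^+ 2 * f x ^+ 2
        + 2 * (t * u) * (f x * g x) + u ^+ 2 * g x ^+ 2)).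
      rewrite (@RintegralD _ _ _ mu _ (fun x => t ^+ 2 * f x ^+ 2
        + 2 * (t * u) * (f x * g x)))//.
      - rewrite RintegralD//; [|exact: integLZ|exact: integLZ].
        by rewrite !RintegralZl.
      - by apply: integLD; exact: integLZ.
      - exact: integLZ.
    by apply: eq_IL => x _; ring.
  by apply: Rintegral_ge0 => x _; exact: sqr_ge0.
have [B1|B1] := eqVneq B 0.
  have [C0|C0] := eqVneq C 0; first by rewrite C0 expr0n/= mulr_ge0.
  (* With B = 0 the form is affine in u, and this u gives it the value A - (A + 1) = -1. *)
  exfalso; have := key 1 (- (A + 1) / (2 * C)).
  rewrite B1 mulr0 addr0 expr1n !mul1r.
  have -> : 2 * (- (A + 1) / (2 * C)) * C = - (A + 1) by field.
  by lra.
have := key B (- C).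
have -> : B ^+ 2 * A + 2 * (B * - C) * C + (- C) ^+ 2 * B =
  B * (A * B - C ^+ 2) by ring.
by rewrite pmulr_rge0 ?subr_ge0// lt_def B1.
Qed.

End IntegralsOnLambda.
#[export] Hint Extern 0 (@measurable _ _ (@Lambda _)) =>
  solve [apply: measurable_Lam] : core.

(** * Affine change of variables *)

Section Affine.
Context {R : realType}.
Notation mu := (@lebesgue_measure R).

(** Lebesgue measure and the scaled pushforward [nu] agree on half-open intervals, hence everywhere;
    the formula is integration against [nu]. *)
Lemma ge0_integral_affine (al be : R) (f : R -> \bar R) : 0 < al ->
  measurable_fun setT f -> (forall x, 0 <= f x)%E ->
  (\int[mu]_x f x = al%:E * \int[mu]_x f (al * x + be)%R)%E.
Proof.
move=> al0 mf f0.
pose phi := (fun x => al * x + be) : measurableTypeR R -> measurableTypeR R.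
have mphi : measurable_fun setT phi.
  by apply: measurable_funD => //; apply: measurable_funM.
pose nal := NngNum (ltW al0).
pose nu0 := mscale nal (pushforward mu phi).
pose nu := nu0 mphi.
have nuE A : measurable A -> mu A = nu A.
  apply: lebesgue_measure_unique => _ [[a b]] _ <- /=.
  rewrite /nu /nu0 /mscale /pushforward /=.
  have -> : pushforward mu phi `]a, b] = mu `](a - be) / al, (b - be) / al].
    rewrite /pushforward; congr (mu _).
    apply/seteqP; split => x /=; rewrite /phi !in_itv/=.
    - by rewrite ltr_pdivrMr// ler_pdivlMr// => /andP[? ?]; apply/andP; split; lra.
    - by rewrite ltr_pdivrMr// ler_pdivlMr// => /andP[? ?]; apply/andP; split; lra.
  rewrite !lebesgue_measure_itv/= !lte_fin ltr_pM2r ?invr_gt0// ltrD2r.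
  case: ifPn => _; last by rewrite mule0.
  by rewrite -EFinB -EFinM; congr (_%:E); field; rewrite gt_eqF.
transitivity (\int[nu]_x f x)%E.
  by apply: eq_measure_integral => A mA _; exact: nuE.
rewrite /nu /nu0 ge0_integral_mscale//= ge0_integral_pushforward//.
Qed.

End Affine.

(** * The fundamental theorem of calculus with singular endpoints *)

Section FTCopen.
Context {R : realType}.
Notation mu := (@lebesgue_measure R).
Implicit Types (f F : R -> R) (a b : R).

(** The denominator n + 3 keeps the two endpoints apart: each is moved inwards by at most a third of
    the length. *)
Let an a b (n : nat) := a + (b - a) / n.+3%:R.
Let bn a b (n : nat) := b - (b - a) / n.+3%:R.

Let step a b n : a < b -> 0 < (b - a) / n.+3%:R.
Proof. by move=> ab; rewrite divr_gt0 ?subr_gt0. Qed.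

Let abn a b n : a < b -> a < an a b n /\ an a b n < bn a b n /\ bn a b n < b.
Proof.
move=> ab; have s0 := step n ab; rewrite /an /bn.
have : (b - a) / n.+3%:R <= (b - a) / 3.
  by apply: ler_pM; rewrite ?subr_ge0 ?(ltW ab)// lef_pV2 ?posrE// ler_nat.
by set t := _ / n.+3%:R in s0 * => h; split; [lra|split; lra].
Qed.

Let step_cvg a b : (b - a) / n.+3%:R @[n --> \oo] --> (0 : R).
Proof.
rewrite -[X in _ --> X](mulr0 (b - a)); apply: cvgMr.
have := @cvg_harmonic R; rewrite -(cvg_shiftn 2); apply: cvg_trans.
by apply: near_eq_cvg; near=> n; rewrite /= addn2.
Unshelve. all: by end_near. Qed.

Let an_cvg a b : an a b n @[n --> \oo] --> a.
Proof. by rewrite -[X in _ --> X]addr0; apply: cvgD; [exact: cvg_cst|exact: step_cvg]. Qed.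

Let bn_cvg a b : bn a b n @[n --> \oo] --> b.
Proof. by rewrite -[X in _ --> X]subr0; apply: cvgB; [exact: cvg_cst|exact: step_cvg]. Qed.

Let itv_cvg a b x : a < x < b -> \forall n \near \oo, an a b n <= x <= bn a b n.
Proof.
move=> /andP[ax xb]; near=> n; apply/andP; split.
- near: n; apply: cvgr_le (@an_cvg a b) _ ax.
- near: n; apply: cvgr_ge (@bn_cvg a b) _ xb.
Unshelve. all: by end_near. Qed.

Context (f F : R -> R) (a b la lb : R) (ab : a < b)
  (cf : forall x, a < x < b -> {for x, continuous f})
  (dF : forall x, a < x < b -> is_derive x 1 F (f x))
  (Fa : F x @[x --> a^'+] --> la) (Fb : F x @[x --> b^'-] --> lb).

Let FTCn n : (\int[mu]_(x in `[an a b n, bn a b n]) (f x)%:E =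
  (F (bn a b n) - F (an a b n))%:E)%E.
Proof.
have [h1 [h2 h3]] := abn n ab.
have cF x : a < x < b -> {for x, continuous F}.
  move=> xab; apply/differentiable_continuous/derivable1_diffP.
  exact: (@ex_derive _ _ _ _ _ _ _ (dF xab)).
rewrite EFinB; apply: continuous_FTC2 => //.
- apply: continuous_in_subspaceT => x; rewrite inE/= in_itv/= => /andP[? ?].
  by apply: cf; apply/andP; split; lra.
- split.
  + move=> x; rewrite in_itv/= => /andP[? ?].
    by apply: (@ex_derive _ _ _ _ _ _ _ (dF _)); apply/andP; split; lra.
  + by apply: cvg_at_right_filter; apply: cF; apply/andP; split; lra.
  + by apply: cvg_at_left_filter; apply: cF; apply/andP; split; lra.
- move=> x; rewrite in_itv/= => /andP[? ?].
  have xab : a < x < b by apply/andP; split; lra.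
  by rewrite derive1E (@derive_val _ _ _ _ _ _ _ (dF xab)).
Qed.

Let FTCn_cvg : (F (bn a b n) - F (an a b n)) @[n --> \oo] --> lb - la.
Proof.
apply: cvgB.
- move/cvg_at_leftP : Fb; apply; split => // n.
  by have [_ []] := abn n ab.
- move/cvg_at_rightP : Fa; apply; split => // n.
  by have [] := abn n ab.
Qed.

Let mf : measurable_fun `]a, b[ f.
Proof.
apply: open_continuous_measurable_fun; first exact: interval_open.
by move=> x; rewrite inE/= in_itv/=; exact: cf.
Qed.

(** Monotone convergence over closed subintervals, where the classical theorem applies.
    Integrability is a consequence here, which is how powers singular at an endpoint are shown to
    have a finite integral. *)
Lemma ge0_FTC_open : (forall x, a < x < b -> 0 <= f x) ->
  (\int[mu]_(x in `]a, b[) (f x)%:E = (lb - la)%:E)%E.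
Proof.
move=> f0.
have UE : \bigcup_n `[an a b n, bn a b n]%classic = `]a, b[%classic.
  apply/seteqP; split => [x [n _]|x] /=.
    rewrite !in_itv/= => /andP[? ?]; have [? [? ?]] := abn n ab.
    by apply/andP; split; lra.
  rewrite in_itv/= => /itv_cvg[n _ /(_ n)] h; exists n => //=.
  by rewrite in_itv/= h/=.
have sub n : `[an a b n, bn a b n]%classic `<=` `]a, b[%classic.
  by rewrite -UE => x hx; exists n.
have nd : nondecreasing_seq (fun n => `[an a b n, bn a b n]%classic : set R).
  move=> n m nm; apply/subsetPset => x /=; rewrite !in_itv/= => /andP[h1 h2].
  have h : (b - a) / m.+3%:R <= (b - a) / n.+3%:R.
    apply: ler_pM; rewrite ?subr_ge0 ?(ltW ab)//.
    by rewrite lef_pV2 ?posrE// ler_nat.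
  move: h1 h2; rewrite /an /bn; move: h; set t := _ / m.+3%:R; set u := _ / n.+3%:R.
  by move=> h h1 h2; apply/andP; split; lra.
have h : (\int[mu]_(x in `[an a b n, bn a b n]) (f x)%:E)%E @[n --> \oo] -->
   (\int[mu]_(x in \bigcup_n `[an a b n, bn a b n]%classic) (f x)%:E)%E.
  apply: ge0_nondecreasing_set_cvg_integral => //.
  - by move=> n; apply/measurable_EFinP; apply: measurable_funS mf.
  - move=> n x /sub /=; rewrite in_itv/= => xab.
    by rewrite lee_fin f0.
rewrite -UE; apply: (cvg_unique _ h) => //.
rewrite (_ : (fun n => _) = EFin \o (fun n => F (bn a b n) - F (an a b n))).
  by apply: cvg_EFin; [near=> n|exact: FTCn_cvg].
by apply/funext => n; rewrite FTCn.
Unshelve. all: by end_near. Qed.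

(** For integrands of any sign, dominated convergence with the absolute value of the integrand as
    majorant. *)
Lemma FTC_open : mu.-integrable `]a, b[ (EFin \o f) ->
  \int[mu]_(x in `]a, b[) f x = lb - la.
Proof.
move=> intf.
have [] := @dominated_convergence _ _ _ mu `]a, b[ _
  (fun n => (EFin \o f) \_ `[an a b n, bn a b n]%classic) (EFin \o f)
  (fun x => `|(EFin \o f) x|%E).
- by [].
- move=> n; apply/(measurable_restrict _ _) => //.
  by apply: measurable_funS (measurable_int _ intf) => //; exact: subIsetl.
- exact: measurable_int intf.
- apply: aeW => x /=; rewrite in_itv/= => xab.
  apply: cvg_near_cst; have := itv_cvg xab; apply: filterS => n h.
  by rewrite patchE mem_set//= in_itv/= h.
- exact: integrable_abse.
- apply: aeW => x n _; rewrite patchE; case: ifPn => _ //.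
  by rewrite abse0.
move=> _ _ h; apply/EFin_inj; rewrite /Rintegral fineK; last first.
  exact: integrable_fin_num.
apply: (cvg_unique _ h) => //.
rewrite (_ : [sequence _]_n = fun n => (F (bn a b n) - F (an a b n))%:E).
  by apply: cvg_EFin; [near=> n|exact: FTCn_cvg].
apply/funext => n /=; rewrite -FTCn -integral_mkcondr; congr integral.
have [? [? ?]] := abn n ab.
apply/seteqP; split => x /=; rewrite !in_itv/=; first by case.
by move=> /andP[? ?]; split; apply/andP; split; lra.
Unshelve. all: by end_near. Qed.

End FTCopen.

(** * Fubini and Tonelli on the square Lambda x Lambda *)

Section FubiniOnLambda.
Context {R : realType}.
Notation mu := (@lebesgue_measure R).
Notation Lam := (@Lambda R).

(** Multiplying by the two indicators turns iterated integrals over Lambda into integrals over the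
    whole plane, where the product-measure theorems apply. *)
Let cut (F : R * R -> R) z := F z * (\1_Lam z.1 * \1_Lam z.2).

Let measurable_cut F : measurable_fun setT F -> measurable_fun setT (cut F).
Proof.
move=> mF; apply: measurable_funM => //; apply: measurable_funM.
- by apply: measurableT_comp measurable_fst; exact: measurable_indic.
- by apply: measurableT_comp measurable_snd; exact: measurable_indic.
Qed.

Let cut_fst F x : (\int[mu]_y (cut F (x, y))%:E =
  ((fun x => \int[mu]_(y in Lam) (F (x, y))%:E) \_ Lam) x)%E.
Proof.
rewrite patchE; case: ifPn => Lx.
  rewrite [RHS]integral_mkcond; apply: eq_integral => y _.
  rewrite patchE /cut /= [\1_Lam x]indicE Lx mul1r indicE.
  by case: (y \in Lam); rewrite ?mulr1 ?mulr0.
rewrite integral0_eq// => y _.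
by rewrite /cut /= [\1_Lam x]indicE (negbTE Lx) mul0r mulr0.
Qed.

Let cut_snd F y : (\int[mu]_x (cut F (x, y))%:E =
  ((fun y => \int[mu]_(x in Lam) (F (x, y))%:E) \_ Lam) y)%E.
Proof.
rewrite patchE; case: ifPn => Ly.
  rewrite [RHS]integral_mkcond; apply: eq_integral => x _.
  rewrite patchE /cut /= [\1_Lam y]indicE Ly mulr1 indicE.
  by case: (x \in Lam); rewrite ?mulr1 ?mulr0.
rewrite integral0_eq// => x _.
by rewrite /cut /= [\1_Lam y]indicE (negbTE Ly) !mulr0.
Qed.

Lemma measurable_intL1 (F : R * R -> R) : measurable_fun setT F ->
  (forall z, 0 <= F z) ->
  measurable_fun Lam (fun x => \int[mu]_(y in Lam) (F (x, y))%:E)%E.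
Proof.
move=> mF F0; apply/(measurable_restrictT _ measurable_Lam).
rewrite (_ : _ \_ _ = fun x => \int[mu]_y (cut F (x, y))%:E)%E; last first.
  by apply/funext => x; rewrite -cut_fst.
have mG : measurable_fun setT (EFin \o cut F).
  by apply/measurable_EFinP; exact: measurable_cut.
have G0 z : (0 <= (EFin \o cut F) z)%E by rewrite lee_fin !mulr_ge0.
exact: (measurable_fun_fubini_tonelli_F (m2 := mu) (EFin \o cut F) mG G0).
Qed.

Lemma measurable_intL2 (F : R * R -> R) : measurable_fun setT F ->
  (forall z, 0 <= F z) ->
  measurable_fun Lam (fun y => \int[mu]_(x in Lam) (F (x, y))%:E)%E.
Proof.
move=> mF F0; apply/(measurable_restrictT _ measurable_Lam).
rewrite (_ : _ \_ _ = fun y => \int[mu]_x (cut F (x, y))%:E)%E; last first.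
  by apply/funext => y; rewrite -cut_snd.
have mG : measurable_fun setT (EFin \o cut F).
  by apply/measurable_EFinP; exact: measurable_cut.
have G0 z : (0 <= (EFin \o cut F) z)%E by rewrite lee_fin !mulr_ge0.
exact: (measurable_fun_fubini_tonelli_G (m1 := mu) (EFin \o cut F) mG G0).
Qed.

Lemma tonelliL (F : R * R -> R) : measurable_fun setT F ->
  (forall z, 0 <= F z) ->
  (\int[mu]_(x in Lam) \int[mu]_(y in Lam) (F (x, y))%:E =
   \int[mu]_(y in Lam) \int[mu]_(x in Lam) (F (x, y))%:E)%E.
Proof.
move=> mF F0.
have mG : measurable_fun setT (EFin \o cut F).
  by apply/measurable_EFinP; exact: measurable_cut.
have G0 z : (0 <= (EFin \o cut F) z)%E by rewrite lee_fin !mulr_ge0.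
have := fubini_tonelli (m1 := mu) (m2 := mu) (EFin \o cut F) mG G0.
under eq_integral do rewrite /= cut_fst.
under [RHS]eq_integral do rewrite /= cut_snd.
by rewrite -!integral_mkcond.
Qed.

(** The inner integrals in Fubini's theorem are extended reals, finite only almost everywhere;
    [fine] alters them on a null set. *)
Lemma integrable_fineL (f : R -> \bar R) : mu.-integrable Lam f ->
  integL (fun x => fine (f x)) /\
  fine (\int[mu]_(x in Lam) f x) = \int[mu]_(x in Lam) fine (f x).
Proof.
move=> intf; have mf := measurable_int _ intf.
have mff : measurable_fun Lam (fun x => (fine (f x))%:E).
  by apply/measurable_EFinP; apply: measurableT_comp.
have fE : ae_eq mu Lam f (fun x => (fine (f x))%:E).
  have := integrable_ae measurable_LamR intf.
  apply: (@filterS _ _ (ae_filter_ringOfSetsType mu)) => x + Lx.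
  by move=> /(_ Lx) /fineK ->.
split; last first.
  by rewrite /Rintegral; congr fine; apply: ae_eq_integral.
apply: le_integrable intf => // x _ /=.
by case: (f x) => [r| |] //=; rewrite ?normr0 ?lee_fin ?leey.
Qed.

Let fubini_half (F : R * R -> R) : measurable_fun setT F ->
  (\int[mu]_(x in Lam) \int[mu]_(y in Lam) `|F (x, y)|%:E < +oo)%E ->
  [/\ aeL (fun x => integL (fun y => F (x, y))),
      integL (fun x => \int[mu]_(y in Lam) F (x, y)),
      fine (\int[mu]_(x in Lam) \int[mu]_(y in Lam) (F (x, y))%:E) =
      \int[mu]_(x in Lam) \int[mu]_(y in Lam) F (x, y) &
      (\int[mu]_(x in Lam) \int[mu]_(y in Lam) (F (x, y))%:E =
      \int[mu]_(y in Lam) \int[mu]_(x in Lam) (F (x, y))%:E)%E].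
Proof.
move=> mF Foo.
have mG : measurable_fun setT (EFin \o cut F).
  by apply/measurable_EFinP; exact: measurable_cut.
have iG : (mu \x mu)%E.-integrable setT (EFin \o cut F).
  apply/integrable12ltyP; first exact: mG.
  have cutn x y : `|(EFin \o cut F) (x, y)|%E =
      (cut (fun z => `|F z|) (x, y))%:E.
    rewrite /= /cut /= normrM [X in _ * X]ger0_norm//.
  under eq_integral do under eq_integral do rewrite cutn.
  under eq_integral do rewrite cut_fst.
  by rewrite -integral_mkcond.
have ae1 : aeL (fun x => integL (fun y => F (x, y))).
  have := ae_integrable1 iG; rewrite /aeL.
  apply: (@filterS _ _ (ae_filter_ringOfSetsType mu)) => x ix Lx.
  apply/(integrable_mkcond _ measurable_LamR).
  apply: eq_integrable ix => // y _.
  rewrite /cut patchE /= [\1_Lam x]indicE mem_set// mul1r indicE.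
  by case: (y \in Lam); rewrite ?mulr1 ?mulr0.
have i1 : mu.-integrable Lam
    (fun x => \int[mu]_(y in Lam) (F (x, y))%:E)%E.
  apply/(integrable_mkcond _ measurable_LamR).
  by apply: eq_integrable (integrable_fubini_F iG) => // x _; exact: cut_fst.
have [i2 e2] := integrable_fineL i1.
split; [exact: ae1|exact: i2|exact: e2|].
have := Fubini iG.
under eq_integral do rewrite /= cut_fst.
under [RHS]eq_integral do rewrite /= cut_snd.
by rewrite -!integral_mkcond.
Qed.

Lemma fubiniL (F : R * R -> R) : measurable_fun setT F ->
  (\int[mu]_(x in Lam) \int[mu]_(y in Lam) `|F (x, y)|%:E < +oo)%E ->
  [/\ aeL (fun x => integL (fun y => F (x, y))),
      integL (fun x => \int[mu]_(y in Lam) F (x, y)),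
      integL (fun y => \int[mu]_(x in Lam) F (x, y)) &
      \int[mu]_(x in Lam) \int[mu]_(y in Lam) F (x, y) =
      \int[mu]_(y in Lam) \int[mu]_(x in Lam) F (x, y)].
Proof.
move=> mF Foo; have [ae1 i1 e1 e] := fubini_half mF Foo.
(* Integrability in the second variable is the first half for the transposed function. *)
pose F' z := F (z.2, z.1).
have mF' : measurable_fun setT F'.
  apply: (measurableT_comp mF (g := fun z => (z.2, z.1))).
  exact: measurable_swap.
have Foo' : (\int[mu]_(x in Lam) \int[mu]_(y in Lam) `|F' (x, y)|%:E < +oo)%E.
  have /= <- := @tonelliL (fun z => `|F z|) _ _ => //.
  exact: measurableT_comp.
have [_ i2 e2 _] := fubini_half mF' Foo'.
by split; [exact: ae1|exact: i1|exact: i2|rewrite -e1 -e2 e].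
Qed.

End FubiniOnLambda.

(** * Truncated powers and Beta integrals *)

Section TruncatedPower.
Context {R : realType}.
Notation mu := (@lebesgue_measure R).
Notation Lam := (@Lambda R).
Implicit Types (c p q x y t : R).

(** The value at t = 0 is 0 even for c = 0, so [tpow 0] is the indicator of t > 0. With the kernel
    [tpow c (y - x)], integrals over ]x, 1[ become integrals over Lambda. *)
Definition tpow c t : R := if 0 < t then t `^ c else 0.

Lemma tpow_ge0 c t : 0 <= tpow c t.
Proof. by rewrite /tpow; case: ifP => // _; exact: powR_ge0. Qed.

Lemma tpowE c t : 0 < t -> tpow c t = t `^ c.
Proof. by rewrite /tpow => ->. Qed.

Lemma tpow0 c t : t <= 0 -> tpow c t = 0.
Proof. by rewrite /tpow ltNge => ->. Qed.

Lemma measurable_tpow c : measurable_fun setT (tpow c).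
Proof.
apply: measurable_fun_ifT.
- exact: measurable_fun_ltr.
- exact: measurable_powR.
- exact: measurable_cst.
Qed.

Lemma is_derive_powR c x : 0 < x ->
  is_derive x 1 (fun t => t `^ c) (c * x `^ (c - 1)).
Proof.
move=> x0; have xi : x \in `]0, +oo[ by rewrite in_itv/= x0.
apply: DeriveDef; first exact: (@derivable_powR R 1 c x xi).
by rewrite -derive1E powR_derive1.
Qed.

Lemma is_deriveMR (f g : R -> R) x l m : is_derive x 1 f l -> is_derive x 1 g m ->
  is_derive x 1 (fun z => f z * g z) (l * g x + f x * m).
Proof.
move=> df dg; have := is_deriveM df dg.
by rewrite /GRing.scale/= addrC (mulrC l).
Qed.

Lemma is_deriveZR (f : R -> R) x k l : is_derive x 1 f l ->
  is_derive x 1 (fun z => k * f z) (k * l).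
Proof. by move=> df; have := is_deriveZ k df. Qed.

Lemma is_derive_continuous (f : R -> R) x l :
  is_derive x 1 f l -> {for x, continuous f}.
Proof.
move=> df; apply/differentiable_continuous/derivable1_diffP.
exact: (@ex_derive _ _ _ _ _ _ _ df).
Qed.

Lemma is_derive_powRD c (be x : R) : 0 < be + x ->
  is_derive x 1 (fun t => (be + t) `^ c) (c * (be + x) `^ (c - 1)).
Proof.
move=> h; have hd : is_derive x 1 (fun t : R => be + t) 1.
  by rewrite -[X in is_derive _ _ _ X]add0r; apply: is_deriveD.
have := @is_derive1_comp _ (fun t => t `^ c) (fun t => be + t) x _ _
  (is_derive_powR c h) hd.
by rewrite mulr1.
Qed.

Lemma is_derive_powRB c (be x : R) : 0 < be - x ->
  is_derive x 1 (fun t => (be - t) `^ c) (- (c * (be - x) `^ (c - 1))).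
Proof.
move=> h; have hd : is_derive x 1 (fun t : R => be - t) (-1).
  by rewrite -[X in is_derive _ _ _ X]add0r; apply: is_deriveD.
have := @is_derive1_comp _ (fun t => t `^ c) (fun t => be - t) x _ _
  (is_derive_powR c h) hd.
by rewrite mulrN1.
Qed.

Lemma powRD_continuous c be x : 0 < x - be ->
  {for x, continuous (fun t => (t - be) `^ c)}.
Proof.
rewrite addrC => h; have := is_derive_continuous (is_derive_powRD c h).
rewrite (_ : (fun t => (- be + t) `^ c) = fun t => (t - be) `^ c)//.
by apply/funext => t; rewrite addrC.
Qed.

Lemma powRB_continuous c be x : 0 < be - x ->
  {for x, continuous (fun t => (be - t) `^ c)}.
Proof. by move=> h; apply: is_derive_continuous (is_derive_powRB c h). Qed.

Lemma powRD_cvg0 c be : 0 < c -> (x - be) `^ c @[x --> be^'+] --> (0 : R).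
Proof.
move=> c0; apply/cvg_at_rightP => u [bu ub].
have /cvg_at_rightP := powR_cvg0 c0; apply; split.
  by move=> n; rewrite subr_gt0.
by rewrite -[X in _ --> X](subrr be); apply: cvgB => //; exact: cvg_cst.
Qed.

Lemma powRB_cvg0 c be : 0 < c -> (be - x) `^ c @[x --> be^'-] --> (0 : R).
Proof.
move=> c0; apply/cvg_at_leftP => u [bu ub].
have /cvg_at_rightP := powR_cvg0 c0; apply; split.
  by move=> n; rewrite subr_gt0.
by rewrite -[X in _ --> X](subrr be); apply: cvgB => //; exact: cvg_cst.
Qed.

Lemma integral_powRD c a b : -1 < c -> a < b ->
  (\int[mu]_(x in `]a, b[) ((x - a) `^ c)%:E =
   ((b - a) `^ (c + 1) / (c + 1))%:E)%E.
Proof.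
move=> c1 ab; have c10 : 0 < c + 1 by lra.
rewrite -[X in X%:E]subr0.
apply: (@ge0_FTC_open _ _ (fun x => (x - a) `^ (c + 1) / (c + 1))) => //.
- by move=> x /andP[ax xb]; apply: powRD_continuous; rewrite subr_gt0.
- move=> x /andP[ax xb].
  have h : 0 < - a + x by lra.
  have := is_deriveZR (c + 1)^-1 (is_derive_powRD (c + 1) h).
  rewrite addrK mulrA mulVf ?gt_eqF// mul1r [- a + x]addrC.
  rewrite (_ : (fun z => (c + 1)^-1 * (- a + z) `^ (c + 1)) = fun z => (z - a) `^ (c + 1) / (c + 1))//.
  by apply/funext => z; rewrite mulrC (addrC z).
- rewrite -(mul0r (c + 1)^-1); apply: cvgMl; exact: powRD_cvg0.
- apply: cvg_at_left_filter; apply: cvgMl.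
  by apply: powRD_continuous; rewrite subr_gt0.
- by move=> x _; exact: powR_ge0.
Qed.

Lemma integral_powRB c a b : -1 < c -> a < b ->
  (\int[mu]_(x in `]a, b[) ((b - x) `^ c)%:E =
   ((b - a) `^ (c + 1) / (c + 1))%:E)%E.
Proof.
move=> c1 ab; have c10 : 0 < c + 1 by lra.
rewrite -[X in X%:E](opprK) -[X in X%:E](sub0r).
apply: (@ge0_FTC_open _ _ (fun x => - ((b - x) `^ (c + 1) / (c + 1)))) => //.
- by move=> x /andP[ax xb]; apply: powRB_continuous; rewrite subr_gt0.
- move=> x /andP[ax xb].
  have h : 0 < b - x by lra.
  have := is_deriveZR (- (c + 1)^-1) (is_derive_powRB (c + 1) h).
  rewrite addrK mulrNN mulrA mulVf ?gt_eqF// mul1r.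
  rewrite (_ : (fun z => - (c + 1)^-1 * (b - z) `^ (c + 1)) = fun z => - ((b - z) `^ (c + 1) / (c + 1)))//.
  by apply/funext => z; rewrite mulNr mulrC.
- apply: cvgN; apply: cvg_at_right_filter; apply: cvgMl.
  by apply: powRB_continuous; rewrite subr_gt0.
- rewrite -oppr0 -(mul0r (c + 1)^-1); apply: cvgN; apply: cvgMl; exact: powRB_cvg0.
- by move=> x _; exact: powR_ge0.
Qed.

Lemma integral_tpowB c y : -1 < c -> Lam y ->
  (\int[mu]_(x in Lam) (tpow c (y - x))%:E =
   ((1 + y) `^ (c + 1) / (c + 1))%:E)%E.
Proof.
move=> c1 /LamE/andP[y0 y1].
rewrite (_ : 1 + y = y - -1); last by lra.
rewrite -integral_powRB// [LHS]integral_mkcond [RHS]integral_mkcond.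
apply: eq_integral => x _; rewrite !patchE; case: ifPn => Lx; case: ifPn => // yx.
- by rewrite tpowE// subr_gt0; move: yx; rewrite inE/= in_itv/= => /andP[].
- rewrite tpow0// subr_le0 leNgt; apply: contra yx.
  by move: Lx; rewrite !inE/= => /LamE/andP[h _] ?; rewrite in_itv/= h.
- exfalso; move/negP: Lx; apply; rewrite inE; apply/LamE.
  by move: yx; rewrite inE/= in_itv/= => /andP[-> /lt_trans]; apply.
Qed.

Lemma integral_tpowD c x : -1 < c -> Lam x ->
  (\int[mu]_(y in Lam) (tpow c (y - x))%:E =
   ((1 - x) `^ (c + 1) / (c + 1))%:E)%E.
Proof.
move=> c1 /LamE/andP[x0 x1].
rewrite -integral_powRD// [LHS]integral_mkcond [RHS]integral_mkcond.
apply: eq_integral => y _; rewrite !patchE; case: ifPn => Ly; case: ifPn => // yx.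
- by rewrite tpowE// subr_gt0; move: yx; rewrite inE/= in_itv/= => /andP[].
- rewrite tpow0// subr_le0 leNgt; apply: contra yx.
  by move: Ly; rewrite !inE/= => /LamE/andP[_ h] ?; rewrite in_itv/= h andbT.
- exfalso; move/negP: Ly; apply; rewrite inE; apply/LamE.
  by move: yx; rewrite inE/= in_itv/= => /andP[/(lt_trans x0) -> ->].
Qed.

End TruncatedPower.

Section Beta.
Context {R : realType}.
Notation mu := (@lebesgue_measure R).
Notation Lam := (@Lambda R).
Implicit Types (c p q x y t : R).

(** Euler's Beta function at (p + 1, q + 1); the truncations restrict the integral to ]0, 1[. *)
Definition betaf p q : R := fine (\int[mu]_y (tpow p y * tpow q (1 - y))%:E).

Lemma measurable_tpow_comp c (d : measure_display) (T : measurableType d)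
    (D : set T) (f : T -> R) :
  measurable_fun D f -> measurable_fun D (fun z => tpow c (f z)).
Proof. by move=> mf; apply: measurableT_comp (measurable_tpow c) mf. Qed.

Let measurable_beta p q : measurable_fun setT (fun y : R => tpow p y * tpow q (1 - y)).
Proof.
apply: measurable_funM; first exact: measurable_tpow.
by apply: measurable_tpow_comp; exact: measurable_funB.
Qed.

Lemma tpow_scale p al z : 0 < al -> tpow p (al * z) = al `^ p * tpow p z.
Proof.
move=> al0; have [z0|z0] := ltP 0 z.
  by rewrite !tpowE ?mulr_gt0// powRM ?ltW.
by rewrite !tpow0 ?mulr0// pmulr_rle0.
Qed.

Let powR_half q y : 2^-1 <= y < 1 -> y `^ q <= 1 + 2^-1 `^ q.
Proof.
move=> /andP[y2 y1]; have y0 : 0 < y by lra.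
have [q0|q0] := leP 0 q.
  apply: ler_wpDr; first exact: powR_ge0.
  have := ge0_ler_powR q0; move=> /(_ y 1); rewrite powR1.
  by apply; rewrite ?nnegrE; lra.
apply: ler_wpDl => //.
rewrite -(opprK q) !(powRN _ (- q)) lef_pV2 ?posrE ?powR_gt0//.
by apply: ge0_ler_powR; rewrite ?nnegrE; lra.
Qed.

(** On each half of ]0, 1[ only one factor can be singular and the other is bounded by [powR_half];
    hence the majorant C (y^p + (1 - y)^q), whose integral is explicit. *)
Lemma beta_lty p q : -1 < p -> -1 < q ->
  (\int[mu]_y (tpow p y * tpow q (1 - y))%:E < +oo)%E.
Proof.
move=> p1 q1.
have mq : measurable_fun setT (fun y : R => (1 - y) `^ q).
  apply: (@measurableT_comp _ _ _ _ _ _ (fun t => t `^ q)).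
    exact: measurable_powR.
  exact: measurable_funB.
pose C := (1 + 2^-1 `^ q) + (1 + 2^-1 `^ p).
have C0 : 0 < C by rewrite /C; have := powR_ge0 (2^-1 : R) q; have := powR_ge0 (2^-1 : R) p; lra.
have -> : (\int[mu]_y (tpow p y * tpow q (1 - y))%:E =
    \int[mu]_(y in `]0%R, 1%R[) (tpow p y * tpow q (1 - y))%:E)%E.
  rewrite [RHS]integral_mkcond; apply: eq_integral => y _; rewrite patchE.
  case: ifPn => // yn; have [y0|y0] := leP y 0; first by rewrite tpow0 ?mul0r.
  rewrite [tpow q _]tpow0 ?mulr0// subr_le0 leNgt; apply: contra yn => y1.
  by rewrite inE/= in_itv/= y0.
apply: (@le_lt_trans _ _ (\int[mu]_(y in `]0%R, 1%R[)
    (C%:E * (y `^ p + (1 - y) `^ q)%:E))%E).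
  apply: ge0_le_integral => //.
  - by move=> y _; rewrite lee_fin mulr_ge0 ?tpow_ge0.
  - by apply/measurable_EFinP; exact: measurable_funTS (measurable_beta _ _).
  - apply: measurable_funeM; apply/measurable_EFinP; apply: measurable_funD.
      exact: measurable_funTS (measurable_powR _).
    exact: measurable_funTS mq.
  - move=> y; rewrite /= in_itv/= => /andP[y0 y1].
    rewrite -EFinM lee_fin !tpowE ?subr_gt0//.
    have hp := powR_ge0 y p; have hq := powR_ge0 (1 - y) q.
    have h2p := powR_ge0 (2^-1 : R) p; have h2q := powR_ge0 (2^-1 : R) q.
    have [y2|y2] := leP y 2^-1.
      have h : (1 - y) `^ q <= 1 + 2^-1 `^ q by apply: powR_half; lra.
      by rewrite /C; nra.
    have h : y `^ p <= 1 + 2^-1 `^ p by apply: powR_half; lra.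
    by rewrite /C; nra.
rewrite ge0_integralZl//.
- rewrite lte_mul_pinfty ?lee_fin ?ltW//.
  under eq_integral do rewrite EFinD.
  rewrite ge0_integralD//.
  + have -> : (\int[mu]_(y in `]0%R, 1%R[) (y `^ p)%:E =
        \int[mu]_(y in `]0%R, 1%R[) ((y - 0) `^ p)%:E)%E.
      by apply: eq_integral => y _; rewrite subr0.
    by rewrite integral_powRD// integral_powRB// -EFinD ltry.
  + by move=> y _; rewrite lee_fin powR_ge0.
  + by apply/measurable_EFinP; exact: measurable_funTS (measurable_powR _).
  + by move=> y _; rewrite lee_fin powR_ge0.
  + by apply/measurable_EFinP; exact: measurable_funTS mq.
- apply/measurable_EFinP; apply: measurable_funD.
    exact: measurable_funTS (measurable_powR _).
  exact: measurable_funTS mq.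
- by move=> y _; rewrite lee_fin addr_ge0 ?powR_ge0.
- by rewrite lee_fin ltW.
Qed.

Lemma EFin_beta p q : -1 < p -> -1 < q ->
  (\int[mu]_y (tpow p y * tpow q (1 - y))%:E = (betaf p q)%:E)%E.
Proof.
move=> p1 q1; rewrite /betaf fineK// ge0_fin_numE ?beta_lty//.
by apply: integral_ge0 => y _; rewrite lee_fin mulr_ge0 ?tpow_ge0.
Qed.

(** A zero integral would make the integrand, positive on ]0, 1[, vanish almost everywhere.
    Positivity is what allows the Abel identities to be divided by this constant. *)
Lemma beta_gt0 p q : -1 < p -> -1 < q -> 0 < betaf p q.
Proof.
move=> p1 q1; rewrite lt_def; apply/andP; split; last first.
  by apply: fine_ge0; apply: integral_ge0 => y _; rewrite lee_fin mulr_ge0 ?tpow_ge0.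
apply/eqP => b0; have := EFin_beta p1 q1; rewrite b0 => i0.
have : (\int[mu]_y `|(tpow p y * tpow q (1 - y))%:E| = 0)%E.
  apply: etrans i0; apply: eq_integral => y _; rewrite gee0_abs// lee_fin.
  by rewrite mulr_ge0 ?tpow_ge0.
move/ae_eq_integral_abs => /(_ measurableT).
have mb : measurable_fun setT (fun y : R => (tpow p y * tpow q (1 - y))%:E).
  by apply/measurable_EFinP; exact: measurable_beta.
move=> /(_ mb) [N [mN N0 sN]].
have : (mu `]0%R, 1%R[ <= mu N)%E.
  apply: le_measure; rewrite ?inE//.
  apply: subset_trans sN => y /=; rewrite in_itv/= => /andP[y0 y1] h.
  have := h I; rewrite !tpowE ?subr_gt0// => -[] /eqP.
  by rewrite mulf_eq0 !gt_eqF// powR_gt0// subr_gt0.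
by rewrite N0 lebesgue_measure_itv/= lte_fin ltr01 oppr0 adde0 lee_fin ler10.
Qed.

(** The substitution y = x + (t - x) z and homogeneity of both kernels reduce this to the Beta
    integral; for t <= x both sides vanish by truncation. *)
Lemma tpow_conv p q x t : -1 < p -> -1 < q -> -1 <= x -> t <= 1 ->
  (\int[mu]_(y in Lam) (tpow p (y - x) * tpow q (t - y))%:E =
   (betaf p q * tpow (p + q + 1) (t - x))%:E)%E.
Proof.
move=> p1 q1 Lx Lt; have [tx|xt] := leP t x.
  rewrite [in RHS]tpow0 ?subr_le0// mulr0; apply: integral0_eq => y _.
  have [yx|xy] := leP y x; first by rewrite tpow0 ?mul0r// subr_le0.
  by rewrite [X in _ * X]tpow0 ?mulr0// subr_le0 (le_trans tx)// ltW.
have al0 : 0 < t - x by rewrite subr_gt0.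
transitivity (\int[mu]_y (tpow p (y - x) * tpow q (t - y))%:E)%E.
  rewrite integral_mkcond; apply: eq_integral => y _; rewrite patchE.
  case: ifPn => // Ly; have [yx|xy] := leP y x; first by rewrite tpow0 ?mul0r// subr_le0.
  rewrite [X in _ * X]tpow0 ?mulr0// subr_le0 leNgt; apply: contra Ly => yt.
  by rewrite inE; apply/LamE; lra.
rewrite (@ge0_integral_affine _ (t - x) x)//; last 2 first.
- apply/measurable_EFinP; apply: measurable_funM; apply: measurable_tpow_comp;
  exact: measurable_funB.
- by move=> y; rewrite lee_fin mulr_ge0 ?tpow_ge0.
under eq_integral => z _.
  rewrite (_ : tpow p _ = (t - x) `^ p * tpow p z); last first.
    by rewrite -tpow_scale//; congr tpow; ring.
  rewrite (_ : tpow q _ = (t - x) `^ q * tpow q (1 - z)); last first.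
    by rewrite -tpow_scale//; congr tpow; ring.
  rewrite mulrACA EFinM.
  over.
rewrite ge0_integralZl//; last 3 first.
- by apply/measurable_EFinP; exact: measurable_beta.
- by move=> y _; rewrite lee_fin mulr_ge0 ?tpow_ge0.
- by rewrite lee_fin mulr_ge0 ?powR_ge0.
rewrite EFin_beta// -!EFinM tpowE//; congr (_%:E).
rewrite powRD ?(gt_eqF al0) ?implybT// powRD ?(gt_eqF al0) ?implybT//.
by rewrite powRr1 ?(ltW al0)//; ring.
Qed.

End Beta.

(** * Abel integral operators *)

Section Volterra.
Context {R : realType}.
Notation mu := (@lebesgue_measure R).
Notation Lam := (@Lambda R).
Implicit Types (c p q x y t : R) (h phi : R -> R).

(* Riemann-Liouville integrals of order [c + 1], without the Gamma factor. *)
Definition Jr c h x : R := \int[mu]_(y in Lam) (tpow c (y - x) * h y).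
Definition Jl c h y : R := \int[mu]_(x in Lam) (tpow c (y - x) * h x).

Lemma measurable_restrL h : measurable_fun Lam h -> measurable_fun setT (h \_ Lam).
Proof. by move=> mh; apply/(measurable_restrictT _ measurable_Lam). Qed.

Lemma restrLE h x : Lam x -> (h \_ Lam) x = h x.
Proof. by move=> Lx; rewrite patchE mem_set. Qed.

Lemma measurable_tpow_sub c :
  measurable_fun setT (fun z : R * R => tpow c (z.2 - z.1)).
Proof.
apply: measurable_tpow_comp; apply: measurable_funB.
  exact: measurable_snd.
exact: measurable_fst.
Qed.

Lemma tpow_le c y : 0 <= c -> y <= 2 -> tpow c y <= 2 `^ c.
Proof.
move=> c0 y2; have [y0|y0] := ltP 0 y; last by rewrite tpow0 ?powR_ge0.
by rewrite tpowE// ge0_ler_powR// nnegrE ltW.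
Qed.

Lemma Lam_sub_le x y : Lam x -> Lam y -> y - x <= 2.
Proof. by move=> /LamE ? /LamE ?; lra. Qed.

Lemma measurable_tpowB c x : measurable_fun Lam (fun y : R => tpow c (y - x)).
Proof. by apply: measurable_tpow_comp; exact: measurable_funB. Qed.

Lemma measurable_tpowBl c y : measurable_fun Lam (fun x : R => tpow c (y - x)).
Proof. by apply: measurable_tpow_comp; exact: measurable_funB. Qed.

Lemma integral_tpowB_le c y : -1 < c -> Lam y ->
  (\int[mu]_(x in Lam) (tpow c (y - x))%:E <= (2 `^ (c + 1) / (c + 1))%:E)%E.
Proof.
move=> c1 Ly; rewrite integral_tpowB// lee_fin ler_pM2r ?invr_gt0; last by lra.
move/LamE : Ly => ?; apply: ge0_ler_powR; rewrite ?nnegrE; lra.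
Qed.

Lemma integrable_tpowBl c y : -1 < c -> Lam y -> integL (fun x => tpow c (y - x)).
Proof.
move=> c1 Ly; apply: integL_ge0.
- exact: measurable_tpowBl.
- by move=> x _; exact: tpow_ge0.
- by rewrite integral_tpowB// ltry.
Qed.

Lemma integrable_tpowB c x : -1 < c -> Lam x -> integL (fun y => tpow c (y - x)).
Proof.
move=> c1 Lx; apply: integL_ge0.
- exact: measurable_tpowB.
- by move=> y _; exact: tpow_ge0.
- by rewrite integral_tpowD// ltry.
Qed.

(** Tonelli with x innermost: for every y the kernel has integral in x at most 2^(c+1) / (c + 1), so
    integrability of [h] suffices even for an unbounded kernel. Restricting [h] and [phi] to Lambda
    makes the integrand measurable on the plane. *)
Let kern_lty c h phi M : -1 < c -> integL h -> measurable_fun Lam phi ->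
  (forall x, Lam x -> `|phi x| <= M) ->
  let F (z : R * R) := tpow c (z.2 - z.1) * (h \_ Lam) z.2 * (phi \_ Lam) z.1 in
  measurable_fun setT F /\
  (\int[mu]_(x in Lam) \int[mu]_(y in Lam) `|F (x, y)|%:E < +oo)%E.
Proof.
move=> c1 ih mphi phiM F; have mh := integL_meas ih.
have L0 : Lam 0 by apply/LamE; lra.
have M0 : 0 <= M by rewrite (le_trans _ (phiM 0 L0)).
have mF : measurable_fun setT F.
  apply: measurable_funM; first apply: measurable_funM.
  - exact: measurable_tpow_sub.
  - by apply: measurableT_comp measurable_snd; exact: measurable_restrL.
  - by apply: measurableT_comp measurable_fst; exact: measurable_restrL.
split=> //.
have mnF : measurable_fun setT (fun z => `|F z|) by exact: measurableT_comp.
rewrite (@tonelliL R (fun z => `|F z|) mnF)//.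
apply: (@le_lt_trans _ _
    (\int[mu]_(y in Lam) ((M * (2 `^ (c + 1) / (c + 1)))%:E * `|h y|%:E))%E).
  apply: ge0_le_integral => //.
  - by move=> y _; apply: integral_ge0 => x _; rewrite lee_fin.
  - exact: (measurable_intL2 mnF).
  - apply: measurable_funeM; apply/measurable_EFinP.
    exact: measurableT_comp.
  - move=> y Ly; apply: (@le_trans _ _
      (\int[mu]_(x in Lam) ((M * `|h y|)%:E * (tpow c (y - x))%:E))%E).
      apply: ge0_le_integral => //.
      + apply/measurable_EFinP; apply: measurableT_comp => //.
        apply: (measurable_funTS (D := Lam)).
        exact: (measurableT_comp (g := fun x => (x, y)) mF).
      + apply: measurable_funeM; apply/measurable_EFinP.
        exact: measurable_tpowBl.
      + move=> x Lx; rewrite -EFinM lee_fin /F /= !restrLE// !normrM.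
        rewrite (ger0_norm (tpow_ge0 _ _)) [leRHS]mulrC -mulrA.
        by rewrite ler_wpM2l ?tpow_ge0// mulrC ler_wpM2r// phiM.
    rewrite ge0_integralZl//.
    + rewrite [X in (X%:E * `|h y|%:E)%E]mulrC muleC -EFinM.
      rewrite (_ : (2 `^ (c + 1) / (c + 1) * M * `|h y|)%:E =
        ((2 `^ (c + 1) / (c + 1))%:E * (M * `|h y|)%:E)%E).
        by apply: lee_wpmul2r; [rewrite lee_fin mulr_ge0|exact: integral_tpowB_le].
      by rewrite -EFinM mulrA.
    + by apply/measurable_EFinP; exact: measurable_tpowBl.
    + by move=> x _; rewrite lee_fin tpow_ge0.
    + by rewrite lee_fin mulr_ge0.
have C0 : 0 <= M * (2 `^ (c + 1) / (c + 1)).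
  by rewrite mulr_ge0// divr_ge0 ?powR_ge0//; lra.
rewrite ge0_integralZl//.
- rewrite lte_mul_pinfty ?lee_fin//.
  by move/integrableP : ih => [].
- by apply/measurable_EFinP; exact: measurableT_comp.
Qed.

Lemma Jr_integL c h : -1 < c -> integL h ->
  aeL (fun x => integL (fun y => tpow c (y - x) * h y)) /\ integL (Jr c h).
Proof.
move=> c1 ih; have mh := integL_meas ih.
have c1b x : Lam x -> `|(cst 1 : R -> R) x| <= 1 by rewrite normr1.
have [mF Foo] := kern_lty c1 ih (measurable_cst _) c1b.
have [a1 i1 _ _] := fubiniL mF Foo; split.
  apply: aeL_imp a1 => x Lx; apply: eq_integL => y Ly /=.
  by rewrite !restrLE// mulr1.
apply: eq_integL i1 => x Lx; apply: eq_IL => y Ly /=.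
by rewrite !restrLE// mulr1.
Qed.

(** Fubini for the kernel. The integral defining [Jr c h x] converges only for almost every x, so
    [E1] is an identity almost everywhere; [E2] holds for every y because [phi] is bounded. *)
Lemma Jr_pair c h phi M : -1 < c -> integL h -> measurable_fun Lam phi ->
  (forall x, Lam x -> `|phi x| <= M) ->
  [/\ integL (fun x => Jr c h x * phi x),
      integL (fun y => h y * Jl c phi y) &
      \int[mu]_(x in Lam) (Jr c h x * phi x) =
      \int[mu]_(y in Lam) (h y * Jl c phi y)].
Proof.
move=> c1 ih mphi phiM; have mh := integL_meas ih.
have [aJ iJ] := Jr_integL c1 ih.
have [mF Foo] := kern_lty c1 ih mphi phiM.
have [_ i1 i2 e] := fubiniL mF Foo.
have mJp : measurable_fun Lam (fun x => Jr c h x * phi x).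
  by apply: measurable_funM; [exact: integL_meas|].
have E1 : aeL (fun x => \int[mu]_(y in Lam)
    (tpow c (y - x) * (h \_ Lam) y * (phi \_ Lam) x) = Jr c h x * phi x).
  apply: aeL_imp aJ => x Lx ix; rewrite (restrLE _ Lx) /Jr -(ILZr _ ix).
  by apply: eq_IL => y Ly; rewrite restrLE.
have E2 y : Lam y -> \int[mu]_(x in Lam)
    (tpow c (y - x) * (h \_ Lam) y * (phi \_ Lam) x) = h y * Jl c phi y.
  move=> Ly; rewrite (restrLE _ Ly) /Jl.
  rewrite -(ILZl _ (integLMb (integrable_tpowBl c1 Ly) mphi phiM)).
  by apply: eq_IL => x Lx; rewrite (restrLE _ Lx); ring.
split.
- exact: aeL_integL mJp E1 i1.
- by apply: eq_integL i2 => y Ly; exact: E2.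
- by rewrite -(aeL_IL (integL_meas i1) mJp E1) e; apply: eq_IL.
Qed.

(** Fubini and [tpow_conv]. The condition 0 <= p + q + 1 bounds the composed kernel, so the identity
    holds at every point of Lambda, although the integral defining [Jr q h] may converge only almost
    everywhere. *)
Lemma Jr_comp p q h x : -1 < p -> -1 < q -> 0 <= p + q + 1 -> integL h -> Lam x ->
  Jr p (Jr q h) x = betaf p q * Jr (p + q + 1) h x.
Proof.
move=> p1 q1 pq ih Lx; have mh := integL_meas ih.
have b0 := ltW (beta_gt0 p1 q1).
have x1 : -1 <= x by move/LamE : Lx => /andP[/ltW].
have L1 t : Lam t -> t <= 1 by move=> /LamE/andP[_ /ltW].
pose F (z : R * R) := tpow p (z.1 - x) * tpow q (z.2 - z.1) * (h \_ Lam) z.2.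
have mF : measurable_fun setT F.
  apply: measurable_funM; first apply: measurable_funM.
  - apply: measurable_tpow_comp; apply: measurable_funB.
      exact: measurable_fst.
    exact: measurable_cst.
  - exact: measurable_tpow_sub.
  - by apply: measurableT_comp measurable_snd; exact: measurable_restrL.
have mnF : measurable_fun setT (fun z => `|F z|) by exact: measurableT_comp.
have inner t : Lam t -> (\int[mu]_(y in Lam) `|F (y, t)|%:E =
    (betaf p q * tpow (p + q + 1) (t - x))%:E * `|h t|%:E)%E.
  move=> Lt; have t1 := L1 t Lt; rewrite -tpow_conv// -ge0_integralZr//.
  - apply: eq_integral => y _; rewrite -EFinM /F /= restrLE// normrM.
    by rewrite [X in X * _]ger0_norm// mulr_ge0 ?tpow_ge0.
  - apply/measurable_EFinP; apply: measurable_funM.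
      exact: measurable_tpowB.
    exact: measurable_tpowBl.
  - by move=> y _; rewrite lee_fin mulr_ge0 ?tpow_ge0.
have Foo : (\int[mu]_(y in Lam) \int[mu]_(t in Lam) `|F (y, t)|%:E < +oo)%E.
  rewrite (@tonelliL R (fun z => `|F z|) mnF)//.
  have ib : integL (fun t => `|h t| * (betaf p q * tpow (p + q + 1) (t - x))).
    apply: (@integLMb _ _ _ (betaf p q * 2 `^ (p + q + 1))).
    - exact: integL_norm.
    - by apply: measurable_funM => //; exact: measurable_tpowB.
    - move=> t Lt; rewrite ger0_norm ?mulr_ge0 ?tpow_ge0//.
      by apply: ler_wpM2l => //; exact/tpow_le/Lam_sub_le.
  move/integrableP : ib => [_]; apply: le_lt_trans; rewrite le_eqVlt; apply/orP; left.
  apply/eqP; apply: eq_integral => t; rewrite inE => Lt.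
  rewrite inner// -EFinM mulrC /= normrM normr_id; congr (_ * _)%:E.
  by rewrite ger0_norm// mulr_ge0 ?tpow_ge0.
have [_ _ _ e] := fubiniL mF Foo.
have [aJ iJ] := Jr_integL q1 ih.
transitivity (\int[mu]_(y in Lam) \int[mu]_(t in Lam) F (y, t)).
  have [a1 i1 _ _] := fubiniL mF Foo.
  apply: aeL_IL.
  - by apply: measurable_funM; [exact: measurable_tpowB|exact: integL_meas].
  - exact: integL_meas i1.
  apply: aeL_imp aJ => y Ly iy; rewrite /Jr -(ILZl _ iy).
  by apply: eq_IL => t Lt; rewrite /F /= (restrLE _ Lt) mulrA.
rewrite e /Jr -ILZl; last first.
  apply: eq_integL (@integLMb _ _ (fun t => tpow (p + q + 1) (t - x))
    (2 `^ (p + q + 1)) ih _ _).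
  - by move=> t _; rewrite mulrC.
  - exact: measurable_tpowB.
  - by move=> t Lt; rewrite ger0_norm ?tpow_ge0//; exact/tpow_le/Lam_sub_le.
apply: eq_IL => t Lt; have t1 := L1 t Lt; rewrite mulrA /F /=.
rewrite (@eq_IL _ _ (fun y => tpow p (y - x) * tpow q (t - y) * h t)); last first.
  by move=> y Ly; rewrite restrLE.
have ipq : integL (fun y => tpow p (y - x) * tpow q (t - y)).
  apply: integL_ge0.
  - by apply: measurable_funM; [exact: measurable_tpowB|exact: measurable_tpowBl].
  - by move=> y _; rewrite mulr_ge0 ?tpow_ge0.
  - by rewrite tpow_conv// ltry.
by rewrite (ILZr _ ipq); congr (_ * _); rewrite /Rintegral tpow_conv.
Qed.

Lemma ae_eq_Jr c h h' x : measurable_fun Lam h -> measurable_fun Lam h' ->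
  aeL (fun y => h y = h' y) -> Jr c h x = Jr c h' x.
Proof.
move=> mh mh' e; apply: aeL_IL.
- by apply: measurable_funM => //; exact: measurable_tpowB.
- by apply: measurable_funM => //; exact: measurable_tpowB.
- by apply: aeL_imp e => y _ ->.
Qed.

Lemma Jr_EFin_integrable c h x : 0 <= c -> integL h -> Lam x ->
  integL (fun y => tpow c (y - x) * h y).
Proof.
move=> c0 ih Lx; apply: eq_integL (@integLMb _ _ (fun t => tpow c (t - x))
    (2 `^ c) ih _ _).
- by move=> t _; rewrite mulrC.
- exact: measurable_tpowB.
- by move=> t Lt; rewrite ger0_norm ?tpow_ge0//; exact/tpow_le/Lam_sub_le.
Qed.

(** [Jr 0 h x] is the integral of [h] from x to 1. If it vanishes identically, the primitive of [h]
    from the left is constant on Lambda, and Lebesgue's differentiation theorem identifies [h] with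
    its zero derivative. *)
Lemma Jr0_eq0 h : integL h -> (forall x, Lam x -> Jr 0 h x = 0) ->
  aeL (fun x => h x = 0).
Proof.
move=> ih J0; pose f := h \_ Lam.
have ifT : mu.-integrable setT (EFin \o f).
  by rewrite /f -restrict_EFin; apply/(integrable_mkcond _ measurable_LamR).
have ifS y : mu.-integrable `]-oo, y] (EFin \o f).
  by apply: integrableS ifT.
have lf : locally_integrable setT f by exact: open_integrable_locally openT ifT.
have := FTC1Ny ifS lf; rewrite /aeL.
apply: (@filterS _ _ (ae_filter_ringOfSetsType mu)) => x [dF F'] Lx.
rewrite -(restrLE h Lx) -/f -F' derive1E.
have near_c : \forall y \near x,
    \int[mu]_(t in `]-oo, y]) f t = \int[mu]_(t in Lam) h t.
  have := open_nbhs_nbhs (conj open_Lam Lx); apply: filterS => y Ly.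
  have := J0 y Ly; rewrite /Jr => Jy.
  have e : integL (fun t => tpow 0 (t - y) * h t) by exact: Jr_EFin_integrable.
  have -> : \int[mu]_(t in Lam) h t =
      \int[mu]_(t in Lam) (h t - tpow 0 (t - y) * h t).
    by rewrite (ILB ih e) Jy subr0.
  rewrite [LHS]Rintegral_mkcond [RHS]Rintegral_mkcond.
  apply: eq_Rintegral => t _; rewrite /f !patchE.
  have [Lt|Lt] := boolP (t \in Lam); last by case: ifP.
  have tE : (t \in [set` `]-oo, y]]) = (t <= y).
    by apply/idP/idP; rewrite inE/= in_itv.
  rewrite tE; have [ty|ty] := leP t y.
    by rewrite tpow0 ?mul0r ?subr0// subr_le0.
  by rewrite tpowE ?powRr0 ?mul1r ?subrr// subr_gt0.
rewrite (@near_eq_derive _ _ _ _ (cst (\int[mu]_(t in Lam) h t)))//.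
by rewrite derive_cst.
Qed.

End Volterra.

(** * Smooth functions, test functions and weak derivatives *)

Section Smooth.
Context {R : realType}.
Notation mu := (@lebesgue_measure R).
Notation Lam := (@Lambda R).
Implicit Types (f g h phi : R -> R) (D : set R).

(** Recursing on the first derivative, rather than differentiating [derive1n] once more, lets the
    sum, product and substitution rules go by induction on n with the functions varying. *)
Fixpoint Cn D n f : Prop :=
  if n is n'.+1 then (forall x, D x -> derivable f x 1) /\ Cn D n' (derive1 f) else True.

Lemma derive1_eq_on D f g : open D -> {in D, f =1 g} -> {in D, (derive1 f) =1 (derive1 g)}.
Proof.
move=> oD fg x Dx; rewrite !derive1E; apply: near_eq_derive.
have := open_nbhs_nbhs (conj oD (set_mem Dx)); apply: filterS => y Dy.
by rewrite fg// mem_set.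
Qed.

Lemma derivable_eq_on D f g x : open D -> {in D, f =1 g} -> D x ->
  derivable f x 1 -> derivable g x 1.
Proof.
move=> oD fg Dx; apply: near_eq_derivable.
have := open_nbhs_nbhs (conj oD Dx); apply: filterS => y Dy.
by rewrite fg// mem_set.
Qed.

Lemma Cn_eq D n f g : open D -> {in D, f =1 g} -> Cn D n f -> Cn D n g.
Proof.
move=> oD; elim: n f g => [//|n IH] f g fg /= [df Cf]; split.
  by move=> x Dx; exact: (derivable_eq_on oD fg Dx (df _ Dx)).
exact: (IH _ _ (derive1_eq_on oD fg) Cf).
Qed.

Lemma derive1n_eq_on D n f g : open D -> {in D, f =1 g} ->
  {in D, (derive1n n f) =1 (derive1n n g)}.
Proof.
move=> oD fg; elim: n => [//|n IH].
by rewrite !derive1nS; exact: derive1_eq_on.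
Qed.

Lemma Cn_pred D n f : Cn D n.+1 f -> Cn D n f.
Proof. by elim: n f => [//|n IH] f [df Cf]; split => //; exact: IH. Qed.

Lemma Cn_derive1n D n f x : Cn D n.+1 f -> D x -> derivable (derive1n n f) x 1.
Proof.
elim: n f => [|n IH] f [df Cf] Dx; first exact: df.
by rewrite derive1Sn; exact: IH.
Qed.

Lemma CnD D n f g : open D -> Cn D n f -> Cn D n g -> Cn D n (fun x => f x + g x).
Proof.
move=> oD; elim: n f g => [//|n IH] f g [df Cf] [dg Cg]; split.
  by move=> x Dx; apply: derivableD; [exact: df|exact: dg].
apply: (Cn_eq oD) (IH _ _ Cf Cg) => x; rewrite inE => Dx.
by rewrite !derive1E deriveD//; [exact: df|exact: dg].
Qed.

Lemma CnM D n f g : open D -> Cn D n f -> Cn D n g -> Cn D n (fun x => f x * g x).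
Proof.
move=> oD; elim: n f g => [//|n IH] f g Cf' Cg'.
have [df Cf] := Cf'; have [dg Cg] := Cg'; split.
  by move=> x Dx; apply: derivableM; [exact: df|exact: dg].
apply: (Cn_eq oD) (CnD oD (IH _ _ (Cn_pred Cf') Cg) (IH _ _ (Cn_pred Cg') Cf)).
move=> x; rewrite inE => Dx.
by rewrite !derive1E deriveM//; [exact: df|exact: dg].
Qed.

Lemma Cn_cst D n (c : R) : open D -> Cn D n (fun=> c).
Proof.
move=> oD; elim: n c => [//|n IH] c; split; first by move=> x _; exact: derivable_cst.
by apply: (Cn_eq oD) (IH 0) => x _; rewrite derive1_cst.
Qed.

Lemma Cn_affine n f (al be : R) : Cn setT n f -> Cn setT n (fun x => f (al * x + be)).
Proof.
have daff (x : R) : is_derive x 1 (fun z : R => al * z + be) al.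
  rewrite -[X in is_derive _ _ _ X]addr0; apply: is_deriveD.
  by rewrite -[X in is_derive _ _ _ X](mulr1 al); exact: is_deriveZR.
have dcomp g (x : R) : (forall x : R, derivable g x 1) ->
    is_derive x 1 (fun z => g (al * z + be)) ((derive1 g) (al * x + be) * al).
  move=> dg; apply: (@is_derive1_comp _ g (fun z => al * z + be)) (daff x).
  by rewrite derive1E; exact/derivableP.
elim: n f => [//|n IH] f [df Cf]; split => [x _|].
  exact: (@ex_derive _ _ _ _ _ _ _ (dcomp f x (fun x => df x I))).
apply: (Cn_eq openT) (CnM openT (IH _ Cf) (Cn_cst n al openT)) => x _.
by rewrite [RHS]derive1E (@derive_val _ _ _ _ _ _ _ (dcomp f x (fun x => df x I))).
Qed.

(* Flat at [0], and closed under differentiation as [Q] varies. *)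
Definition expflat (Q : {poly R}) (t : R) : R :=
  if 0 < t then Q.[t^-1] * expR (- t^-1) else 0.

Lemma is_derive_horner (p : {poly R}) (x : R) :
  is_derive x 1 (fun z => p.[z]) (p^`()%R).[x].
Proof.
elim/poly_ind: p => [|p c IH].
  rewrite deriv0 horner0 (_ : (fun z => _) = cst 0); first exact: is_derive_cst.
  by apply/funext => z; rewrite horner0.
rewrite (_ : (fun z => _) = fun z => p.[z] * z + c); last first.
  by apply/funext => z; rewrite hornerMXaddC.
rewrite derivMXaddC hornerD hornerMX.
rewrite addrC -[X in _ + X]mulr1 -[X in is_derive _ _ _ X]addr0.
apply: is_deriveD.
exact: is_deriveMR IH (is_derive_id x (1 : R)).
Qed.

Lemma expX_le n (x : R) : 0 <= x -> x ^+ n <= n`!%:R * expR x.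
Proof.
case: n => [|n] x0.
  by rewrite expr0 fact0 mul1r; have := expR_ge1Dx x; lra.
have := expR_ge1Dxn n x0; set t := _ / _ => h.
have : t <= expR x by lra.
by rewrite /t ler_pdivrMr ?ltr0n ?fact_gt0// mulrC.
Qed.

Lemma horner_expR_bound (Q : {poly R}) :
  {C | 0 <= C & forall x, 0 <= x -> `|Q.[x]| * expR (- x) <= C}.
Proof.
exists (\sum_(i < size Q) `|Q`_i| * i`!%:R).
  by apply: sumr_ge0 => i _; rewrite mulr_ge0.
move=> x x0; rewrite expRN ler_pdivrMr ?expR_gt0// horner_coef mulr_suml.
apply: (le_trans (ler_norm_sum _ _ _)); apply: ler_sum => i _.
by rewrite normrM -mulrA ler_wpM2l// normrX ger0_norm// expX_le.
Qed.

(** In the variable x = 1 / t, flatness of order n is boundedness of (Q X^n)(x) e^(-x) for x >=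
    0. *)
Lemma expflat_le (Q : {poly R}) n :
  {C | 0 <= C & forall t, `|expflat Q t| <= C * `|t| ^+ n}.
Proof.
have [C C0 HC] := horner_expR_bound (Q * 'X^n); exists C => // t.
rewrite /expflat; case: ltP => t0; last by rewrite normr0 mulr_ge0// exprn_ge0.
rewrite normrM (ger0_norm (expR_ge0 _)) (gtr0_norm t0).
have ti0 : 0 <= t^-1 by rewrite invr_ge0 ltW.
have := HC _ ti0; rewrite hornerM hornerXn normrM normrX (ger0_norm ti0).
rewrite mulrAC exprVn ler_pdivrMr ?exprn_gt0// mulrC.
Qed.

Lemma is_derive0_sqr_bound (f : R -> R) (C : R) :
  (forall t, `|f t| <= C * `|t| ^+ 2) -> is_derive (0 : R) 1 f 0.
Proof.
move=> fC; have f0 : f 0 = 0.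
  by apply/eqP; rewrite -normr_le0 (le_trans (fC 0))// normr0 expr0n mulr0.
have C0 : 0 <= C by have := fC 1; rewrite normr1 expr1n mulr1; apply: le_trans.
have cv : h^-1 *: ((f \o shift 0) (h *: 1) - f 0) @[h --> 0^'] --> (0 : R).
  apply/cvgrPdist_le => e e0; near=> h.
  rewrite sub0r normrN /= f0 subr0 addr0 /GRing.scale/= mulr1.
  have h0 : h != 0 by near: h; exact: nbhs_dnbhs_neq.
  rewrite normrM normfV ler_pdivrMl ?normr_gt0// (le_trans (fC _))//.
  rewrite expr2 mulrCA ler_wpM2l//.
  have : `|h| <= e / (C + 1).
    near: h; apply: dnbhs0_le; rewrite divr_gt0//; lra.
  rewrite ler_pdivlMr; last by lra.
  by have := normr_ge0 h; nra.
apply: DeriveDef; first by apply/cvg_ex; exists 0.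
exact/cvg_lim.
Unshelve. all: by end_near. Qed.

(** For t > 0 the derivative of Q(1/t) e^(-1/t) is t^(-2) (Q - Q')(1/t) e^(-1/t), of the same form
    again; at t = 0 quadratic flatness gives the derivative 0. *)
Lemma is_derive_expflat (Q : {poly R}) (t : R) :
  is_derive t 1 (expflat Q) (expflat ('X^2 * (Q - Q^`()%R)) t).
Proof.
have [t0|t0|t0] := ltgtP t 0.
- rewrite /expflat ltNge (ltW t0)/=.
  apply: (@near_eq_is_derive _ _ _ (cst 0)).
  have := @lt_nbhsl R t 0 t0; apply: filterS => z z0.
  by rewrite ltNge (ltW z0).
- rewrite [X in is_derive _ _ _ X]/expflat t0.
  have ti : is_derive t 1 (fun z : R => z^-1) (- t^-1 ^+ 2).
    have t1 : id t != 0 :> R by rewrite /= gt_eqF.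
    have := is_deriveV t1 (is_derive_id t (1 : R)).
    by rewrite /GRing.scale/= mulr1 exprVn.
  pose g (z : R) : R := Q.[z^-1] * expR (- z^-1).
  apply: (@near_eq_is_derive _ _ _ g).
    have := @lt_nbhsr R 0 t t0; apply: filterS => z z0.
    by rewrite /g /expflat z0.
  have d1 := @is_derive1_comp _ (fun z => Q.[z]) (fun z : R => z^-1) t _ _
    (is_derive_horner Q t^-1) ti.
  have d2 := @is_derive1_comp _ expR (fun z : R => - z^-1) t _ _
    (is_derive_expR (- t^-1)) (is_deriveN ti).
  have h : is_derive t 1 g _ := is_deriveMR d1 d2.
  apply: (is_derive_eq h).
  by rewrite /= hornerM hornerXn hornerD hornerN; ring.
- have [C C0 HC] := expflat_le Q 2.
  rewrite t0 [X in is_derive _ _ _ X](_ : _ = 0).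
    exact: is_derive0_sqr_bound HC.
  by rewrite /expflat ltxx.
Qed.

Lemma Cn_expflat n (Q : {poly R}) : Cn setT n (expflat Q).
Proof.
elim: n Q => [//|n IH] Q; split.
  by move=> x _; exact: (@ex_derive _ _ _ _ _ _ _ (is_derive_expflat Q x)).
apply: (Cn_eq openT) (IH ('X^2 * (Q - Q^`()%R))) => x _.
by rewrite derive1E (@derive_val _ _ _ _ _ _ _ (is_derive_expflat Q x)).
Qed.


End Smooth.

Section TestFunctions.
Context {R : realType}.
Notation mu := (@lebesgue_measure R).
Notation Lam := (@Lambda R).
Implicit Types (f g h phi psi : R -> R).

Lemma DCTL (f_ : nat -> R -> R) (f g : R -> R) :
  (forall n, measurable_fun Lam (f_ n)) -> measurable_fun Lam f ->
  aeL (fun x => f_ n x @[n --> \oo] --> f x) -> integL g ->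
  (forall n x, Lam x -> `|f_ n x| <= g x) ->
  integL f /\
  \int[mu]_(x in Lam) f_ n x @[n --> \oo] --> \int[mu]_(x in Lam) f x.
Proof.
move=> mf_ mf cf ig fg.
have [] := @dominated_convergence _ _ _ mu Lam measurable_LamR
  (fun n => EFin \o f_ n) (EFin \o f) (EFin \o g).
- by move=> n; apply/measurable_EFinP; exact: mf_.
- by apply/measurable_EFinP; exact: mf.
- move: cf; rewrite /aeL; apply: (@filterS _ _ (ae_filter_ringOfSetsType mu)).
  move=> x cx Lx; apply: cvg_EFin; first by near=> n.
  exact: cx.
- exact: ig.
- by apply: aeW => x n Lx; rewrite /= lee_fin fg.
move=> i1 _ h; split; first exact: i1.
have i_ n : integL (f_ n) by exact: integL_le (mf_ n) ig (fg n).
have := h; rewrite -(EFin_IL i1).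
have -> : [sequence (\int[mu]_(x in Lam) (EFin \o f_ n) x)%E]_n =
    EFin \o (fun n => \int[mu]_(x in Lam) f_ n x).
  by apply/funext => n /=; rewrite -(EFin_IL (i_ n)).
by move/fine_cvg.
Unshelve. all: by end_near. Qed.

Lemma test_Cn phi n : test_function phi -> Cn setT n phi.
Proof.
case=> + _; elim: n phi => [//|n IH] phi H; split.
  by move=> x _; exact: (H 0%N x).
by apply: IH => m x; have := H m.+1 x; rewrite derive1Sn.
Qed.

Lemma Cn_test phi (a b : R) : (forall n, Cn setT n phi) -> -1 < a -> b < 1 ->
  (forall x, x \notin `[a, b] -> phi x = 0) -> test_function phi.
Proof.
move=> H a1 b1 ab; split; last by exists a, b.
by move=> n x; exact: (Cn_derive1n (H n.+1)).
Qed.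

Lemma derive1_supp (a b : R) f : (forall x, x \notin `[a, b] -> f x = 0) ->
  forall x, x \notin `[a, b] -> derive1 f x = 0.
Proof.
move=> H x xab; have o : open (~` `[a, b]%classic) :> Prop.
  by apply: closed_openC; exact: interval_closed.
have := @derive1_eq_on _ _ f (cst 0) o.
move=> /(_ _ x); rewrite derive1_cst; apply.
  by move=> y; rewrite inE/= => /negP; rewrite /= => yab; apply: H.
by rewrite inE/=; apply/negP.
Qed.

Lemma test_derive1 phi : test_function phi -> test_function (derive1 phi).
Proof.
move=> tp; have [dp [a [b [a1 b1 H]]]] := tp; split.
  by move=> n x; rewrite -derive1Sn; exact: dp.
by exists a, b; split => //; exact: derive1_supp.
Qed.

Lemma test_derive1n n phi : test_function phi -> test_function (derive1n n phi).
Proof.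
by elim: n phi => [//|n IH] phi tp; rewrite derive1Sn; exact/IH/test_derive1.
Qed.

Lemma test_lin phi psi (c : R) : test_function phi -> test_function psi ->
  test_function (fun x => phi x + c * psi x).
Proof.
move=> tp tq; have [_ [a [b [a1 b1 H]]]] := tp; have [_ [a' [b' [a1' b1' H']]]] := tq.
apply: (@Cn_test _ (Order.min a a') (Order.max b b')).
- move=> n; apply: (CnD openT); first exact: test_Cn.
  by apply: (CnM openT (Cn_cst n c openT)); exact: test_Cn.
- by rewrite lt_min a1.
- by rewrite gt_max b1.
- move=> x; rewrite in_itv/= ge_min le_max => h.
  rewrite H ?H' ?mulr0 ?addr0//; rewrite in_itv/=; apply: contra h => /andP[-> ->];
    by rewrite ?orbT.
Qed.

Lemma test_continuous phi : test_function phi -> continuous phi.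
Proof.
move=> [dp _] x; apply/differentiable_continuous/derivable1_diffP.
exact: (dp 0%N x).
Qed.

Lemma continuousL_measurable f : continuous f -> measurable_fun Lam f.
Proof. by move=> cf; apply: measurable_funTS; exact: continuous_measurable_fun. Qed.

Lemma test_measurable phi : test_function phi -> measurable_fun setT phi.
Proof. by move=> /test_continuous cf; exact: continuous_measurable_fun. Qed.

Lemma test_measurableL phi : test_function phi -> measurable_fun Lam phi.
Proof. by move=> /test_measurable; exact: measurable_funTS. Qed.

Lemma test_outside phi x : test_function phi -> ~ Lam x -> phi x = 0.
Proof.
move=> [_ [a [b [a1 b1 H]]]] nL; apply: H; rewrite in_itv/=.
by apply/negP => /andP[? ?]; apply: nL; apply/LamE; lra.
Qed.

Lemma test_bounded phi : test_function phi -> exists M, forall x, `|phi x| <= M.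
Proof.
move=> tp; have [_ [a [b [a1 b1 H]]]] := tp.
have ct : compact `[-1, 1 : R]%classic by exact: segment_compact.
have : bounded_set (phi @` `[-1, 1 : R]%classic).
  apply: compact_bounded; apply: continuous_compact => //.
  by apply: continuous_subspaceT; exact: test_continuous.
move=> [M [Mr HM]]; exists (`|M| + 1) => x.
have [Lx|nLx] := pselect (Lam x); last first.
  by rewrite (test_outside tp nLx) normr0.
apply: (HM (`|M| + 1)); first by rewrite (le_lt_trans (ler_norm _))// ltrDl.
exists x => //; rewrite /= in_itv/=; move/LamE: Lx => ?; apply/andP; split; lra.
Qed.

Lemma test_integL phi : test_function phi -> integL phi.
Proof.
move=> tp; have [M HM] := test_bounded tp.
by apply: (integL_bounded (test_measurableL tp)) => x _; exact: HM.
Qed.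

Lemma IL_tpow0_left f y : y <= 1 ->
  \int[mu]_(x in Lam) (tpow 0 (y - x) * f x) = \int[mu]_(x in `]-1, y[) f x.
Proof.
move=> y1; rewrite [LHS]Rintegral_mkcond [RHS]Rintegral_mkcond.
apply: eq_Rintegral => x _; rewrite !patchE.
have -> : (x \in [set` `]-1, y[]) = (x \in Lam) && (x < y).
  apply/idP/andP; rewrite !inE.
    rewrite /= in_itv/= => /andP[x1 xy]; split => //.
    by apply/LamE; rewrite x1 (lt_le_trans xy y1).
  by move=> [/LamE/andP[h _] xy]; rewrite /= in_itv/= h xy.
case: ifP => //= _; have [xy|yx] := ltP x y; last by rewrite tpow0 ?mul0r// subr_le0.
by rewrite tpowE ?subr_gt0// powRr0 mul1r.
Qed.

Lemma IL_tpow0_right f x : -1 <= x ->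
  \int[mu]_(y in Lam) (tpow 0 (y - x) * f y) = \int[mu]_(y in `]x, 1[) f y.
Proof.
move=> x1; rewrite [LHS]Rintegral_mkcond [RHS]Rintegral_mkcond.
apply: eq_Rintegral => y _; rewrite !patchE.
have -> : (y \in [set` `]x, 1[]) = (y \in Lam) && (x < y).
  apply/idP/andP; rewrite !inE.
    rewrite /= in_itv/= => /andP[xy y1]; split => //.
    by apply/LamE; rewrite y1 (le_lt_trans x1 xy).
  by move=> [/LamE/andP[_ h] xy]; rewrite /= in_itv/= h xy.
case: ifP => //= _; have [xy|yx] := ltP x y; last by rewrite tpow0 ?mul0r// subr_le0.
by rewrite tpowE ?subr_gt0// powRr0 mul1r.
Qed.

Lemma test_FTC phi y : test_function phi -> -1 < y <= 1 ->
  \int[mu]_(x in `]-1, y[) derive1 phi x = phi y.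
Proof.
move=> tp /andP[y0 y1]; have cp := test_continuous tp.
transitivity (phi y - 0); last by rewrite subr0.
apply: (@FTC_open _ _ phi) => //.
- by move=> x _; exact: (test_continuous (test_derive1 tp)).
- move=> x _; rewrite derive1E; apply/derivableP; case: tp => dp _; exact: (dp 0%N x).
- have <- : phi (-1) = 0 by apply: (test_outside tp) => /LamE; lra.
  exact/cvg_at_right_filter/cp.
- exact/cvg_at_left_filter/cp.
- have := test_integL (test_derive1 tp); apply: integrableS => //.
  move=> x; rewrite /= in_itv/= => /andP[h1 h2].
  by apply/LamE; rewrite h1 (lt_le_trans h2).
Qed.

Lemma Jl0_test phi y : test_function phi -> Lam y -> Jl 0 (derive1 phi) y = phi y.
Proof.
move=> tp /LamE/andP[y0 y1]; rewrite /Jl IL_tpow0_left ?(ltW y1)// test_FTC//.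
by rewrite y0 (ltW y1).
Qed.

(** To the right of the support of [phi] its primitive from the left is constant, equal to the full
    integral, hence 0: this is why the primitive again has compact support. *)
Lemma test_primitive phi : test_function phi -> \int[mu]_(x in Lam) phi x = 0 ->
  exists Phi, test_function Phi /\ derive1 Phi = phi.
Proof.
move=> tp p0; have [_ [a [b [a1 b1 H]]]] := tp.
have ipT : mu.-integrable setT (EFin \o phi).
  have : mu.-integrable setT ((EFin \o phi) \_ Lam).
    by apply/(integrable_mkcond _ measurable_LamR); exact: test_integL.
  apply: eq_integrable => // x _; rewrite patchE; case: ifPn => // xL.
  by rewrite /= (test_outside tp)//; move=> Lx; rewrite mem_set in xL.
pose Phi x := \int[mu]_(t in `]-oo, x]) phi t.
have dPhi x : derivable Phi x 1 /\ derive1 Phi x = phi x.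
  apply: (@continuous_FTC1 _ phi -oo%O x (x + 1)) => //.
  - by rewrite ltrDl.
  - exact: integrableS ipT.
  - by rewrite ltNyr.
  - exact: (test_continuous tp).
have dE : derive1 Phi = phi by apply/funext => x; have [] := dPhi x.
exists Phi; split => //; apply: (@Cn_test _ a b) => //.
  move=> [|n] //; split; first by move=> x _; have [] := dPhi x.
  by rewrite dE; exact: test_Cn.
move=> x; rewrite in_itv/= negb_and -!ltNge => /orP[xa|bx].
  rewrite /Phi (@eq_Rintegral _ _ _ _ _ (cst 0)) => [|t].
    by rewrite Rintegral_mkcond (@eq_Rintegral _ _ _ _ _ (cst 0)) ?Rintegral_cst ?mul0r// => t _; rewrite patchE; case: ifP.
  rewrite inE/= in_itv/= => tx; apply: H; rewrite in_itv/=.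
  by apply/negP => /andP[? ?]; lra.
rewrite /Phi -[RHS]p0 [LHS]Rintegral_mkcond [RHS]Rintegral_mkcond.
apply: eq_Rintegral => t _; rewrite !patchE.
have [tab|tab] := boolP (t \in `[a, b]); last by rewrite H//; do 2 case: ifP.
move: tab; rewrite in_itv/= => /andP[ta tb].
rewrite !mem_set//; first by apply/LamE; lra.
by rewrite /= in_itv/=; lra.
Qed.

End TestFunctions.

Section WeakDerivatives.
Context {R : realType}.
Notation mu := (@lebesgue_measure R).
Notation Lam := (@Lambda R).
Implicit Types (f g h w phi psi : R -> R).

(** Smooth minorants of the indicator of ]a, b[, tending to it pointwise as n grows. *)
Definition bump (a b : R) (n : nat) (x : R) : R :=
  expflat 1 (n.+1%:R * (x - a)) * expflat 1 (n.+1%:R * (b - x)).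

Lemma expflat1_itv (t : R) : 0 <= expflat 1 t <= 1.
Proof.
rewrite /expflat; case: ifP => t0; last by rewrite lexx ler01.
by rewrite hornerC mul1r expR_ge0/= expR_le1 oppr_le0 invr_ge0 ltW.
Qed.

Lemma bump_itv a b n x : 0 <= bump a b n x <= 1.
Proof.
have /andP[h1 h2] := expflat1_itv (n.+1%:R * (x - a)).
have /andP[h3 h4] := expflat1_itv (n.+1%:R * (b - x)).
by rewrite /bump mulr_ge0//= mulr_ile1.
Qed.

Lemma bump_test a b n : -1 < a -> b < 1 -> test_function (bump a b n).
Proof.
move=> a1 b1; apply: (@Cn_test _ _ a b) => //.
  move=> m; apply: (Cn_eq openT) (CnM openT
    (Cn_affine n.+1%:R (- n.+1%:R * a) (Cn_expflat m 1))
    (Cn_affine (- n.+1%:R) (n.+1%:R * b) (Cn_expflat m 1))) => x _ /=.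
  rewrite /bump; congr (expflat 1 _ * expflat 1 _); ring.
move=> x; rewrite in_itv/= negb_and -!ltNge => /orP[xa|bx]; rewrite /bump.
  by rewrite {1}/expflat ifF ?mul0r//; apply/negP; rewrite pmulr_rgt0// subr_gt0; lra.
by rewrite {2}/expflat ifF ?mulr0//; apply/negP; rewrite pmulr_rgt0// subr_gt0; lra.
Qed.

Lemma expflat1_cvg1 (t : R) : 0 < t -> expflat 1 (n.+1%:R * t) @[n --> \oo] --> (1 : R).
Proof.
move=> t0; rewrite (_ : (fun n => _) = fun n => expR (- (n.+1%:R^-1 * t^-1))); last first.
  by apply/funext => n; rewrite /expflat mulr_gt0// hornerC mul1r invfM.
rewrite -[X in _ --> X]expR0; apply: continuous_cvg; first exact: continuous_expR.
rewrite -oppr0; apply: cvgN; rewrite -(mul0r t^-1); apply: cvgMl.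
exact: cvg_harmonic.
Qed.

Lemma bump_cvg a b x : bump a b n x @[n --> \oo] --> (\1_`]a, b[ x : R).
Proof.
rewrite indicE; case: (boolP (x \in `]a, b[%classic)).
  rewrite inE/= in_itv/= => /andP[ax xb]; rewrite -[X in _ --> X](mulr1 1).
  by apply: cvgM; apply: expflat1_cvg1; rewrite subr_gt0.
move=> nx; apply: cvg_near_cst; apply: nearW => n; apply/eqP.
have [xa|ax] := leP x a.
  by rewrite /bump {1}/expflat ifF ?mul0r//; apply/negP; rewrite pmulr_rgt0// subr_gt0; lra.
have [bx|xb] := leP b x.
  by rewrite /bump {2}/expflat ifF ?mulr0//; apply/negP; rewrite pmulr_rgt0// subr_gt0; lra.
by move: nx; rewrite notin_setE/= in_itv/= ax xb.
Qed.

Lemma locint_seg d (a b : R) : locally_integrable Lam d -> -1 < a -> b < 1 ->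
  integL (fun x => d x * \1_`[a, b] x).
Proof.
move=> [md _ dK] a1 b1.
have sub : `[a, b]%classic `<=` Lam.
  by move=> x; rewrite /= in_itv/= => ?; apply/LamE; lra.
have := dK _ sub (@segment_compact R a b) => doo.
apply/integrableP; split.
  by apply/measurable_EFinP; apply: measurable_funM => //; exact: measurable_indic.
apply: le_lt_trans doo; rewrite [X in (_ <= X)%E]integral_mkcond.
rewrite [X in (X <= _)%E]integral_mkcond.
rewrite le_eqVlt; apply/orP; left; apply/eqP; apply: eq_integral => x _.
rewrite !patchE /= indicE; have [xab|xab] := boolP (x \in `[a, b]%classic).
  by rewrite mem_set ?mulr1//; apply: sub; rewrite inE in xab.
by case: ifP => //=; rewrite mulr0 normr0.
Qed.

Lemma locint_test d phi : locally_integrable Lam d -> test_function phi ->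
  integL (fun x => d x * phi x).
Proof.
move=> ld tp; have [_ [a [b [a1 b1 H]]]] := tp; have [M HM] := test_bounded tp.
have := integLMb (locint_seg ld a1 b1) (test_measurableL tp) (fun x _ => HM x).
apply: eq_integL => x Lx; rewrite indicE.
have [xab|xab] := boolP (x \in `[a, b]%classic); first by rewrite mulr1.
by rewrite H ?mulr0//; move: xab; rewrite notin_setE/= => /negP.
Qed.

Lemma integL_locint f : integL f -> locally_integrable Lam f.
Proof. by move=> intf; apply: open_integrable_locally => //; exact: open_Lam. Qed.

Let fundamental_itv d (a b : R) : locally_integrable Lam d ->
  (forall phi, test_function phi -> \int[mu]_(x in Lam) (d x * phi x) = 0) ->
  -1 < a -> b < 1 -> \int[mu]_(x in Lam) (d x * \1_`]a, b[ x) = 0.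
Proof.
move=> ld d0 a1 b1; have [md _ _] := ld.
have [|||||_ h] := @DCTL R (fun n x => d x * bump a b n x)
  (fun x => d x * \1_`]a, b[ x) (fun x => `|d x * \1_`[a, b] x|).
- move=> n; apply: measurable_funM => //.
  by apply: test_measurableL; exact: bump_test.
- by apply: measurable_funM => //; exact: measurable_indic.
- by apply: aeL_all => x _; apply: cvgMr; exact: bump_cvg.
- by apply: integL_norm; exact: locint_seg.
- move=> n x Lx; rewrite 2!(normrM (d x)) ler_wpM2l// indicE.
  have /andP[h1 h2] := bump_itv a b n x.
  have [xab|xab] := boolP (x \in `[a, b]%classic).
    by rewrite normr1 ger0_norm.
  rewrite /bump; move: xab; rewrite notin_setE/= in_itv/= => /negP.
  rewrite negb_and -!ltNge => /orP[xa|bx].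
    by rewrite {1}/expflat ifF ?mul0r ?normr0//; apply/negP; rewrite pmulr_rgt0// subr_gt0; lra.
  by rewrite {2}/expflat ifF ?mulr0 ?normr0//; apply/negP; rewrite pmulr_rgt0// subr_gt0; lra.
- move: h; rewrite (_ : (fun n => _) = cst 0); last first.
    by apply/funext => n; rewrite d0//; exact: bump_test.
  by move/(cvg_unique _ (cvg_cst _)) => <-.
Qed.

(** Limits of bumps replace test functions by indicators of intervals. As [d] is only locally
    integrable it is first cut off to ]an, bn[; every integral of the truncation from x to 1
    vanishes, so [Jr0_eq0] applies, and the countably many null sets are united. *)
Lemma fundamental_lemma d : locally_integrable Lam d ->
  (forall phi, test_function phi -> \int[mu]_(x in Lam) (d x * phi x) = 0) ->
  aeL (fun x => d x = 0).
Proof.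
move=> ld d0.
pose an n : R := -1 + n.+2%:R^-1; pose bn n : R := 1 - n.+2%:R^-1.
have nb n : 0 < (n.+2%:R^-1 : R) < 1.
  by rewrite invr_gt0 ltr0n/= invf_lt1// ltr1n.
have an1 n : -1 < an n by rewrite /an ltrDl; have /andP[] := nb n.
have bn1 n : bn n < 1 by rewrite /bn ltrBlDr ltrDl; have /andP[] := nb n.
pose h n x := d x * \1_`]an n, bn n[ x.
have ih n : integL (h n).
  have mi : measurable_fun Lam (\1_`]an n, bn n[ : R -> R) by exact: measurable_indic.
  apply: eq_integL (@integLMb _ _ _ 1 (locint_seg ld (an1 n) (bn1 n)) mi _).
  - move=> x _; rewrite /h -mulrA !indicE; congr (_ * _).
    have [x1|x1] := boolP (x \in `]an n, bn n[%classic); last by rewrite mulr0.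
    rewrite mulr1 mem_set//=; move: x1; rewrite inE/= !in_itv/= => /andP[? ?].
    by apply/andP; split; apply: ltW.
  - by move=> x _; rewrite indicE; case: (_ \in _); rewrite ?normr0 ?normr1.
have h0 n : aeL (fun x => h n x = 0).
  apply: Jr0_eq0 => // x Lx; rewrite /Jr.
  rewrite (@eq_IL _ _ (fun y => d y * \1_`](Order.max x (an n)), bn n[ y)).
    by apply: fundamental_itv => //; rewrite lt_max an1 orbT.
  move=> y Ly; rewrite /h mulrCA; congr (_ * _); rewrite !indicE.
  have -> : (y \in `](Order.max x (an n)), bn n[%classic) =
      (x < y) && (y \in `]an n, bn n[%classic).
    apply/idP/andP; rewrite !inE/= !in_itv/= gt_max.
      by move=> /andP[/andP[-> ->] ->].
    by move=> [-> /andP[-> ->]].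
  have [xy|yx] := ltP x y; last by rewrite tpow0 ?mul0r// subr_le0.
  by rewrite tpowE ?subr_gt0// powRr0 mul1r.
have : {ae mu, forall x, forall n, Lam x -> h n x = 0}.
  by apply/ae_foralln => n; exact: h0.
rewrite /aeL; apply: (@filterS _ _ (ae_filter_ringOfSetsType mu)) => x H Lx.
have [n] : exists n, an n < x < bn n.
  move/LamE : (Lx) => /andP[x1 x2].
  pose e := Order.min (x + 1) (1 - x).
  have e0 : 0 < e by rewrite lt_min; lra.
  have [n _ /(_ n.+1 (leqnSn n))] := cvgr_lt (0 : R) (@cvg_harmonic R) _ e0.
  move=> hn; exists n; rewrite /an /bn; move: hn; rewrite /harmonic/= lt_min.
  set t := _^-1 => /andP[? ?].
  by apply/andP; split; lra.
by move=> hx; have := H n Lx; rewrite /h indicE mem_set ?mulr1//=.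
Qed.


Lemma IL_locintD f g phi : locally_integrable Lam f -> locally_integrable Lam g ->
  test_function phi -> forall c, \int[mu]_(x in Lam) ((f x + c * g x) * phi x) =
  \int[mu]_(x in Lam) (f x * phi x) + c * \int[mu]_(x in Lam) (g x * phi x).
Proof.
move=> lf lg tp c; have i1 := locint_test lf tp; have i2 := locint_test lg tp.
rewrite -(ILZl _ i2) -(ILD i1 (integLZ _ i2)).
by apply: eq_IL => x _; ring.
Qed.

Lemma locintD f g c : locally_integrable Lam f -> locally_integrable Lam g ->
  locally_integrable Lam (fun x => f x + c * g x).
Proof.
move=> [mf oL fK] [mg _ gK]; split => //.
  by apply: measurable_funD => //; exact: measurable_funM.
move=> K KL cK; have mK := compact_measurable cK.
have iK h : measurable_fun Lam h ->
    (\int[mu]_(x in K) `|h x|%:E < +oo)%E -> mu.-integrable K (EFin \o h).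
  move=> mh hoo; apply/integrableP; split => //.
  by apply/measurable_EFinP; exact: measurable_funS mh.
have i1 := iK _ mf (fK _ KL cK); have i2 := iK _ mg (gK _ KL cK).
have : mu.-integrable K ((EFin \o f) \+ (fun x => c%:E * (EFin \o g) x))%E.
  by apply: integrableD => //; exact: integrableZl.
by move/integrableP => [].
Qed.

Lemma weak_derivative_unique j w g g' : is_weak_derivative j w g ->
  is_weak_derivative j w g' -> aeL (fun x => g x = g' x).
Proof.
move=> [lw lg wg] [_ lg' wg'].
have := @fundamental_lemma (fun x => g x + -1 * g' x) (locintD _ lg lg').
have H phi : test_function phi ->
    \int[mu]_(x in Lam) ((g x + -1 * g' x) * phi x) = 0.
  move=> tp; rewrite (IL_locintD lg lg' tp).
  have := wg _ tp; rewrite wg'// /inner => /(congr1 (fun t => (-1) ^+ j * t)).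
  by rewrite !mulrA -expr2 sqrr_sign !mul1r => ->; ring.
by move=> /(_ H); apply: aeL_imp => x _; lra.
Qed.

Lemma weakly_derivableP j w : weakly_derivable j w ->
  is_weak_derivative j w (weak_derivative j w).
Proof. by move=> h; exact: (xgetPex _ h). Qed.

Lemma weak_derivative_ae j w g : is_weak_derivative j w g ->
  aeL (fun x => weak_derivative j w x = g x).
Proof.
move=> h; have wd : weakly_derivable j w by exists g.
exact: (weak_derivative_unique (weakly_derivableP wd) h).
Qed.

Lemma weak_derivative_ae_eq j w w' g g' : is_weak_derivative j w g ->
  locally_integrable Lam w' -> locally_integrable Lam g' ->
  aeL (fun x => w x = w' x) -> aeL (fun x => g x = g' x) ->
  is_weak_derivative j w' g'.
Proof.
move=> [lw lg wg] lw' lg' ww' gg'; split => // phi tp.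
have mp n := test_measurableL (test_derive1n n tp).
have aux h h' psi : locally_integrable Lam h -> locally_integrable Lam h' ->
    aeL (fun x => h x = h' x) -> measurable_fun Lam psi -> inner h psi = inner h' psi.
  move=> [mh _ _] [mh' _ _] hh' mpsi; apply: aeL_IL.
  - exact: measurable_funM.
  - exact: measurable_funM.
  - by apply: aeL_imp hh' => x _ ->.
rewrite -(aux w w')// -(aux g g')//; first exact: wg.
exact: (mp 0%N).
Qed.

Lemma weak_derivativeD j w w' g g' c : is_weak_derivative j w g ->
  is_weak_derivative j w' g' ->
  is_weak_derivative j (fun x => w x + c * w' x) (fun x => g x + c * g' x).
Proof.
move=> [lw lg wg] [lw' lg' wg']; split; [exact: locintD|exact: locintD|].
move=> phi tp; have tpj := test_derive1n j tp.
rewrite /inner (IL_locintD lw lw' tpj) (IL_locintD lg lg' tp).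
by have := wg _ tp; have := wg' _ tp; rewrite /inner => -> ->; ring.
Qed.

Lemma derive1nD m n f : derive1n m (derive1n n f) = derive1n (n + m) f.
Proof.
elim: n f => [//|n IH] f; rewrite derive1Sn IH.
by rewrite addSn derive1Sn.
Qed.

Lemma weak_derivative_comp i j w g h : is_weak_derivative i w g ->
  is_weak_derivative j g h -> is_weak_derivative (i + j) w h.
Proof.
move=> [lw lg wg] [_ lh gh]; split => // phi tp.
rewrite addnC -derive1nD wg; last exact: test_derive1n.
by rewrite gh// mulrA -exprD addnC.
Qed.

(** The identity of order i, tested with phi^(j), is compared with that of order i + j; the sign
    (-1)^i cancels because it squares to 1. *)
Lemma weak_derivative_quot i j w g h : is_weak_derivative i w g ->
  is_weak_derivative (i + j) w h -> is_weak_derivative j g h.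
Proof.
move=> [lw lg wg] [_ lh wh]; split => // phi tp.
have := wg _ (test_derive1n j tp); rewrite derive1nD addnC wh//.
rewrite exprD => /(congr1 (fun t => (-1) ^+ i * t)).
by rewrite !mulrA -expr2 sqrr_sign !mul1r => ->.
Qed.

Lemma weak_derivative0 w : locally_integrable Lam w -> is_weak_derivative 0 w w.
Proof. by move=> lw; split => // phi _; rewrite expr0 mul1r. Qed.

(** The adjoint of [Jr 0] is [Jl 0], and [Jl 0] applied to the derivative of a test function returns
    that function. *)
Lemma Jr_weak_derivative g : integL g -> is_weak_derivative 1 (Jr 0 g) (fun x => - g x).
Proof.
move=> ig; have [_ iJ] := @Jr_integL R 0 g (ltrN10 _) ig.
have iN : integL (fun x => - g x).
  by apply: eq_integL (integLZ (-1) ig) => x _; rewrite mulN1r.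
split; [exact: integL_locint|exact: integL_locint|move=> phi tp].
have [M HM] := test_bounded (test_derive1 tp).
have [_ _ /= e] := @Jr_pair R 0 g (derive1 phi) M (ltrN10 _) ig
  (test_measurableL (test_derive1 tp)) (fun x _ => HM x).
rewrite /inner expr1 mulN1r e.
have igp := locint_test (integL_locint ig) tp.
transitivity (\int[mu]_(x in Lam) (g x * phi x)).
  by apply: eq_IL => y Ly; rewrite Jl0_test.
rewrite (@eq_IL _ (fun x => - g x * phi x) (fun x => -1 * (g x * phi x))).
  by rewrite ILZl// mulN1r opprK.
by move=> x _; ring.
Qed.

Lemma test_normalized : exists eta, test_function eta /\ \int[mu]_(x in Lam) eta x = 1.
Proof.
pose b : R -> R := bump (- 2^-1) 2^-1 0.
have tb : test_function b by apply: bump_test; lra.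
have ib := test_integL tb.
have b0 : 0 < \int[mu]_(x in Lam) b x.
  rewrite lt_def IL_ge0 ?andbT; last by move=> x _; have /andP[] := bump_itv (- 2^-1) 2^-1 0 x.
  apply/eqP => b0.
  have : (\int[mu]_(x in Lam) `|(b x)%:E| = 0)%E.
    have := EFin_IL ib; rewrite b0 => /esym; apply: etrans.
    apply: eq_integral => x _; rewrite gee0_abs// lee_fin.
    by have /andP[] := bump_itv (- 2^-1) 2^-1 0 x.
  move/ae_eq_integral_abs => /(_ measurable_LamR).
  have mb : measurable_fun Lam (fun x : R => (b x)%:E).
    by apply/measurable_EFinP; exact: test_measurableL.
  move=> /(_ mb) [N [mN N0 sN]].
  have : (mu `](- 2^-1)%R, (2^-1)%R[ <= mu N)%E.
    apply: le_measure; rewrite ?inE//.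
    apply: subset_trans sN => y /=; rewrite in_itv/= => /andP[y0 y1] h.
    have Ly : Lam y by apply/LamE; lra.
    have := h Ly; rewrite /b /bump /expflat !mul1r !subr_gt0 y0 y1 !hornerC !mul1r.
    by case=> /eqP; rewrite mulf_eq0 !gt_eqF// expR_gt0.
  rewrite N0 lebesgue_measure_itv/= lte_fin ifT; last by lra.
  by rewrite -EFinB lee_fin; lra.
(* The summand [0 * b x] brings the rescaled bump into the form covered by [test_lin]. *)
exists (fun x => 0 * b x + (\int[mu]_(x in Lam) b x)^-1 * b x); split.
  have t0 : test_function (fun x : R => 0 * b x).
    have := test_lin (-1) tb tb; rewrite (_ : (fun x => _) = fun x => 0 * b x)//.
    by apply/funext => x; ring.
  exact: (test_lin _ t0 tb).
rewrite (@eq_IL _ _ (fun x => (\int[mu]_(x in Lam) b x)^-1 * b x)); last first.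
  by move=> x _; rewrite mul0r add0r.
by rewrite ILZl// mulVf// gt_eqF.
Qed.

(** The sum w = f + Jr 0 g has weak derivative 0. For a test function psi, the difference psi -
    (integral of psi) eta has zero mean, hence is the derivative of a test function; testing w with
    it gives that w - c annihilates psi, where c is the integral of w eta. *)
Lemma du_Bois_Reymond f g : integL f -> integL g -> is_weak_derivative 1 f g ->
  exists c, aeL (fun x => f x = c - Jr 0 g x).
Proof.
move=> intf ig fg; have [_ iJ] := @Jr_integL R 0 g (ltrN10 _) ig.
have [lw _ Hw] := weak_derivativeD 1 fg (Jr_weak_derivative ig).
pose w x := f x + 1 * Jr 0 g x.
have iw : integL w by apply: integLD => //; exact: integLZ.
have [eta [te e1]] := test_normalized.
pose c := \int[mu]_(x in Lam) (w x * eta x); exists c.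
have ae0 : aeL (fun x => w x + - c * 1 = 0).
  have l1 := integL_locint (@integL_cst R 1).
  apply: fundamental_lemma; first exact: locintD.
  move=> psi tp.
  pose I := \int[mu]_(x in Lam) psi x.
  have t2 := test_lin (- I) tp te.
  have [|Phi [tP dP]] := test_primitive t2.
    rewrite ILD ?ILZl ?e1; [by rewrite mulr1 subrr|exact: test_integL..|].
    by apply: integLZ; exact: test_integL.
  have := Hw _ tP; rewrite /inner derive1n1 dP.
  rewrite [X in _ = _ * X](_ : _ = 0); last first.
    by rewrite (@eq_IL _ _ (fun=> 0)) ?Rintegral_cst ?mul0r// => x _; ring.
  rewrite mulr0 => E.
  have i1 := locint_test lw tp; have i2 := locint_test lw te.
  have E' : \int[mu]_(x in Lam) (w x * psi x) - I * c = 0.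
    rewrite -E /c -ILZl// -ILB//; last exact: integLZ.
    by apply: eq_IL => x _; rewrite /w; ring.
  rewrite (IL_locintD lw l1 tp).
  rewrite (@eq_IL _ (fun x => 1 * psi x) psi); last by move=> x _; rewrite mul1r.
  by rewrite -/I mulNr [c * _]mulrC; exact: E'.
by apply: aeL_imp ae0 => x _; rewrite /w; lra.
Qed.

End WeakDerivatives.

(** * Inverting the fractional derivative *)

Section Representation.
Context {R : realType}.
Notation mu := (@lebesgue_measure R).
Notation Lam := (@Lambda R).
Implicit Types (f g h w phi psi e G : R -> R).

(** A null set contains no nonempty open interval; this is how one-sided limits of functions equal
    only almost everywhere are compared. *)
Lemma aeL_itv_ex (P : R -> Prop) (a b : R) : aeL P -> -1 <= a -> a < b -> b <= 1 ->
  exists x, a < x < b /\ P x.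
Proof.
move=> [N [mN N0 sN]] a1 ab b1; apply: contrapT => nex.
have : (mu `]a, b[ <= mu N)%E.
  apply: le_measure; rewrite ?inE//.
  apply: subset_trans sN => y /=; rewrite in_itv/= => yab h.
  apply: nex; exists y; split => //; apply: h.
  by move/andP: yab => [? ?]; apply/LamE; lra.
by rewrite N0 lebesgue_measure_itv/= lte_fin ab -EFinB lee_fin; lra.
Qed.

Lemma ae_lim_left f g (l l' : R) : aeL (fun x => f x = g x) ->
  f x @[x --> 1^'-] --> l -> g x @[x --> 1^'-] --> l' -> l = l'.
Proof.
move=> fg fl gl; apply/eqP; rewrite -subr_eq0; apply/eqP; apply: contrapT => /eqP l0.
have l1 : 0 < `|l - l'| by rewrite normr_gt0.
have /cvgrPdist_lt /(_ _ l1) : (f x - g x) @[x --> 1^'-] --> l - l' by exact: cvgB.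
move=> [d /= d0 H].
have d20 : 0 < Order.min d 1 by rewrite lt_min d0 ltr01.
have d21 : Order.min d 1 <= 1 by rewrite ge_min lexx orbT.
have d2d : Order.min d 1 <= d by rewrite ge_min lexx.
have [|||x [/andP[x1 x2] fgx]] := @aeL_itv_ex _ (1 - Order.min d 1) 1 fg.
- by lra.
- by lra.
- by [].
have hx : `|1 - x| < d by rewrite ger0_norm; lra.
by have := H x hx x2; rewrite fgx subrr subr0 ltxx.
Qed.

Lemma ae_lim_right f g (l l' : R) : aeL (fun x => f x = g x) ->
  f x @[x --> (-1)^'+] --> l -> g x @[x --> (-1)^'+] --> l' -> l = l'.
Proof.
move=> fg fl gl; apply/eqP; rewrite -subr_eq0; apply/eqP; apply: contrapT => /eqP l0.
have l1 : 0 < `|l - l'| by rewrite normr_gt0.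
have /cvgrPdist_lt /(_ _ l1) : (f x - g x) @[x --> (-1)^'+] --> l - l' by exact: cvgB.
move=> [d /= d0 H].
have d20 : 0 < Order.min d 1 by rewrite lt_min d0 ltr01.
have d21 : Order.min d 1 <= 1 by rewrite ge_min lexx orbT.
have d2d : Order.min d 1 <= d by rewrite ge_min lexx.
have [|||x [/andP[x1 x2] fgx]] := @aeL_itv_ex _ (-1) (-1 + Order.min d 1) fg.
- by [].
- by lra.
- by lra.
have hx : `|-1 - x| < d by rewrite distrC ger0_norm; lra.
by have := H x hx x1; rewrite fgx subrr subr0 ltxx.
Qed.

Lemma Jr0_lim_left h : integL h -> Jr 0 h x @[x --> 1^'-] --> (0 : R).
Proof.
move=> ih; have mh := integL_meas ih; apply/cvg_at_leftP => u [u1 uc].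
have [|||||_] := @DCTL R (fun n y => tpow 0 (y - u n) * h y) (cst 0) (fun y => `|h y|).
- by move=> n; exact: (measurable_funM (measurable_tpowB 0 (u n)) mh).
- exact: measurable_cst.
- apply: aeL_all => y /LamE/andP[_ y1]; apply: cvg_near_cst.
  near=> n; have yu : y < u n by near: n; exact: (cvgr_gt _ uc _ y1).
  by rewrite tpow0 ?mul0r// subr_le0 ltW.
- exact: integL_norm.
- move=> n y _; rewrite normrM ger0_norm ?tpow_ge0// ler_piMl//.
  by rewrite /tpow; case: ifP => //; rewrite powRr0.
by rewrite Rintegral_cst// mul0r.
Unshelve. all: by end_near. Qed.

Lemma Jr0_lim_right h : integL h ->
  Jr 0 h x @[x --> (-1)^'+] --> \int[mu]_(x in Lam) h x.
Proof.
move=> ih; have mh := integL_meas ih; apply/cvg_at_rightP => u [u1 uc].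
have [|||||_] := @DCTL R (fun n y => tpow 0 (y - u n) * h y) h (fun y => `|h y|).
- by move=> n; exact: (measurable_funM (measurable_tpowB 0 (u n)) mh).
- exact: mh.
- apply: aeL_all => y /LamE/andP[y1 _]; apply: cvg_near_cst.
  near=> n; have yu : u n < y by near: n; exact: (cvgr_lt _ uc _ y1).
  by rewrite tpowE ?subr_gt0// powRr0 mul1r.
- exact: integL_norm.
- move=> n y _; rewrite normrM ger0_norm ?tpow_ge0// ler_piMl//.
  by rewrite /tpow; case: ifP => //; rewrite powRr0.
by [].
Unshelve. all: by end_near. Qed.

(** The two limits bound [w] near the ends, and what remains is a compact segment of Lambda, where
    local integrability applies. *)
Lemma locint_lim_integL w (l l' : R) : locally_integrable Lam w ->
  w x @[x --> (-1)^'+] --> l -> w x @[x --> 1^'-] --> l' -> integL w.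
Proof.
move=> lw wl wr; have [mw _ _] := lw.
have [d1 /= d10 H1] : \forall x \near (-1)^'+, `|l - w x| < 1.
  by move/cvgrPdist_lt : wl; apply.
have [d2 /= d20 H2] : \forall x \near 1^'-, `|l' - w x| < 1.
  by move/cvgrPdist_lt : wr; apply.
have := integLD (integL_norm (@locint_seg R w (-1 + d1 / 2) (1 - d2 / 2) lw _ _))
  (integL_cst (`|l| + `|l'| + 1)).
move=> H; apply: integL_le mw (H _ _) _; [lra|lra|].
move=> x Lx; have := Lx => /LamE/andP[x1 x2]; rewrite indicE.
have [xab|xab] := boolP (x \in `[-1 + d1 / 2, 1 - d2 / 2]%classic).
  by rewrite mulr1; have := normr_ge0 l; have := normr_ge0 l'; lra.
rewrite mulr0 normr0 add0r; move: xab; rewrite notin_setE/= in_itv/= => /negP.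
rewrite negb_and -!ltNge => /orP[xa|bx].
  have /H1 : `|-1 - x| < d1 by rewrite distrC ger0_norm; lra.
  move=> /(_ x1); rewrite distrC => h; have := ler_normD (w x - l) l; rewrite subrK.
  by have := normr_ge0 l'; lra.
have /H2 : `|1 - x| < d2 by rewrite ger0_norm; lra.
move=> /(_ x2); rewrite distrC => h; have := ler_normD (w x - l') l'; rewrite subrK.
by have := normr_ge0 l; lra.
Qed.

(** Close to 1 one has |h| < 1, and the kernel alone integrates to (1 - x)^(c+1) / (c + 1), which
    tends to 0. *)
Lemma Jr_lim_left c h : -1 < c -> integL h -> h x @[x --> 1^'-] --> (0 : R) ->
  Jr c h x @[x --> 1^'-] --> (0 : R).
Proof.
move=> c1 ih h0; have mh := integL_meas ih.
have c10 : 0 < c + 1 by lra.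
have [d /= d0 H] : \forall x \near 1^'-, `|0 - h x| < 1.
  by move/cvgrPdist_lt : h0; apply.
have cv : (1 - x) `^ (c + 1) / (c + 1) @[x --> 1^'-] --> (0 : R).
  by rewrite -(mul0r (c + 1)^-1); apply: cvgMl; exact: powRB_cvg0.
apply/cvgr0Pnorm_le => eps eps0.
move/cvgr0Pnorm_le : cv => /(_ _ eps0) cv.
near=> x.
have x1 : x < 1 by near: x; exact: nbhs_left_lt.
have xm : -1 < x by near: x; apply: nbhs_left_gt; lra.
have xd : 1 - d < x by near: x; apply: nbhs_left_gt; lra.
have Lx : Lam x by apply/LamE; rewrite xm.
have bnd y : Lam y -> `|tpow c (y - x) * h y| <= tpow c (y - x).
  move=> /LamE/andP[y0 y1]; rewrite normrM (ger0_norm (tpow_ge0 _ _)).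
  have [xy|yx] := ltP x y; last by rewrite tpow0 ?mul0r// subr_le0.
  rewrite ler_piMr ?tpow_ge0//; apply: ltW.
  have := H y; rewrite sub0r normrN; apply => //.
  by rewrite /ball_/= ger0_norm; lra.
have mint : measurable_fun Lam (fun y => tpow c (y - x) * h y).
  by apply: measurable_funM; [exact: measurable_tpowB|exact: mh].
have it := integrable_tpowB c1 Lx.
have ii := integL_le mint it bnd.
apply: (le_trans (le_norm_IL ii)).
apply: (le_trans (IL_le (integL_norm ii) it bnd)).
rewrite /Rintegral integral_tpowD//= -[leLHS]ger0_norm; last first.
  by rewrite divr_ge0 ?powR_ge0// ltW.
by near: x; exact: cv.
Unshelve. all: by end_near. Qed.

Lemma betaf_p0 (p : R) : -1 < p -> betaf p 0 = (p + 1)^-1.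
Proof.
move=> p1; rewrite /betaf.
have -> : (\int[mu]_y (tpow p y * tpow 0 (1 - y))%:E =
    \int[mu]_(y in `]0%R, 1%R[) ((y - 0) `^ p)%:E)%E.
  rewrite [RHS]integral_mkcond; apply: eq_integral => y _; rewrite patchE subr0.
  case: ifPn; rewrite ?inE ?notin_setE/= in_itv/=.
    by move=> /andP[? ?]; rewrite !tpowE ?subr_gt0// powRr0 mulr1.
  move=> /negP; rewrite negb_and -!leNgt => /orP[?|?]; first by rewrite tpow0 ?mul0r.
  by rewrite [tpow 0 _]tpow0 ?mulr0// subr_le0.
by rewrite integral_powRD//= subr0 powR1 div1r.
Qed.

Lemma betaf_0p (p : R) : -1 < p -> betaf 0 p = (p + 1)^-1.
Proof.
move=> p1; rewrite /betaf.
have -> : (\int[mu]_y (tpow 0 y * tpow p (1 - y))%:E =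
    \int[mu]_(y in `]0%R, 1%R[) ((1 - y) `^ p)%:E)%E.
  rewrite [RHS]integral_mkcond; apply: eq_integral => y _; rewrite patchE.
  case: ifPn; rewrite ?inE ?notin_setE/= in_itv/=.
    by move=> /andP[? ?]; rewrite !tpowE ?subr_gt0// powRr0 mul1r.
  move=> /negP; rewrite negb_and -!leNgt => /orP[?|?]; first by rewrite tpow0 ?mul0r.
  by rewrite [tpow p _]tpow0 ?mulr0// subr_le0.
by rewrite integral_powRB//= subr0 powR1 div1r.
Qed.

Lemma Jr_comm0 p h x : -1 < p -> integL h -> Lam x ->
  Jr p (Jr 0 h) x = Jr 0 (Jr p h) x.
Proof.
move=> p1 ih Lx; have h1 : 0 <= p + 0 + 1 by lra.
have h2 : 0 <= 0 + p + 1 by lra.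
rewrite (Jr_comp p1 (ltrN10 _) h1 ih Lx) (Jr_comp (ltrN10 _) p1 h2 ih Lx).
by rewrite (betaf_p0 p1) (betaf_0p p1) [p + 0]addr0 [0 + p]add0r.
Qed.

Lemma JrZ c a h x : integL (fun y => tpow c (y - x) * h y) ->
  Jr c (fun y => a * h y) x = a * Jr c h x.
Proof. by move=> i; rewrite /Jr -ILZl//; apply: eq_IL => y _; ring. Qed.

Lemma Jr0_bound h x : integL h -> Lam x ->
  `|Jr 0 h x| <= \int[mu]_(y in Lam) `|h y|.
Proof.
move=> ih Lx; have ii := Jr_EFin_integrable (lexx 0) ih Lx.
apply: (le_trans (le_norm_IL ii)); apply: IL_le => //; [exact: integL_norm|exact: integL_norm|].
move=> y _; rewrite normrM ger0_norm ?tpow_ge0// ler_piMl//.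
by rewrite /tpow; case: ifP => //; rewrite powRr0.
Qed.

(** Write p = - b - 1. The boundary conditions make [Jr p] commute with differentiation along the
    chain [W], so [G] is the first derivative of [Jr p (W k.-1)], and integration gives
    [Jr p (W k.-1) = - Jr 0 G]. This Abel equation is solved by applying [Jr b] and using that
    [Jr 0] is injective. *)
Lemma representation (k : nat) (b : R) e G : (0 < k)%N -> -1 < b < 0 ->
  boundary_conditions k e -> integL e -> integL G ->
  is_weak_derivative k (Jr (- b - 1) e) G ->
  exists W : nat -> R -> R,
  [/\ forall l, (l < k)%N -> integL (W l),
      aeL (fun x => W 0%N x = e x),
      forall l, (l.+1 < k)%N -> aeL (fun x => W l x = - Jr 0 (W l.+1) x) /\
        \int[mu]_(x in Lam) W l.+1 x = 0,
      aeL (fun x => W k.-1 x = - (betaf b (- b - 1))^-1 * Jr b G x) &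
      W k.-1 x @[x --> (-1)^'+] --> (0 : R)].
Proof.
move=> k0 /andP[b1 b0] bc ie iG wG.
pose p := - b - 1; have p1 : -1 < p by rewrite /p; lra.
have /choice[W HW] : forall l, exists w, (l < k)%N ->
    [/\ is_weak_derivative l e w, w x @[x --> (-1)^'+] --> (0 : R)
      & w x @[x --> 1^'-] --> (0 : R)].
  move=> l; have [lk|kl] := ltnP l k; last by exists e.
  by have [w Hw] := bc l lk; exists w.
have iW l : (l < k)%N -> integL (W l).
  by move=> /HW[[_ lw _] wl wr]; exact: locint_lim_integL lw wl wr.
have W0 : aeL (fun x => W 0%N x = e x).
  have [h _ _] := HW 0%N k0.
  by apply: weak_derivative_unique h (weak_derivative0 _); exact: integL_locint.
have Wd l : (l.+1 < k)%N -> is_weak_derivative 1 (W l) (W l.+1).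
  move=> lk; have [h1 _ _] := HW _ (ltnW lk); have [h2 _ _] := HW _ lk.
  by apply: weak_derivative_quot h1 _; rewrite addn1.
have WJ l : (l.+1 < k)%N -> aeL (fun x => W l x = - Jr 0 (W l.+1) x) /\
    \int[mu]_(x in Lam) W l.+1 x = 0.
  move=> lk; have [c Hc] := du_Bois_Reymond (iW _ (ltnW lk)) (iW _ lk) (Wd _ lk).
  have [_ wl wr] := HW _ (ltnW lk).
  (* The limit at 1 determines the constant of integration; the limit at -1 then yields the zero
     mean of [W l.+1]. *)
  have c0 : 0 = c - 0.
    apply: ae_lim_left Hc wr _; apply: cvgB; first exact: cvg_cst.
    exact/Jr0_lim_left/iW.
  have c1 : 0 = c - \int[mu]_(x in Lam) W l.+1 x.
    apply: ae_lim_right Hc wl _; apply: cvgB; first exact: cvg_cst.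
    exact/Jr0_lim_right/iW.
  split; last by lra.
  by apply: aeL_imp Hc => x _ ->; lra.
have WdJ l : (l.+1 < k)%N -> is_weak_derivative 1 (Jr p (W l)) (Jr p (W l.+1)).
  move=> lk; have [_ iJ] := Jr_integL p1 (iW _ lk).
  have [_ iJ'] := Jr_integL p1 (iW _ (ltnW lk)).
  have [_ iJ0] := Jr_integL (ltrN10 _) (iW _ lk).
  (* The coefficient -2 serves to negate: Jr 0 - 2 Jr 0 = - Jr 0, whose weak derivative is plus the
     integrand. *)
  have := weak_derivativeD (-2) (Jr_weak_derivative iJ) (Jr_weak_derivative iJ).
  move/weak_derivative_ae_eq; apply; [exact: integL_locint|exact: integL_locint| |].
    apply: aeL_all => x Lx; have [h _] := WJ _ lk.
    rewrite (@ae_eq_Jr _ p (W l) (fun x => - 1 * Jr 0 (W l.+1) x)).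
    - rewrite JrZ; first by rewrite Jr_comm0//; [ring|exact: iW].
      apply: (integLMb (integrable_tpowB p1 Lx) (integL_meas iJ0)) => y Ly.
      exact: (Jr0_bound (iW _ lk) Ly).
    - exact: (integL_meas (iW _ (ltnW lk))).
    - by apply: integL_meas; exact: integLZ.
    - by apply: aeL_imp h => y _ ->; rewrite mulN1r.
  by apply: aeL_all => x Lx; ring.
have chain l : (l < k)%N -> is_weak_derivative l (Jr p (W 0%N)) (Jr p (W l)).
  elim: l => [_|l IH lk].
    by apply: weak_derivative0; apply: integL_locint; have [] := Jr_integL p1 (iW _ k0).
  by have := weak_derivative_comp (IH (ltnW lk)) (WdJ _ lk); rewrite addn1.
have k1k : (k.-1 < k)%N by rewrite prednK.
have [_ iF] := Jr_integL p1 (iW _ k1k).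
have WFG : is_weak_derivative 1 (Jr p (W k.-1)) G.
  apply: (weak_derivative_quot (chain _ k1k)); rewrite addn1 (prednK k0).
  apply: (weak_derivative_ae_eq wG).
  - by apply: integL_locint; have [] := Jr_integL p1 (iW _ k0).
  - exact: integL_locint.
  - apply: aeL_all => x Lx; apply: ae_eq_Jr.
    + exact: (integL_meas ie).
    + exact: (integL_meas (iW _ k0)).
    + by apply: aeL_imp W0 => y _ ->.
  - by apply: aeL_all.
have [_ wkl wkr] := HW _ k1k.
have [c Hc] := du_Bois_Reymond iF iG WFG.
have c0 : 0 = c - 0.
  apply: ae_lim_left Hc _ _; first exact: Jr_lim_left (iW _ k1k) wkr.
  by apply: cvgB; [exact: cvg_cst|exact: Jr0_lim_left].
have [_ iJ0] := Jr_integL (ltrN10 _) iG.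
have [_ iJb] := Jr_integL b1 iG.
have bp : b + p + 1 = 0 by rewrite /p; ring.
have be0 := beta_gt0 b1 p1.
exists W; split => //.
have : aeL (fun x => betaf b p * W k.-1 x + Jr b G x = 0).
  apply: Jr0_eq0.
    by apply: integLD => //; apply: integLZ; exact: iW.
  move=> x Lx.
  have -> : Jr 0 (fun y => betaf b p * W k.-1 y + Jr b G y) x =
      betaf b p * Jr 0 (W k.-1) x + Jr 0 (Jr b G) x.
    rewrite /Jr -ILZl; last exact: Jr_EFin_integrable (lexx 0) (iW _ k1k) Lx.
    rewrite -ILD.
    - by apply: eq_IL => y _; ring.
    - by apply: integLZ; exact: Jr_EFin_integrable (lexx 0) (iW _ k1k) Lx.
    - exact: Jr_EFin_integrable (lexx 0) iJb Lx.
  (* The exponent 0 is read as b + p + 1, so that the composition law replaces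
     [betaf b p * Jr 0 (W k.-1)] by [Jr b (Jr p (W k.-1))]. *)
  rewrite -Jr_comm0// -[X in betaf b p * Jr X _ _]bp -Jr_comp//; last 2 first.
  - by rewrite bp.
  - exact: iW.
  rewrite (@ae_eq_Jr _ b _ (fun x => -1 * Jr 0 G x)).
  - rewrite JrZ; first by ring.
    apply: (integLMb (integrable_tpowB b1 Lx) (integL_meas iJ0)) => y Ly.
    exact: (Jr0_bound iG Ly).
  - exact: integL_meas.
  - exact: (integL_meas (integLZ (-1) iJ0)).
  - by apply: aeL_imp Hc => y _ ->; rewrite mulN1r; lra.
apply: aeL_imp => x _ h; apply: (mulfI (negbT (gt_eqF be0))).
by rewrite mulrA mulrN mulfV ?gt_eqF// mulN1r; lra.
Qed.

End Representation.

(** * Stability: the weighted norm of u - u_N is controlled by its fractional derivative *)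

Section Energy.
Context {R : realType}.
Notation mu := (@lebesgue_measure R).
Notation Lam := (@Lambda R).
Implicit Types (f g h w G : R -> R) (b : R).

Lemma aeL_le f g : measurable_fun Lam f -> integL g ->
  aeL (fun x => `|f x| <= g x) -> integL f /\
  \int[mu]_(x in Lam) `|f x| <= \int[mu]_(x in Lam) g x.
Proof.
move=> mf ig fg; have mg := integL_meas ig.
have le1 : (\int[mu]_(x in Lam) `|(f x)%:E| <= \int[mu]_(x in Lam) `|(g x)%:E|)%E.
  apply: ae_ge0_le_integral => //.
  - by apply: measurableT_comp => //; exact/measurable_EFinP.
  - by apply: measurableT_comp => //; exact/measurable_EFinP.
  - move: fg; rewrite /aeL; apply: (@filterS _ _ (ae_filter_ringOfSetsType mu)).
    move=> x + Lx => /(_ Lx) h; rewrite /= lee_fin (le_trans h)//.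
    exact: ler_norm.
have intf : integL f.
  apply/integrableP; split; first exact/measurable_EFinP.
  apply: le_lt_trans le1 _.
  by move/integrableP : ig => [].
split=> //; rewrite -lee_fin (EFin_IL (integL_norm intf)).
apply: (le_trans le1); rewrite le_eqVlt; apply/orP; left; apply/eqP.
rewrite (EFin_IL ig); apply: ae_eq_integral => //.
- by apply: measurableT_comp => //; exact/measurable_EFinP.
- exact/measurable_EFinP.
- move: fg; rewrite /aeL; apply: (@filterS _ _ (ae_filter_ringOfSetsType mu)).
  move=> x + Lx => /(_ Lx) h; rewrite /= ger0_norm//.
  exact: le_trans h.
Qed.

(** The unweighted inequality for the two functions sqrt K and (sqrt K) G. *)
Lemma weighted_CS (K G : R -> R) : (forall y, Lam y -> 0 <= K y) ->
  measurable_fun Lam G ->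
  integL K -> integL (fun y => K y * G y ^+ 2) ->
  integL (fun y => K y * G y) /\
  (\int[mu]_(y in Lam) (K y * G y)) ^+ 2 <=
  (\int[mu]_(y in Lam) K y) * (\int[mu]_(y in Lam) (K y * G y ^+ 2)).
Proof.
move=> K0 mG iK iKG; have mK := integL_meas iK.
have msK : measurable_fun Lam (fun y => K y `^ 2^-1).
  by apply: (measurableT_comp (measurable_powR _)).
have sK y : Lam y -> K y `^ 2^-1 * K y `^ 2^-1 = K y.
  by move=> Ly; rewrite powR12_sqrt ?K0// -expr2 sqr_sqrtr ?K0.
have e1 y : Lam y -> K y = (K y `^ 2^-1) ^+ 2 by move=> Ly; rewrite expr2 sK.
have e2 y : Lam y -> K y * G y ^+ 2 = (K y `^ 2^-1 * G y) ^+ 2.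
  by move=> Ly; rewrite exprMn -e1.
have e3 y : Lam y -> K y * G y = K y `^ 2^-1 * (K y `^ 2^-1 * G y).
  by move=> Ly; rewrite mulrA sK.
have [i h] := CauchySchwarzL msK (measurable_funM msK mG) (eq_integL e1 iK) (eq_integL e2 iKG).
split; first by apply: eq_integL i => y Ly; rewrite e3.
by rewrite (eq_IL e3) (eq_IL e1) (eq_IL e2).
Qed.

(** Schur's test. Cauchy-Schwarz in y and the row bound give v T^2 <= vv times the integral of K G^2
    over y; exchanging the integrals, the column bound on vv K finishes. *)
Lemma schur_bound (K : R * R -> R) (v vv T G W : R -> R) (C : R) : 0 <= C ->
  measurable_fun setT K -> (forall x y, Lam x -> Lam y -> 0 <= K (x, y)) ->
  measurable_fun Lam v -> (forall x, Lam x -> 0 <= v x) ->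
  measurable_fun Lam vv -> (forall x, Lam x -> 0 < vv x) ->
  measurable_fun Lam T -> measurable_fun Lam G ->
  aeL (fun x => T x = \int[mu]_(y in Lam) (K (x, y) * G y)) ->
  (forall x, Lam x -> integL (fun y => K (x, y)) /\
     v x * \int[mu]_(y in Lam) K (x, y) <= vv x) ->
  (forall y, Lam y -> (\int[mu]_(x in Lam) (vv x * K (x, y))%:E <= (C * W y)%:E)%E) ->
  integL (fun y => G y ^+ 2 * W y) ->
  integL (fun x => v x * T x ^+ 2) /\
  \int[mu]_(x in Lam) (v x * T x ^+ 2) <= C * \int[mu]_(y in Lam) (G y ^+ 2 * W y).
Proof.
move=> C0 mK K0 mv v0 mvv vv0 mT mG TE Kv KC iX.
pose F (z : R * R) := (vv \_ Lam) z.1 * K z * ((G \_ Lam) z.2) ^+ 2.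
have mF : measurable_fun setT F.
  apply: measurable_funM; first apply: measurable_funM => //.
  - by apply: measurableT_comp measurable_fst; exact: measurable_restrL.
  - apply: measurable_funX.
    by apply: measurableT_comp measurable_snd; exact: measurable_restrL.
have F0 z : 0 <= F z.
  case: z => x y; rewrite /F /= !patchE.
  case: ifPn => Lx; last by rewrite !mul0r.
  case: ifPn => Ly; last by rewrite expr0n mulr0.
  move/set_mem : Lx => Lx; move/set_mem : Ly => Ly.
  exact: mulr_ge0 (mulr_ge0 (ltW (vv0 _ Lx)) (K0 _ _ Lx Ly)) (sqr_ge0 _).
have iCX : integL (fun y => C * (G y ^+ 2 * W y)) by exact: integLZ.
have Fle : (\int[mu]_(x in Lam) \int[mu]_(y in Lam) (F (x, y))%:E <=
    (C * \int[mu]_(y in Lam) (G y ^+ 2 * W y))%:E)%E.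
  rewrite -ILZl// (EFin_IL iCX) (tonelliL mF F0); apply: ge0_le_integral => //.
  - by move=> y _; apply: integral_ge0 => x _; rewrite lee_fin.
  - exact: (measurable_intL2 mF F0).
  - by apply/measurable_EFinP; exact: (integL_meas iCX).
  - move=> y Ly; apply: (@le_trans _ _
        (\int[mu]_(x in Lam) ((vv x * K (x, y))%:E * (G y ^+ 2)%:E))%E).
      rewrite le_eqVlt; apply/orP; left; apply/eqP; apply: eq_integral => x.
      by rewrite inE => Lx; rewrite /F /= !restrLE.
    have mKy : measurable_fun Lam (fun x => vv x * K (x, y)).
      apply: measurable_funM => //; apply: (measurable_funTS (D := Lam)).
      exact: (measurableT_comp (g := fun x => (x, y)) mK).
    rewrite ge0_integralZr//.
    + have -> : C * (G y ^+ 2 * W y) = (C * W y) * G y ^+ 2 by ring.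
      rewrite (EFinM (C * W y)).
      by apply: lee_wpmul2r; [rewrite lee_fin sqr_ge0|exact: KC].
    + exact/measurable_EFinP.
    + by move=> x Lx; rewrite lee_fin; exact: mulr_ge0 (ltW (vv0 _ Lx)) (K0 _ _ Lx Ly).
    + by rewrite lee_fin sqr_ge0.
have Foo : (\int[mu]_(x in Lam) \int[mu]_(y in Lam) `|F (x, y)|%:E < +oo)%E.
  under eq_integral do under eq_integral do rewrite ger0_norm//.
  by rewrite (le_lt_trans Fle)// ltry.
have [aF iF _ _] := fubiniL mF Foo.
have mvT : measurable_fun Lam (fun x => v x * T x ^+ 2).
  by apply: measurable_funM => //; exact: measurable_funX.
have [|i1 h1] := @aeL_le (fun x => v x * T x ^+ 2) _ mvT iF.
  apply: aeL_imp (aeL_and TE aF) => x Lx [-> ix].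
  have [iK vK] := Kv x Lx; have vx := vv0 x Lx; have vx0 := v0 x Lx.
  have iKG : integL (fun y => K (x, y) * G y ^+ 2).
    apply: eq_integL (integLZ (vv x)^-1 ix) => y Ly.
    by rewrite /F /= !restrLE// -!mulrA mulKf// gt_eqF.
  have [_ cs] := weighted_CS (fun y => K0 x y Lx) mG iK iKG.
  rewrite (ger0_norm (mulr_ge0 vx0 (sqr_ge0 _))).
  have -> : \int[mu]_(y in Lam) F (x, y) =
      vv x * \int[mu]_(y in Lam) (K (x, y) * G y ^+ 2).
    rewrite -ILZl//; apply: eq_IL => y Ly.
    by rewrite /F /= !restrLE// mulrA.
  apply: (le_trans (ler_wpM2l vx0 cs)); rewrite mulrA; apply: ler_wpM2r => //.
  by apply: IL_ge0 => y Ly; exact: mulr_ge0 (K0 _ _ Lx Ly) (sqr_ge0 _).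
split=> //; apply: (le_trans (le_trans (ler_norm _) (le_norm_IL i1))).
apply: (le_trans h1); rewrite -lee_fin; apply: le_trans Fle.
rewrite (EFin_IL iF) le_eqVlt; apply/orP; left; apply/eqP.
have := integrable_fineL.
have iFe : mu.-integrable Lam (fun x => \int[mu]_(y in Lam) (F (x, y))%:E)%E.
  apply/integrableP; split; first exact: (measurable_intL1 mF F0).
  apply: le_lt_trans Foo; rewrite le_eqVlt; apply/orP; left; apply/eqP.
  apply: eq_integral => x _; rewrite gee0_abs; last first.
    by apply: integral_ge0 => y _; rewrite lee_fin.
  by apply: eq_integral => y _; rewrite ger0_norm.
move=> _; have [i2 e2] := integrable_fineL iFe.
by rewrite -(EFin_IL i2) -e2 fineK//; exact: integrable_fin_num iFe.
Qed.

Lemma measurable_powRD c : measurable_fun Lam (fun x : R => (1 + x) `^ c).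
Proof.
apply: (measurableT_comp (measurable_powR c)).
by apply: measurable_funD.
Qed.

Lemma measurable_powRB c : measurable_fun Lam (fun x : R => (1 - x) `^ c).
Proof.
apply: (measurableT_comp (measurable_powR c)).
by apply: measurable_funB.
Qed.

Lemma powRS (x c : R) : 0 < x -> x `^ (c + 1) = x * x `^ c.
Proof.
move=> x0; rewrite powRD ?(gt_eqF x0) ?implybT//.
by rewrite powRr1 ?(ltW x0)// mulrC.
Qed.

Lemma LamD0 x : Lam x -> 0 < 1 + x. Proof. by move=> /LamE/andP[? ?]; lra. Qed.
Lemma LamB0 x : Lam x -> 0 < 1 - x. Proof. by move=> /LamE/andP[? ?]; lra. Qed.

(** The row integral of the kernel is (1 - x)^(b+1) / (b + 1), which the weight cancels exactly, so
    a constant [vv] works. The column integral (1 + y)^(b+1) / (b + 1) is at most 2 (1 + y)^b / (b +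
    1), whence the constant. *)
Lemma right_bound b : -1 < b -> exists2 C : R, 0 <= C &
  forall G, measurable_fun Lam G -> integL G ->
  integL (fun y => G y ^+ 2 * (1 + y) `^ b) ->
  integL (fun x => (1 - x) `^ (- (b + 1)) * Jr b G x ^+ 2) /\
  \int[mu]_(x in Lam) ((1 - x) `^ (- (b + 1)) * Jr b G x ^+ 2) <=
  C * \int[mu]_(y in Lam) (G y ^+ 2 * (1 + y) `^ b).
Proof.
move=> b1; have b10 : 0 < b + 1 by lra.
exists (2 * (b + 1)^-1 ^+ 2); first by rewrite mulr_ge0 ?sqr_ge0.
move=> G mG iG iX; have [aJ iJ] := Jr_integL b1 iG.
apply: (@schur_bound (fun z => tpow b (z.2 - z.1)) _ (fun=> (b + 1)^-1)) => //.
- by rewrite mulr_ge0 ?sqr_ge0.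
- exact: measurable_tpow_sub.
- by move=> x y _ _; exact: tpow_ge0.
- exact: measurable_powRB.
- by move=> x _; exact: powR_ge0.
- by move=> x _; rewrite invr_gt0.
- exact: integL_meas.
- exact: aeL_all.
- move=> x Lx /=; split; first exact: integrable_tpowB.
  rewrite /Rintegral integral_tpowD//= mulrA powRN mulVf ?mul1r//.
  by rewrite gt_eqF// powR_gt0// LamB0.
- move=> y Ly /=; under eq_integral do rewrite EFinM.
  rewrite ge0_integralZl//.
  + rewrite integral_tpowB// -EFinM lee_fin powRS ?LamD0//.
    set c := (b + 1)^-1; set d := (1 + y) `^ b.
    have -> : c * ((1 + y) * d * c) = (1 + y) * (c ^+ 2 * d) by ring.
    have -> : 2 * c ^+ 2 * d = 2 * (c ^+ 2 * d) by ring.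
    apply: ler_wpM2r; first by rewrite mulr_ge0 ?powR_ge0// sqr_ge0.
    by move/LamE : Ly => ?; lra.
  + by apply/measurable_EFinP; exact: measurable_tpowBl.
  + by move=> x _; rewrite lee_fin tpow_ge0.
  + by rewrite lee_fin invr_ge0 ltW.
Qed.

Lemma aeL_neq (a : R) : aeL (fun y => y != a).
Proof.
exists [set a]; split; [exact: measurable_set1|exact: lebesgue_measure_set1|].
move=> y /= h; apply: contrapT => ya; apply: h => _.
by apply/eqP => e; apply: ya; rewrite e.
Qed.

Lemma integL_Jl h y c : 0 <= c -> integL h -> Lam y ->
  integL (fun x => tpow c (y - x) * h x).
Proof.
move=> c0 ih Ly; apply: eq_integL (@integLMb _ _ (fun t => tpow c (y - t))
    (2 `^ c) ih _ _).
- by move=> t _; rewrite mulrC.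
- exact: measurable_tpowBl.
- by move=> t Lt; rewrite ger0_norm ?tpow_ge0//; exact/tpow_le/Lam_sub_le.
Qed.

Lemma Jr0_Jl0 h x : integL h -> Lam x ->
  Jr 0 h x + Jl 0 h x = \int[mu]_(y in Lam) h y.
Proof.
move=> ih Lx; have i1 := Jr_EFin_integrable (lexx 0) ih Lx.
have i2 := integL_Jl (lexx 0) ih Lx.
rewrite /Jr /Jl -(ILD i1 i2); apply: aeL_IL.
- exact: (integL_meas (integLD i1 i2)).
- exact: (integL_meas ih).
- apply: aeL_imp (aeL_neq x) => y _ yx.
  rewrite -mulrDl; have [xy|yx'|e] := ltgtP x y.
  + by rewrite tpowE ?subr_gt0// tpow0 ?subr_le0 ?(ltW xy)// powRr0 addr0 mul1r.
  + by rewrite tpow0 ?subr_le0 ?(ltW yx')// tpowE ?subr_gt0// powRr0 add0r mul1r.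
  + by rewrite e eqxx in yx.
Qed.

Lemma tpow_conv_left p q y : -1 < p -> -1 < q -> Lam y ->
  (\int[mu]_(x in Lam) ((1 + x) `^ p * tpow q (y - x))%:E =
  (betaf p q * (1 + y) `^ (p + q + 1))%:E)%E.
Proof.
move=> p1 q1 Ly; have y1 : y <= 1 by move/LamE : Ly => /andP[_ /ltW].
have e (z : R) : z - -1 = 1 + z by rewrite opprK addrC.
have := tpow_conv p1 q1 (lexx (-1)) y1.
rewrite e [tpow (p + q + 1) _]tpowE ?LamD0// => <-.
apply: eq_integral => x; rewrite inE => Lx.
by rewrite e [tpow p _]tpowE ?LamD0.
Qed.

Lemma integral_powRD_Lam c : -1 < c ->
  (\int[mu]_(x in Lam) ((1 + x) `^ c)%:E = (2 `^ (c + 1) / (c + 1))%:E)%E.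
Proof.
move=> c1; have h11 : -1 < 1 :> R by lra.
have := @integral_powRD R c (-1) 1 c1 h11.
rewrite (_ : 1 - -1 = 2 :> R); last by rewrite opprK.
by move=> <-; apply: eq_integral => x _; rewrite opprK addrC.
Qed.

Lemma integL_powRD c : -1 < c -> integL (fun x : R => (1 + x) `^ c).
Proof.
move=> c1; apply: integL_ge0; first exact: measurable_powRD.
  by move=> x _; exact: powR_ge0.
by rewrite integral_powRD_Lam// ltry.
Qed.

Lemma Jl_powRD p q y : -1 < p -> -1 < q -> Lam y ->
  Jl q (fun x => (1 + x) `^ p) y = betaf p q * (1 + y) `^ (p + q + 1).
Proof.
move=> p1 q1 Ly; have := tpow_conv_left p1 q1 Ly; rewrite /Jl /Rintegral => h.
by under eq_integral do rewrite mulrC; rewrite h.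
Qed.

Lemma weighted_integL b G : -1 < b -> measurable_fun Lam G ->
  integL (fun y => G y ^+ 2 * (1 + y) `^ b) -> integL (fun y => (1 + y) `^ b * G y).
Proof.
move=> b1 mG iX.
have := @weighted_CS (fun y => (1 + y) `^ b) G (fun y _ => powR_ge0 _ _) mG (integL_powRD b1).
by case=> //; apply: eq_integL iX => y _; rewrite mulrC.
Qed.

Lemma Jl0_bound b G x : -1 < b -> measurable_fun Lam G -> Lam x ->
  integL (fun y => G y ^+ 2 * (1 + y) `^ b) ->
  (Jl 0 (fun y => (1 + y) `^ b * G y) x) ^+ 2 <=
  (1 + x) `^ (b + 1) / (b + 1) * \int[mu]_(y in Lam) (G y ^+ 2 * (1 + y) `^ b).
Proof.
move=> b1 mG Lx iX; have ib := integL_powRD b1.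
have i1 := integL_Jl (lexx 0) ib Lx.
have i2 := integL_Jl (lexx 0) iX Lx.
have i2' : integL (fun y => tpow 0 (x - y) * (1 + y) `^ b * G y ^+ 2).
  by apply: eq_integL i2 => y _; ring.
have K0 y : Lam y -> 0 <= tpow 0 (x - y) * (1 + y) `^ b.
  by move=> _; rewrite mulr_ge0 ?tpow_ge0 ?powR_ge0.
have [_] := weighted_CS K0 mG i1 i2'.
rewrite (@eq_IL _ _ (fun y => tpow 0 (x - y) * ((1 + y) `^ b * G y))); last first.
  by move=> y _; rewrite mulrA.
move/le_trans; apply.
have := Jl_powRD b1 (ltrN10 _) Lx; rewrite /Jl => ->.
rewrite betaf_p0// addr0 [(b + 1)^-1 * _]mulrC; apply: ler_wpM2l.
  by rewrite mulr_ge0 ?powR_ge0// invr_ge0; lra.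
apply: IL_le => // y Ly.
have -> : tpow 0 (x - y) * (1 + y) `^ b * G y ^+ 2 =
  tpow 0 (x - y) * (G y ^+ 2 * (1 + y) `^ b) by ring.
apply: ler_piMl; first by rewrite mulr_ge0 ?powR_ge0// sqr_ge0.
by rewrite /tpow; case: ifP => //; rewrite powRr0.
Qed.

Lemma powR2_le (x c : R) : 0 <= c -> 0 <= x <= 2 -> x `^ c <= 2 `^ c.
Proof. by move=> c0 /andP[x0 x2]; apply: ge0_ler_powR; rewrite ?nnegrE. Qed.

Lemma IL_powRD c : -1 < c -> \int[mu]_(x in Lam) ((1 + x) `^ c) = 2 `^ (c + 1) / (c + 1).
Proof. by move=> c1; rewrite /Rintegral integral_powRD_Lam. Qed.

(** At x = -1 the kernel (y - x)^b becomes (1 + y)^b, so [kappa] is the formal value of [Jr b G]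
    there. Since [kappa = Jr 0 h + Jl 0 h] with h = (1 + y)^b G, the difference is T - Jl 0 h:
    Schur's test bounds T, whose kernel K is nonnegative because b < 0, and [Jl0_bound] controls the
    rest. *)
Lemma left_bound b : -1 < b < 0 -> exists2 C : R, 0 <= C &
  forall G, measurable_fun Lam G -> integL G ->
  integL (fun y => G y ^+ 2 * (1 + y) `^ b) ->
  let kappa := \int[mu]_(y in Lam) ((1 + y) `^ b * G y) in
  integL (fun x => (1 + x)^-1 * (Jr b G x - kappa) ^+ 2) /\
  \int[mu]_(x in Lam) ((1 + x)^-1 * (Jr b G x - kappa) ^+ 2) <=
  C * \int[mu]_(y in Lam) (G y ^+ 2 * (1 + y) `^ b).
Proof.
move=> /andP[b1 b0]; have b10 : 0 < b + 1 by lra.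
(* [C1] bounds the columns: [tpow_conv_left] produces (1 + y)^(2b+1), of which a factor (1 +
   y)^(b+1) is at most 2^(b+1). [C2] is the integral of (1 + x)^b / (b + 1). The factors 2 in the
   witness come from (T - J)^2 <= 2 T^2 + 2 J^2. *)
pose C1 := (b + 1)^-1 * (betaf b b * 2 `^ (b + 1)).
have bb0 := beta_gt0 b1 b1.
have C10 : 0 <= C1.
  by rewrite /C1 mulr_ge0 ?mulr_ge0 ?powR_ge0 ?(ltW bb0)// invr_ge0 ltW.
pose C2 := (b + 1)^-1 * (2 `^ (b + 1) / (b + 1)).
exists (2 * C1 + 2 * C2).
  by rewrite addr_ge0 ?mulr_ge0 ?powR_ge0 ?invr_ge0// ltW.
move=> G mG iG iX kappa.
set X := \int[mu]_(y in Lam) (G y ^+ 2 * (1 + y) `^ b).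
have X0 : 0 <= X by apply: IL_ge0 => y _; rewrite mulr_ge0 ?powR_ge0// sqr_ge0.
pose h y := (1 + y) `^ b * G y.
have ih : integL h by exact: weighted_integL.
have [aJ iJ] := Jr_integL b1 iG; have [_ iJh] := Jr_integL (ltrN10 _) ih.
pose T x := Jr b G x - Jr 0 h x.
have mT : measurable_fun Lam T by apply: measurable_funB; exact: integL_meas.
pose K (z : R * R) := tpow b (z.2 - z.1) - tpow 0 (z.2 - z.1) * (1 + z.2) `^ b.
have mK : measurable_fun setT K.
  apply: measurable_funB; first exact: measurable_tpow_sub.
  apply: measurable_funM; first exact: measurable_tpow_sub.
  apply: (measurableT_comp (measurable_powR b)).
  by apply: measurable_funD => //; exact: measurable_snd.
have ib := integL_powRD b1.
have K0 x y : Lam x -> Lam y -> 0 <= K (x, y).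
  move=> Lx Ly; rewrite /K /= subr_ge0; have [xy|yx] := ltP x y; last first.
    by rewrite !tpow0 ?mul0r// subr_le0.
  rewrite !tpowE ?subr_gt0// powRr0 mul1r.
  rewrite -(opprK b) !(powRN _ (- b)) lef_pV2 ?posrE ?powR_gt0 ?subr_gt0 ?LamD0//.
  move/LamE : (Lx) => ?.
  by apply: ge0_ler_powR; rewrite ?nnegrE; lra.
have invE x : Lam x -> (1 + x)^-1 = (1 + x) `^ (-1).
  by move=> Lx; rewrite powR_inv1// ltW// LamD0.
have powE x c : Lam x -> (1 + x)^-1 * (1 + x) `^ (c + 1) = (1 + x) `^ c.
  by move=> Lx; rewrite powRS ?LamD0// mulrA mulVf ?mul1r// gt_eqF ?LamD0.
have mv : measurable_fun Lam (fun x : R => (1 + x)^-1).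
  have := measurable_powRD (-1); apply: eq_measurable_fun => x.
  by rewrite inE => Lx; rewrite invE.
have iKx x : Lam x -> integL (fun y => K (x, y)).
  move=> Lx; apply: integLB; first exact: integrable_tpowB.
  exact: Jr_EFin_integrable (lexx 0) ib Lx.
have [|||||||||i1 h1] := @schur_bound K (fun x => (1 + x)^-1)
    (fun x => (1 + x) `^ b / (b + 1)) T G (fun y => (1 + y) `^ b) C1 C10 mK K0 mv.
- by move=> x Lx; rewrite invr_ge0 ltW// LamD0.
- by apply: measurable_funM => //; exact: measurable_powRD.
- by move=> x Lx; rewrite divr_gt0// powR_gt0// LamD0.
- exact: mT.
- exact: mG.
- apply: aeL_imp aJ => x Lx ix.
  have i2 := Jr_EFin_integrable (lexx 0) ih Lx.
  by rewrite /T /Jr -(ILB ix i2); apply: eq_IL => y Ly; rewrite /K /h /=; ring.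
(* The row integral is ((1 - x)^(b+1) - 2^(b+1) + (1 + x)^(b+1)) / (b + 1), hence at most (1 +
   x)^(b+1) / (b + 1). *)
- move=> x Lx; split; first exact: iKx.
  rewrite /K /= ILB; [|exact: integrable_tpowB|exact: Jr_EFin_integrable (lexx 0) ib Lx].
  have := Jr0_Jl0 ib Lx; rewrite IL_powRD//.
  have -> := @Jl_powRD b 0 x b1 (ltrN10 _) Lx; rewrite betaf_p0// addr0.
  rewrite /Jr => e.
  have -> : \int[mu]_(y in Lam) (tpow b (y - x)) = (1 - x) `^ (b + 1) / (b + 1).
    by rewrite /Rintegral integral_tpowD.
  have le2 : (1 - x) `^ (b + 1) / (b + 1) <= 2 `^ (b + 1) / (b + 1).
    rewrite ler_pM2r ?invr_gt0//; apply: powR2_le; first exact: ltW.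
    by move/LamE : Lx => ?; lra.
  rewrite -[leRHS](_ : (1 + x)^-1 * ((1 + x) `^ (b + 1) / (b + 1)) = _); last first.
    by rewrite mulrA powE.
  apply: ler_wpM2l; first by rewrite invr_ge0 ltW// LamD0.
  by rewrite [leRHS]mulrC; lra.
- move=> y Ly.
  apply: (@le_trans _ _ (\int[mu]_(x in Lam)
    ((b + 1)^-1%:E * ((1 + x) `^ b * tpow b (y - x))%:E))%E).
    apply: ge0_le_integral => //.
    + move=> x Lx; rewrite lee_fin; apply: mulr_ge0 (K0 _ _ Lx Ly).
      by rewrite divr_ge0 ?powR_ge0// ltW.
    + apply/measurable_EFinP; apply: measurable_funM.
        by apply: measurable_funM => //; exact: measurable_powRD.
      apply: (measurable_funTS (D := Lam)).
      exact: (measurableT_comp (g := fun x => (x, y)) mK).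
    + apply: measurable_funeM; apply/measurable_EFinP; apply: measurable_funM.
        exact: measurable_powRD.
      exact: measurable_tpowBl.
    + move=> x Lx; rewrite -EFinM lee_fin mulrA [(b + 1)^-1 * _]mulrC.
      apply: ler_wpM2l; first by rewrite divr_ge0 ?powR_ge0// ltW.
      by rewrite /K /= gerBl mulr_ge0 ?tpow_ge0 ?powR_ge0.
  rewrite ge0_integralZl//.
  + rewrite tpow_conv_left// -EFinM lee_fin /C1 -!mulrA.
    apply: ler_wpM2l; first by rewrite invr_ge0 ltW.
    apply: ler_wpM2l; first exact: ltW.
    have -> : (1 + y) `^ (b + b + 1) = (1 + y) `^ (b + 1) * (1 + y) `^ b.
      rewrite -powRD ?(gt_eqF (LamD0 Ly)) ?implybT//.
      by congr (_ `^ _); ring.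
    apply: ler_wpM2r; first exact: powR_ge0.
    by apply: powR2_le; [exact: ltW|move/LamE : Ly => ?; lra].
  + apply/measurable_EFinP; apply: measurable_funM.
      exact: measurable_powRD.
    exact: measurable_tpowBl.
  + by move=> x _; rewrite lee_fin mulr_ge0 ?tpow_ge0 ?powR_ge0.
  + by rewrite lee_fin invr_ge0 ltW.
- exact: iX.
have iS : integL (fun x => X / (b + 1) * (1 + x) `^ b) by exact: integLZ.
pose f x := (1 + x)^-1 * (Jr b G x - kappa) ^+ 2.
pose g x := 2 * ((1 + x)^-1 * T x ^+ 2) + 2 * (X / (b + 1) * (1 + x) `^ b).
have ig : integL g by apply: integLD; exact: integLZ.
have mf : measurable_fun Lam f.
  apply: measurable_funM => //; apply: measurable_funX; apply: measurable_funB => //.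
  exact: integL_meas.
have f0 x : Lam x -> 0 <= f x.
  by move=> Lx; rewrite mulr_ge0 ?sqr_ge0// invr_ge0 ltW// LamD0.
have fg x : Lam x -> f x <= g x.
  move=> Lx; have e := Jr0_Jl0 ih Lx.
  have -> : f x = (1 + x)^-1 * (T x - Jl 0 h x) ^+ 2.
    by rewrite /f /T; congr (_ * _ ^+ 2); rewrite /kappa -/h -e; ring.
  have := Jl0_bound b1 mG Lx iX; rewrite -/h -/X => hS.
  have v0 : 0 <= (1 + x)^-1 by rewrite invr_ge0 ltW// LamD0.
  have hS' : (1 + x)^-1 * Jl 0 h x ^+ 2 <= X / (b + 1) * (1 + x) `^ b.
    apply: (le_trans (ler_wpM2l v0 hS)).
    by rewrite !mulrA powE// -!mulrA [X * _]mulrC -!mulrA mulrCA.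
  have : (1 + x)^-1 * (T x - Jl 0 h x) ^+ 2 <=
     (1 + x)^-1 * (2 * T x ^+ 2 + 2 * Jl 0 h x ^+ 2).
    apply: ler_wpM2l => //; have := sqr_ge0 (T x + Jl 0 h x); nra.
  by rewrite /g; nra.
have intf : integL f.
  by apply: integL_le mf ig _ => x Lx; rewrite ger0_norm ?f0// fg.
split=> //; apply: (le_trans (IL_le intf ig fg)).
rewrite /g ILD; [|exact: integLZ|exact: integLZ].
rewrite !ILZl// ?IL_powRD//.
have -> : (2 * C1 + 2 * C2) * X =
    2 * (C1 * X) + 2 * (X / (b + 1) * (2 `^ (b + 1) / (b + 1))).
  by rewrite /C2; ring.
by apply: lerD => //; rewrite ler_wpM2l.
Qed.

End Energy.

(** * Vanishing moments of the fractional derivative *)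

Section Coercivity.
Context {R : realType}.
Notation mu := (@lebesgue_measure R).
Notation Lam := (@Lambda R).
Implicit Types (f g h w G : R -> R) (b : R).

Lemma weighted_integL1 b G : b <= 0 -> measurable_fun Lam G ->
  integL (fun y => G y ^+ 2 * (1 + y) `^ b) -> integL G.
Proof.
move=> b0 mG iX.
apply: (@integL_le _ _ (fun y => 1 + 2 `^ (- b) * (G y ^+ 2 * (1 + y) `^ b))) => //.
  by apply: integLD; [exact: integL_cst|exact: integLZ].
move=> y Ly.
have h : 1 <= 2 `^ (- b) * (1 + y) `^ b.
  have -> : (1 + y) `^ b = ((1 + y) `^ (- b))^-1 by rewrite powRN invrK.
  rewrite ler_pdivlMr ?powR_gt0 ?LamD0// mul1r.
  by apply: powR2_le; [lra|move/LamE : Ly => ?; lra].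
have G2 := sqr_ge0 (G y).
have : `|G y| <= 1 + G y ^+ 2 by rewrite ler_norml; apply/andP; split; nra.
rewrite mulrCA; set t := 2 `^ (- b) * _ in h *; nra.
Qed.

(* Otherwise [(Jr b G - kappa)^2] would stay away from [0] near [-1], which the
   weight [(1 + x)^-1] of [left_bound] forbids. *)
Lemma kappa_eq0 b G w (C0 : R) : -1 < b < 0 -> C0 != 0 -> measurable_fun Lam G ->
  integL (fun y => G y ^+ 2 * (1 + y) `^ b) ->
  aeL (fun x => w x = C0 * Jr b G x) -> w x @[x --> (-1)^'+] --> (0 : R) ->
  \int[mu]_(y in Lam) ((1 + y) `^ b * G y) = 0.
Proof.
move=> b10 C00 mG iX wE w0; set kappa := (X in X = 0).
apply/eqP; apply: contrapT => /negP k0.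
have iG := weighted_integL1 (ltW (andP b10).2) mG iX.
have [C _ /(_ G mG iG iX) /= [intf _]] := left_bound b10; move: intf.
rewrite -/kappa => intf; set M := \int[mu]_(x in Lam)
  ((1 + x)^-1 * (Jr b G x - kappa) ^+ 2).
have M0 : 0 <= M.
  by apply: IL_ge0 => x Lx; rewrite mulr_ge0 ?sqr_ge0// invr_ge0 ltW// LamD0.
have kp : 0 < kappa ^+ 2 by rewrite exprn_even_gt0.
have kq0 : 0 <= kappa ^+ 2 / 4 by lra.
(* With this threshold |Jr b G| < |kappa| / 2 near -1, so (Jr b G - kappa)^2 >= kappa^2 / 4
   there. *)
have ek0 : 0 < `|C0 * kappa| / 2 by rewrite divr_gt0// normr_gt0 mulf_neq0.
have /cvgrPdist_lt /(_ _ ek0) [d /= d0 H] := w0.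
pose de := Order.min d 2^-1.
have de0 : 0 < de by rewrite lt_min d0/= invr_gt0.
have de1 : de <= 2^-1 by rewrite ge_min lexx orbT.
have ded : de <= d by rewrite ge_min lexx.
(* The divergent (1 + x)^(-1) is replaced by the smaller, integrable (1 + x)^(ep-1), whose integral
   over ]-1, -1 + de[ is de^ep / ep >= de / ep. This [ep] makes (kappa^2 / 4) (de / ep) equal to M +
   1 + kappa^2 de / 4, more than M. *)
pose ep := kappa ^+ 2 * de / (4 * (M + 1) + kappa ^+ 2 * de).
have den0 : 0 < 4 * (M + 1) + kappa ^+ 2 * de by nra.
have ep0 : 0 < ep by rewrite divr_gt0// mulr_gt0.
have ep1 : ep <= 1 by rewrite ler_pdivrMr// mul1r; nra.
have c1 : -1 < ep - 1 by lra.
have Ly : Lam (-1 + de) by apply/LamE; lra.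
pose F x := kappa ^+ 2 / 4 * (tpow 0 (-1 + de - x) * (1 + x) `^ (ep - 1)).
have iF : integL F.
  by apply: integLZ; exact: integL_Jl (lexx 0) (integL_powRD c1) Ly.
have [|_ hF] := @aeL_le R F _ (integL_meas iF) intf.
  apply: aeL_imp wE => x Lx wx; have hx := LamD0 Lx.
  rewrite (ger0_norm (mulr_ge0 kq0 (mulr_ge0 (tpow_ge0 _ _) (powR_ge0 _ _)))).
  have f0 : 0 <= (1 + x)^-1 * (Jr b G x - kappa) ^+ 2.
    by rewrite mulr_ge0 ?sqr_ge0// invr_ge0 ltW.
  rewrite /F; have [xd|dx] := ltP x (-1 + de); last first.
    by rewrite tpow0 ?subr_le0// mul0r mulr0.
  rewrite tpowE ?subr_gt0// powRr0 mul1r mulrC.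
  have hp : (1 + x) `^ (ep - 1) <= (1 + x)^-1.
    rewrite -(powR_inv1 (ltW hx)); apply: ger_powR; last by lra.
    by rewrite hx/=; lra.
  have x1 : -1 < x by lra.
  have xd' : `|-1 - x| < d by rewrite distrC ger0_norm; lra.
  have := H x xd' x1; rewrite sub0r normrN wx.
  rewrite !normrM -mulrA ltr_pM2l ?normr_gt0// => hJ.
  have k4 : kappa ^+ 2 / 4 <= (Jr b G x - kappa) ^+ 2.
    have : `|kappa| / 2 <= `|Jr b G x - kappa|.
      by have := ler_normB (Jr b G x) (Jr b G x - kappa); rewrite opprB addrC subrK; lra.
    have n0 := normr_ge0 kappa; rewrite -(real_normK (num_real kappa)).
    by rewrite -(real_normK (num_real (_ - _))); nra.
  by apply: ler_pM => //; exact: powR_ge0.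
have : kappa ^+ 2 / 4 * (de `^ ep / ep) <= M.
  apply: le_trans hF; apply: le_trans (le_trans (ler_norm _) (le_norm_IL iF)).
  rewrite /F ILZl; last exact: integL_Jl (lexx 0) (integL_powRD c1) Ly.
  have := @Jl_powRD R (ep - 1) 0 _ c1 (ltrN10 _) Ly; rewrite /Jl => ->.
  rewrite betaf_p0// !addr0 subrK addrA subrr add0r.
  by rewrite [ep^-1 * _]mulrC.
have dep : de <= de `^ ep by apply: ger1_powR; [rewrite de0/=; lra|].
move=> hM.
have : kappa ^+ 2 / 4 * (de / ep) <= M.
  apply: le_trans hM; apply: ler_wpM2l => //.
  by rewrite ler_wpM2r// invr_ge0 ltW.
have -> : kappa ^+ 2 / 4 * (de / ep) = (4 * (M + 1) + kappa ^+ 2 * de) / 4.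
  have kn0 : kappa != 0 by apply/eqP => e; rewrite e expr0n ltxx in kp.
  have den1 := negbT (gt_eqF den0); have de2 := negbT (gt_eqF de0).
  by rewrite /ep; field; do ?[apply/andP; split].
by have := mulr_gt0 kp de0; lra.
Qed.

(** Inserting W_l = - Jr 0 W_(l+1) and moving [Jr 0] onto (1 + x)^j expresses the j-th moment of W_l
    as a nonzero multiple of the (j+1)-st moment of W_(l+1); the induction starts from the zero
    means. *)
Lemma moment_shift (W : nat -> R -> R) (k : nat) :
  (forall l, (l < k)%N -> integL (W l)) ->
  (forall l, (l.+1 < k)%N -> aeL (fun x => W l x = - Jr 0 (W l.+1) x) /\
        \int[mu]_(x in Lam) W l.+1 x = 0) ->
  forall j l, (j < l < k)%N -> \int[mu]_(x in Lam) (W l x * (1 + x) `^ j%:R) = 0.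
Proof.
move=> iW HW; elim=> [|j IH] [|l]//.
  move=> /andP[_ lk]; have [_ <-] := HW _ lk.
  by apply: eq_IL => x _; rewrite powRr0 mulr1.
rewrite ltnS => /andP[jl lk]; have [We _] := HW _ lk.
have := IH l; rewrite jl (ltnW lk) => /(_ isT).
have j1 : -1 < j%:R :> R by apply: lt_le_trans (ltrN10 _) _.
have bj x : Lam x -> `|(1 + x) `^ j%:R| <= 2 `^ (j%:R : R).
  move=> Lx; rewrite ger0_norm ?powR_ge0//.
  by apply: powR2_le => //; move/LamE : Lx => ?; lra.
have [i1 i2 e] := Jr_pair (ltrN10 _) (iW _ lk) (measurable_powRD j%:R) bj.
have iJ := (Jr_integL (ltrN10 _) (iW _ lk)).2.
have := @aeL_IL R (fun x => W l x * (1 + x) `^ j%:R)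
  (fun x => -1 * (Jr 0 (W l.+1) x * (1 + x) `^ j%:R)).
move=> ->; first last.
- by apply: aeL_imp We => x _ ->; ring.
- exact: (integL_meas (integLZ (-1) i1)).
- by apply: measurable_funM; [exact: integL_meas (iW _ (ltnW lk))|exact: measurable_powRD].
rewrite ILZl// e mulN1r => /eqP; rewrite oppr_eq0 => /eqP.
have E y : Lam y -> W l.+1 y * Jl 0 (fun x => (1 + x) `^ j%:R) y =
    (j%:R + 1)^-1 * (W l.+1 y * (1 + y) `^ j.+1%:R).
  move=> Ly; rewrite Jl_powRD// betaf_p0// addr0 -natr1; ring.
have i3 : integL (fun y => W l.+1 y * (1 + y) `^ j.+1%:R).
  apply: (@integLMb _ _ _ (2 `^ j.+1%:R)) => //; [exact: iW|exact: measurable_powRD|].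
  move=> y Ly; rewrite ger0_norm ?powR_ge0//.
  by apply: powR2_le => //; move/LamE : Ly => ?; lra.
rewrite (eq_IL E) ILZl// => /eqP; rewrite mulf_eq0 invr_eq0 => /orP[/eqP h|/eqP//].
have j0 : 0 <= j%:R :> R by [].
by exfalso; clear -j0 h; lra.
Qed.

(** The case i = 0 is [kappa_eq0]. For i = j + 1, pairing W_(k-1) = C0 Jr b G with (1 + x)^j
    produces (1 + y)^(b+j+1) by the Beta integral, and the j-th moment of W_(k-1) vanishes for j < k
    - 1. *)
Lemma moments_eq0 (k : nat) b (W : nat -> R -> R) G (C0 : R) : -1 < b < 0 -> (0 < k)%N ->
  (forall l, (l < k)%N -> integL (W l)) ->
  (forall l, (l.+1 < k)%N -> aeL (fun x => W l x = - Jr 0 (W l.+1) x) /\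
        \int[mu]_(x in Lam) W l.+1 x = 0) ->
  C0 != 0 -> measurable_fun Lam G ->
  integL (fun y => G y ^+ 2 * (1 + y) `^ b) ->
  aeL (fun x => W k.-1 x = C0 * Jr b G x) ->
  W k.-1 x @[x --> (-1)^'+] --> (0 : R) ->
  forall i, (i < k)%N -> \int[mu]_(y in Lam) ((1 + y) `^ (b + i%:R) * G y) = 0.
Proof.
move=> b10 k0 iW HW C00 mG iX wE w0 [_|j jk].
  by rewrite addr0; exact: kappa_eq0 b10 C00 mG iX wE w0.
have /andP[b1 b0] := b10.
have iG := weighted_integL1 (ltW b0) mG iX.
have jk1 : (j < k.-1 < k)%N by rewrite -ltnS prednK// jk leqnn.
have := moment_shift iW HW jk1.
have j1 : -1 < j%:R :> R by apply: lt_le_trans (ltrN10 _) _.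
have bj x : Lam x -> `|(1 + x) `^ j%:R| <= 2 `^ (j%:R : R).
  move=> Lx; rewrite ger0_norm ?powR_ge0//.
  by apply: powR2_le => //; move/LamE : Lx => ?; lra.
have [i1 i2 e] := Jr_pair b1 iG (measurable_powRD j%:R) bj.
rewrite (@aeL_IL R (fun x => W k.-1 x * (1 + x) `^ j%:R)
  (fun x => C0 * (Jr b G x * (1 + x) `^ j%:R))); first last.
- by apply: aeL_imp wE => x _ ->; ring.
- exact: (integL_meas (integLZ C0 i1)).
- apply: measurable_funM; last exact: measurable_powRD.
  by apply: integL_meas; apply: iW; rewrite prednK.
rewrite ILZl// e => /eqP; rewrite mulf_eq0 (negbTE C00)/= => /eqP.
have E y : Lam y -> G y * Jl b (fun x => (1 + x) `^ j%:R) y =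
    betaf j%:R b * ((1 + y) `^ (b + j.+1%:R) * G y).
  move=> Ly; rewrite Jl_powRD// -natr1 mulrC -mulrA; congr (_ * (_ `^ _ * _)); ring.
have be0 := beta_gt0 j1 b1.
have i3 : integL (fun y => (1 + y) `^ (b + j.+1%:R) * G y).
  apply: eq_integL (integLZ (betaf j%:R b)^-1 i2) => y Ly.
  by rewrite E// mulKf// gt_eqF.
rewrite (eq_IL E) ILZl// => /eqP; rewrite mulf_eq0 gt_eqF//= => /eqP //.
Qed.

End Coercivity.

(** * Pointwise decay at the endpoints and the stability estimate *)

Section CoercivityBound.
Context {R : realType}.
Notation mu := (@lebesgue_measure R).
Notation Lam := (@Lambda R).
Implicit Types (f g h w G : R -> R) (b : R).

Lemma LamD02 x : Lam x -> 0 < 1 + x <= 2.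
Proof. by move=> /LamE/andP[? ?]; apply/andP; split; lra. Qed.

Lemma LamB02 x : Lam x -> 0 < 1 - x <= 2.
Proof. by move=> /LamE/andP[? ?]; apply/andP; split; lra. Qed.

Lemma IL_tpow0D x : Lam x -> \int[mu]_(y in Lam) tpow 0 (y - x) = 1 - x.
Proof.
move=> Lx; rewrite /Rintegral integral_tpowD ?ltrN10//= add0r divr1.
by rewrite powRr1// ltW// LamB0.
Qed.

Lemma IL_tpow0B x : Lam x -> \int[mu]_(y in Lam) tpow 0 (x - y) = 1 + x.
Proof.
move=> Lx; rewrite /Rintegral integral_tpowB ?ltrN10//= add0r divr1.
by rewrite powRr1// ltW// LamD0.
Qed.

(** Integration up to the endpoint raises the order of vanishing there by one, with the same
    constant; [pass_left] is its mirror image. *)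
Lemma pass_right g (M p : R) x : 0 <= p -> integL g ->
  aeL (fun y => `|g y| <= M * (1 - y) `^ p) -> Lam x -> 0 <= M ->
  `|Jr 0 g x| <= M * (1 - x) `^ (p + 1).
Proof.
move=> p0 ig gM Lx M0; have ii := Jr_EFin_integrable (lexx 0) ig Lx.
have it := integrable_tpowB (ltrN10 _) Lx.
have im : integL (fun y => M * (1 - x) `^ p * tpow 0 (y - x)) by exact: integLZ.
have [|_ h] := @aeL_le R _ _ (integL_meas ii) im.
  apply: aeL_imp gM => y Ly gy; rewrite normrM (ger0_norm (tpow_ge0 _ _)).
  have [xy|yx] := ltP x y; last by rewrite tpow0 ?subr_le0// mul0r mulr0.
  rewrite tpowE ?subr_gt0// powRr0 mul1r mulr1 (le_trans gy)// ler_wpM2l//.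
  by have := LamB0 Ly => ?; apply: ge0_ler_powR; rewrite ?nnegrE//; lra.
apply: (le_trans (le_norm_IL ii)); apply: (le_trans h).
by rewrite ILZl// IL_tpow0D// powRS ?LamB0// [(1 - x) * _]mulrC mulrA.
Qed.

Lemma pass_left g (M p : R) x : 0 <= p -> integL g ->
  aeL (fun y => `|g y| <= M * (1 + y) `^ p) -> Lam x -> 0 <= M ->
  `|Jl 0 g x| <= M * (1 + x) `^ (p + 1).
Proof.
move=> p0 ig gM Lx M0; have ii := integL_Jl (lexx 0) ig Lx.
have it := integrable_tpowBl (ltrN10 _) Lx.
have im : integL (fun y => M * (1 + x) `^ p * tpow 0 (x - y)) by exact: integLZ.
have [|_ h] := @aeL_le R _ _ (integL_meas ii) im.
  apply: aeL_imp gM => y Ly gy; rewrite normrM (ger0_norm (tpow_ge0 _ _)).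
  have [yx|xy] := ltP y x; last by rewrite tpow0 ?subr_le0// mul0r mulr0.
  rewrite tpowE ?subr_gt0// powRr0 mul1r mulr1 (le_trans gy)// ler_wpM2l//.
  by have := LamD0 Ly => ?; apply: ge0_ler_powR; rewrite ?nnegrE//; lra.
apply: (le_trans (le_norm_IL ii)); apply: (le_trans h).
by rewrite ILZl// IL_tpow0B// powRS ?LamD0// [(1 + x) * _]mulrC mulrA.
Qed.

(** Cauchy-Schwarz on ]x, 1[ between (1 - y)^q and its inverse turns a weighted square bound into
    pointwise decay: the integral of (1 - y)^q is at most (1 - x)^(q+1), whose square root is the
    factor obtained. *)
Lemma start_right g (q : R) x : 0 <= q -> integL g ->
  integL (fun y => (1 - y) `^ (- q) * g y ^+ 2) -> Lam x ->
  `|Jr 0 g x| <= Num.sqrt (\int[mu]_(y in Lam) ((1 - y) `^ (- q) * g y ^+ 2)) *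
    (1 - x) `^ ((q + 1) / 2).
Proof.
move=> q0 ig iB Lx; set B := \int[mu]_(y in Lam) _.
have B0 : 0 <= B by apply: IL_ge0 => y _; exact: mulr_ge0 (powR_ge0 _ _) (sqr_ge0 _).
have mg := integL_meas ig.
pose K y : R := tpow 0 (y - x) * (1 - y) `^ q.
pose g' y := g y * (1 - y) `^ (- q).
have K0 y : Lam y -> 0 <= K y by move=> _; rewrite mulr_ge0 ?tpow_ge0 ?powR_ge0.
have Kle y : Lam y -> K y <= (1 - x) `^ q * tpow 0 (y - x).
  move=> Ly; rewrite /K mulrC; have [xy|yx] := ltP x y; last by rewrite tpow0 ?subr_le0// !mulr0.
  apply: ler_wpM2r; first exact: tpow_ge0.
  by have := LamB0 Ly => ?; apply: ge0_ler_powR; rewrite ?nnegrE//; lra.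
have mK : measurable_fun Lam K.
  by apply: measurable_funM; [exact: measurable_tpowB|exact: measurable_powRB].
have it := integrable_tpowB (ltrN10 _) Lx.
have iK : integL K.
  apply: (integL_le mK (integLZ ((1 - x) `^ q) it)) => y Ly.
  by rewrite ger0_norm ?K0// Kle.
have pq y : Lam y -> (1 - y) `^ q * (1 - y) `^ (- q) = 1.
  by move=> Ly; rewrite powRN mulfV// gt_eqF// powR_gt0// LamB0.
have e1 y : Lam y -> K y * g' y = tpow 0 (y - x) * g y.
  move=> Ly; rewrite /K /g'.
  set u := (1 - y) `^ (- q); set v := (1 - y) `^ q.
  have -> : tpow 0 (y - x) * v * (g y * u) = tpow 0 (y - x) * g y * (v * u) by ring.
  by rewrite pq// mulr1.
have e2 y : Lam y -> K y * g' y ^+ 2 = tpow 0 (y - x) * ((1 - y) `^ (- q) * g y ^+ 2).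
  move=> Ly; rewrite /K /g'.
  set u := (1 - y) `^ (- q); set v := (1 - y) `^ q.
  have -> : tpow 0 (y - x) * v * (g y * u) ^+ 2 =
    tpow 0 (y - x) * (u * g y ^+ 2) * (v * u) by ring.
  by rewrite pq// mulr1.
have iKg : integL (fun y => K y * g' y ^+ 2).
  apply: eq_integL (Jr_EFin_integrable (lexx 0) iB Lx) => y Ly.
  by rewrite e2.
have mg' : measurable_fun Lam g'.
  by apply: measurable_funM => //; exact: measurable_powRB.
have [_ cs] := weighted_CS K0 mg' iK iKg.
have h1 : \int[mu]_(y in Lam) K y <= (1 - x) `^ (q + 1).
  apply: (le_trans (IL_le iK (integLZ ((1 - x) `^ q) it) Kle)).
  by rewrite ILZl// IL_tpow0D// powRS ?LamB0// mulrC.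
have h2 : \int[mu]_(y in Lam) (K y * g' y ^+ 2) <= B.
  apply: IL_le => // y Ly; rewrite e2//.
  apply: ler_piMl; first exact: mulr_ge0 (powR_ge0 _ _) (sqr_ge0 _).
  by rewrite /tpow; case: ifP => //; rewrite powRr0.
have : Jr 0 g x ^+ 2 <= B * (1 - x) `^ (q + 1).
  rewrite /Jr -(eq_IL e1); apply: (le_trans cs); rewrite [leRHS]mulrC.
  apply: ler_pM => //; first exact: IL_ge0.
  by apply: IL_ge0 => y Ly; exact: mulr_ge0 (K0 _ Ly) (sqr_ge0 _).
have -> : (1 - x) `^ (q + 1) = ((1 - x) `^ ((q + 1) / 2)) ^+ 2.
  rewrite expr2 -powRD ?(gt_eqF (LamB0 Lx)) ?implybT//.
  by congr (_ `^ _); field.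
move=> h; rewrite -(ler_sqr (normr_ge0 _)); last first.
  by rewrite nnegrE mulr_ge0 ?sqrtr_ge0 ?powR_ge0.
by rewrite exprMn sqr_sqrtr// real_normK ?num_real.
Qed.

Lemma start_left g x : integL g -> integL (fun y => (1 + y)^-1 * g y ^+ 2) -> Lam x ->
  `|Jl 0 g x| <= Num.sqrt (\int[mu]_(y in Lam) ((1 + y)^-1 * g y ^+ 2)) *
    (1 + x) `^ 1.
Proof.
move=> ig iA Lx; set A := \int[mu]_(y in Lam) _.
have v0 y : Lam y -> 0 <= (1 + y)^-1 by move=> Ly; rewrite invr_ge0 ltW// LamD0.
have A0 : 0 <= A by apply: IL_ge0 => y Ly; exact: mulr_ge0 (v0 _ Ly) (sqr_ge0 _).
have mg := integL_meas ig.
pose K y : R := tpow 0 (x - y) * (1 + y).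
pose g' y := g y * (1 + y) `^ (-1).
have K0 y : Lam y -> 0 <= K y by move=> Ly; rewrite mulr_ge0 ?tpow_ge0// ltW// LamD0.
have Kle y : Lam y -> K y <= (1 + x) * tpow 0 (x - y).
  move=> Ly; rewrite /K mulrC; have [yx|xy] := ltP y x; last by rewrite tpow0 ?subr_le0// !mulr0.
  by apply: ler_wpM2r; [exact: tpow_ge0|lra].
have mK : measurable_fun Lam K.
  by apply: measurable_funM; [exact: measurable_tpowBl|exact: measurable_funD].
have it := integrable_tpowBl (ltrN10 _) Lx.
have iK : integL K.
  apply: (integL_le mK (integLZ (1 + x) it)) => y Ly.
  by rewrite ger0_norm ?K0// Kle.
have inv y : Lam y -> (1 + y) `^ (-1) = (1 + y)^-1.
  by move=> Ly; rewrite powR_inv1// ltW// LamD0.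
have n0 y : Lam y -> 1 + y != 0 by move=> Ly; rewrite gt_eqF// LamD0.
have e1 y : Lam y -> K y * g' y = tpow 0 (x - y) * g y.
  by move=> Ly; rewrite /K /g' inv//; field; exact: n0.
have e2 y : Lam y -> K y * g' y ^+ 2 = tpow 0 (x - y) * ((1 + y)^-1 * g y ^+ 2).
  by move=> Ly; rewrite /K /g' inv//; field; exact: n0.
have iKg : integL (fun y => K y * g' y ^+ 2).
  apply: eq_integL (integL_Jl (lexx 0) iA Lx) => y Ly.
  by rewrite e2.
have mg' : measurable_fun Lam g'.
  by apply: measurable_funM => //; exact: measurable_powRD.
have [_ cs] := weighted_CS K0 mg' iK iKg.
have h1 : \int[mu]_(y in Lam) K y <= (1 + x) ^+ 2.
  apply: (le_trans (IL_le iK (integLZ (1 + x) it) Kle)).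
  by rewrite ILZl// IL_tpow0B// expr2.
have h2 : \int[mu]_(y in Lam) (K y * g' y ^+ 2) <= A.
  apply: IL_le => // y Ly; rewrite e2//.
  apply: ler_piMl; first exact: mulr_ge0 (v0 _ Ly) (sqr_ge0 _).
  by rewrite /tpow; case: ifP => //; rewrite powRr0.
have : Jl 0 g x ^+ 2 <= A * (1 + x) ^+ 2.
  rewrite /Jl -(eq_IL e1); apply: (le_trans cs); rewrite [leRHS]mulrC.
  apply: ler_pM => //; first exact: IL_ge0.
  by apply: IL_ge0 => y Ly; exact: mulr_ge0 (K0 _ Ly) (sqr_ge0 _).
have x0 := ltW (LamD0 Lx).
move=> h; rewrite powRr1// -(ler_sqr (normr_ge0 _)); last first.
  by rewrite nnegrE mulr_ge0 ?sqrtr_ge0.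
by rewrite exprMn sqr_sqrtr// real_normK ?num_real.
Qed.

(** The first integration, from W_(k-1) to W_(k-2), converts square integrability into decay, and k
    - 2 further ones reach W_0. Zero means give Jr 0 W = - Jl 0 W, so each step can be estimated
    from either end. *)
Lemma coercivity_chain (W : nat -> R -> R) (k : nat) (B A q : R) : (1 < k)%N ->
  0 <= q ->
  (forall l, (l < k)%N -> integL (W l)) ->
  (forall l, (l.+1 < k)%N -> aeL (fun x => W l x = - Jr 0 (W l.+1) x) /\
        \int[mu]_(x in Lam) W l.+1 x = 0) ->
  integL (fun y => (1 - y) `^ (- q) * W k.-1 y ^+ 2) ->
  integL (fun y => (1 + y)^-1 * W k.-1 y ^+ 2) ->
  \int[mu]_(y in Lam) ((1 - y) `^ (- q) * W k.-1 y ^+ 2) <= B ->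
  \int[mu]_(y in Lam) ((1 + y)^-1 * W k.-1 y ^+ 2) <= A ->
  aeL (fun x => `|W 0%N x| <= Num.sqrt B * (1 - x) `^ ((q + 1) / 2 + (k - 2)%:R) /\
                `|W 0%N x| <= Num.sqrt A * (1 + x) `^ (1 + (k - 2)%:R)).
Proof.
move=> k1 q0 iW HW iB iA hB hA.
have k0 : (0 < k)%N by exact: ltnW.
have We l : (l.+1 < k)%N -> aeL (fun x => `|W l x| = `|Jr 0 (W l.+1) x| /\
    `|W l x| = `|Jl 0 (W l.+1) x|).
  move=> lk; have [We W0] := HW _ lk; apply: aeL_imp We => x Lx ->.
  rewrite normrN; split; first exact: erefl.
  have := Jr0_Jl0 (iW _ lk) Lx; rewrite W0 => /eqP.
  by rewrite addr_eq0 => /eqP ->; rewrite normrN.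
suff H j : (j <= k - 2)%N -> aeL (fun x =>
    `|W (k - 2 - j)%N x| <= Num.sqrt B * (1 - x) `^ ((q + 1) / 2 + j%:R) /\
    `|W (k - 2 - j)%N x| <= Num.sqrt A * (1 + x) `^ (1 + j%:R)).
  by have := H (k - 2)%N (leqnn _); rewrite subnn.
elim: j => [_|j IH jk].
  rewrite subn0; have lk : ((k - 2).+1 < k)%N by rewrite -subSn// subSS; lia.
  have e : (k - 2).+1 = k.-1 by lia.
  apply: aeL_imp (We _ lk) => x Lx; rewrite e !addr0 => -[h1 h2].
  have iWk : integL (W k.-1) by apply: iW; rewrite prednK.
  split.
    rewrite h1; apply: (le_trans (start_right q0 iWk iB Lx)).
    by apply: ler_wpM2r; [exact: powR_ge0|exact: ler_wsqrtr].
  rewrite h2; apply: (le_trans (start_left iWk iA Lx)).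
  by apply: ler_wpM2r; [exact: powR_ge0|exact: ler_wsqrtr].
have lk : ((k - 2 - j.+1).+1 < k)%N by lia.
have e : (k - 2 - j.+1).+1 = (k - 2 - j)%N by lia.
have ej : j.+1%:R = j%:R + 1 :> R by rewrite natr1.
have {}IH := IH (ltnW jk).
have ig : integL (W (k - 2 - j)%N) by apply: iW; lia.
apply: aeL_imp (We _ lk) => x Lx; rewrite e => -[h1 h2]; split.
  rewrite h1 ej addrA; apply: (@pass_right _ _ _ _ _ ig _ Lx (sqrtr_ge0 _)).
    by rewrite addr_ge0// divr_ge0// addr_ge0.
  by apply: aeL_imp IH => y _ [].
rewrite h2 ej addrA; apply: (@pass_left _ _ _ _ _ ig _ Lx (sqrtr_ge0 _)).
  by rewrite addr_ge0.
by apply: aeL_imp IH => y _ [].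
Qed.


(** At each point of Lambda one of the two weight factors is at most 1, so the weighted square of
    [e] is at most the sum of two one-sided ones, handled by [right_bound] and by [left_bound] with
    kappa = 0. *)
Lemma coercivity (k : nat) b : (0 < k)%N -> -1 < b < 0 ->
  exists2 C : R, 0 <= C & forall e G,
    boundary_conditions k e -> integL e -> measurable_fun Lam G ->
    integL (fun y => G y ^+ 2 * (1 + y) `^ b) ->
    is_weak_derivative k (Jr (- b - 1) e) G ->
    integL (fun x => e x ^+ 2 * ((1 - x) `^ (- (b + k%:R)) * (1 + x) `^ (- k%:R))) ->
    (forall i, (i < k)%N -> \int[mu]_(y in Lam) ((1 + y) `^ (b + i%:R) * G y) = 0) /\
    \int[mu]_(x in Lam) (e x ^+ 2 * ((1 - x) `^ (- (b + k%:R)) * (1 + x) `^ (- k%:R)))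
      <= C * \int[mu]_(y in Lam) (G y ^+ 2 * (1 + y) `^ b).
Proof.
move=> k0 b10; have /andP[b1 b0] := b10.
have [Cr Cr0 HR] := right_bound b1.
have [Cl Cl0 HL] := left_bound b10.
pose p := - b - 1; have p1 : -1 < p by rewrite /p; lra.
have be0 := beta_gt0 b1 p1.
pose c0 : R := - (betaf b p)^-1.
have c00 : c0 != 0 by rewrite oppr_eq0 invr_eq0 gt_eqF.
pose D := (2 `^ (k - 2)%:R : R).
have D0 : 0 <= D by exact: powR_ge0.
(* The factor c0^2 converts bounds on [Jr b G] into bounds on [W k.-1]. In 1 + 2 D, the 1 serves k =
   1 and 2 D serves k >= 2, with D = 2^(k-2) and 2 the length of Lambda. *)
exists (c0 ^+ 2 * (Cr + Cl) * (1 + 2 * D)).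
  apply: mulr_ge0; last by rewrite addr_ge0// mulr_ge0.
  by apply: mulr_ge0; [exact: sqr_ge0|exact: addr_ge0].
move=> e G bc ie mG iX wG iE.
have iG := weighted_integL1 (ltW b0) mG iX.
have [W [iW W0 HW WG wl]] := representation k0 b10 bc ie iG wG.
have mom := moments_eq0 b10 k0 iW HW c00 mG iX WG wl.
split=> //.
set X := \int[mu]_(y in Lam) (G y ^+ 2 * (1 + y) `^ b).
have X0 : 0 <= X by apply: IL_ge0 => y _; exact: mulr_ge0 (sqr_ge0 _) (powR_ge0 _ _).
have [iR hR] := HR G mG iG iX.
have [iL hL] := HL G mG iG iX.
have kap0 : \int[mu]_(y in Lam) ((1 + y) `^ b * G y) = 0.
  by have := mom 0%N k0; rewrite addr0.
rewrite kap0 in iL hL.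
have k1k : (k.-1 < k)%N by rewrite prednK.
have mW : measurable_fun Lam (W k.-1) by exact: (integL_meas (iW _ k1k)).
have [_ iJ] := Jr_integL b1 iG; have mJ := integL_meas iJ.
have iB : integL (fun y => (1 - y) `^ (- (b + 1)) * W k.-1 y ^+ 2).
  apply: (@aeL_integL _ (fun y => c0 ^+ 2 * ((1 - y) `^ (- (b + 1)) * Jr b G y ^+ 2))).
  - by apply: measurable_funM; [exact: measurable_powRB|exact: measurable_funX].
  - by apply: aeL_imp WG => y _ ->; rewrite -/c0; ring.
  - exact: integLZ.
have hB : \int[mu]_(y in Lam) ((1 - y) `^ (- (b + 1)) * W k.-1 y ^+ 2) <= c0 ^+ 2 * Cr * X.
  rewrite (@aeL_IL _ _ (fun y => c0 ^+ 2 * ((1 - y) `^ (- (b + 1)) * Jr b G y ^+ 2))).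
  - by rewrite ILZl// -mulrA; apply: ler_wpM2l; [exact: sqr_ge0|].
  - exact: (integL_meas iB).
  - exact: (integL_meas (integLZ (c0 ^+ 2) iR)).
  - by apply: aeL_imp WG => y _ ->; rewrite -/c0; ring.
have mv : measurable_fun Lam (fun x : R => (1 + x)^-1).
  have := @measurable_powRD R (-1); apply: eq_measurable_fun => x.
  by rewrite inE => Lx; rewrite powR_inv1// ltW// LamD0.
have iA : integL (fun y => (1 + y)^-1 * W k.-1 y ^+ 2).
  apply: (@aeL_integL _ (fun y => c0 ^+ 2 * ((1 + y)^-1 * (Jr b G y - 0) ^+ 2))).
  - by apply: measurable_funM; [exact: mv|exact: measurable_funX].
  - by apply: aeL_imp WG => y _ ->; rewrite -/c0; ring.
  - exact: integLZ.
have hA : \int[mu]_(y in Lam) ((1 + y)^-1 * W k.-1 y ^+ 2) <= c0 ^+ 2 * Cl * X.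
  rewrite (@aeL_IL _ _ (fun y => c0 ^+ 2 * ((1 + y)^-1 * (Jr b G y - 0) ^+ 2))).
  - by rewrite ILZl// -mulrA; apply: ler_wpM2l; [exact: sqr_ge0|].
  - exact: (integL_meas iA).
  - exact: (integL_meas (integLZ (c0 ^+ 2) iL)).
  - by apply: aeL_imp WG => y _ ->; rewrite -/c0; ring.
have cc0 : 0 <= c0 ^+ 2 by exact: sqr_ge0.
pose E x := e x ^+ 2 * ((1 - x) `^ (- (b + k%:R)) * (1 + x) `^ (- k%:R)).
have E0 x : Lam x -> 0 <= E x.
  by move=> _; exact: mulr_ge0 (sqr_ge0 _) (mulr_ge0 (powR_ge0 _ _) (powR_ge0 _ _)).
have mE : measurable_fun Lam E by exact: (integL_meas iE).
have kR1 : 1 <= k%:R :> R by rewrite ler1n.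
have Ele x : Lam x -> E x <= e x ^+ 2 * (1 - x) `^ (- (b + k%:R)) + e x ^+ 2 * (1 + x) `^ (- k%:R).
  move=> Lx; rewrite /E -mulrDr; apply: ler_wpM2l; first exact: sqr_ge0.
  have u0 := powR_ge0 (1 - x) (- (b + k%:R)); have v0 := powR_ge0 (1 + x) (- k%:R).
  have le1 (t c : R) : 1 <= t -> 0 <= c -> t `^ (- c) <= 1.
    move=> t1 c00'; rewrite powRN invf_le1 ?powR_gt0//; last by clear -t1; lra.
    have -> : 1 = 1 `^ c :> R by rewrite powR1.
    by apply: ge0_ler_powR; rewrite ?nnegrE//; clear -t1; lra.
  have [x0|x0] := leP 0 x.
    have h : (1 + x) `^ (- k%:R) <= 1 by apply: le1; clear -x0 kR1 b1; lra.
    by apply: (le_trans (ler_piMr u0 h)); rewrite lerDl.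
  have h : (1 - x) `^ (- (b + k%:R)) <= 1 by apply: le1; clear -x0 kR1 b1; lra.
  by apply: (le_trans (ler_piMl v0 h)); rewrite lerDr.
have fin (g : R -> R) (M : R) : integL g -> aeL (fun x => E x <= g x) ->
    \int[mu]_(x in Lam) g x <= M -> \int[mu]_(x in Lam) E x <= M.
  move=> ig Eg gM; have [|_ h] := @aeL_le R E g mE ig.
    by apply: aeL_imp Eg => x Lx h; rewrite ger0_norm// E0.
  apply: le_trans gM; apply: le_trans h.
  exact: le_trans (ler_norm _) (le_norm_IL iE).
(* For k = 1 the bounds on W_(k-1) = W_0 already carry the required weights; no integration is left
   to convert them into pointwise decay. *)
have [k1|k1] := leqP k 1.
  have ek : k = 1%N by apply/eqP; rewrite eqn_leq k1 k0.
  rewrite ek /= in iB hB iA hA.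
  apply: (fin _ _ (integLD iB iA)).
    apply: aeL_imp W0 => x Lx We; apply: le_trans (Ele x Lx) _; rewrite We.
    have x0 := LamD0 Lx.
    have -> : (1 + x) `^ (- k%:R) = (1 + x)^-1 by rewrite ek powR_inv1// ltW.
    have -> : b + k%:R = b + 1 by rewrite ek.
    by rewrite [_ * e x ^+ 2]mulrC [X in _ <= _ + X]mulrC.
  rewrite ILD//; apply: (le_trans (lerD hB hA)).
  have -> : c0 ^+ 2 * Cr * X + c0 ^+ 2 * Cl * X = c0 ^+ 2 * (Cr + Cl) * 1 * X by ring.
  apply: ler_wpM2r => //; apply: ler_wpM2l; first by rewrite mulr_ge0// addr_ge0.
  by clear -D0; lra.
have q0 : 0 <= b + 1 by clear -b1; lra.
have pt := coercivity_chain k1 q0 iW HW iB iA hB hA.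
have k2 : k%:R = (k - 2)%:R + 2 :> R by rewrite -natrD subnK.
have B0 : 0 <= c0 ^+ 2 * Cr * X by rewrite mulr_ge0// mulr_ge0.
have A0 : 0 <= c0 ^+ 2 * Cl * X by rewrite mulr_ge0// mulr_ge0.
(* The decay exponents beat the weights equally at both ends: 2 r - c = k - 2 for r = (b + 2) / 2 +
   k - 2, c = b + k on the right and for r = k - 1, c = k on the left. *)
have bnd (M t r c : R) : 0 <= M -> 0 < t <= 2 -> 2 * r - c = (k - 2)%:R ->
    forall z, `|z| <= Num.sqrt M * t `^ r -> z ^+ 2 * t `^ (- c) <= M * D.
  move=> M0 /andP[t0 t2] rc z hz.
  have zz : z ^+ 2 <= M * t `^ (2 * r).
    have -> : M * t `^ (2 * r) = (Num.sqrt M * t `^ r) ^+ 2.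
      by rewrite exprMn sqr_sqrtr// [2 * r]mulrC powRrM -[2]/(2%:R) powR_mulrn ?powR_ge0.
    by rewrite -real_normK ?num_real// ler_sqr ?nnegrE ?mulr_ge0 ?sqrtr_ge0 ?powR_ge0.
  apply: (le_trans (ler_wpM2r (powR_ge0 _ _) zz)).
  rewrite -mulrA -powRD; last by rewrite (gt_eqF t0) implybT.
  rewrite rc; apply: ler_wpM2l => //; apply: ge0_ler_powR; rewrite ?nnegrE//.
  exact: ltW.
have iDD : integL (fun=> (c0 ^+ 2 * Cr * X + c0 ^+ 2 * Cl * X) * D) by exact: integL_cst.
apply: (fin _ _ iDD).
  have W0pt := aeL_and W0 pt; apply: aeL_imp W0pt => x Lx [-> [hr hl]].
  apply: le_trans (Ele x Lx) _; rewrite mulrDl; apply: lerD.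
    apply: (bnd _ _ _ _ B0 _ _ _ hr); last by rewrite k2; field.
    exact: LamB02.
  apply: (bnd _ _ _ _ A0 _ _ _ hl); last by rewrite k2; ring.
  exact: LamD02.
rewrite [leLHS](@Rintegral_cst _ _ _ mu _ measurable_LamR).
have -> : fine (mu Lam) = 1 - -1.
  by rewrite /Lambda lebesgue_measure_itv/= lte_fin ifT//; clear; lra.
have h0 : 0 <= c0 ^+ 2 * (Cr + Cl) * X.
  by rewrite mulr_ge0// mulr_ge0// addr_ge0.
have -> : (c0 ^+ 2 * Cr * X + c0 ^+ 2 * Cl * X) * D * (1 - -1) =
  c0 ^+ 2 * (Cr + Cl) * X * (2 * D) by ring.
have -> : c0 ^+ 2 * (Cr + Cl) * (1 + 2 * D) * X =
  c0 ^+ 2 * (Cr + Cl) * X * (1 + 2 * D) by ring.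
apply: ler_wpM2l; first exact: h0.
by clear; lra.
Qed.

End CoercivityBound.

(** * Integration by parts against Jacobi weights *)

Section ByParts.
Context {R : realType}.
Notation mu := (@lebesgue_measure R).
Notation Lam := (@Lambda R).
Implicit Types (f g h w G H : R -> R) (b : R) (P Q q : {poly R}).

(* [d/dx (P w) = (jac_op al be P) w / (1 - x^2)] for
   [w = (1 - x)^al (1 + x)^be]. *)
Definition jac_op (al be : R) P : {poly R} :=
  P^`() * (1 - 'X^2) + P * (be *: (1 - 'X) - al *: (1 + 'X)).

(** The polynomial factor of the m-th derivative of P (1 - x)^al (1 + x)^be; each differentiation
    lowers both exponents by one. For al = m and be = b + m this is the map of Rodrigues'
    formula. *)
Fixpoint jac_iter (al be : R) m P : {poly R} :=
  if m is m'.+1 then jac_op (al - m'%:R) (be - m'%:R) (jac_iter al be m' P) else P.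

(* For [Q = 1] these are smooth cutoffs, tending to [1] on Lambda; the other [Q]
   arise from differentiation. *)
Definition cutoff (Q : {poly R}) (n : nat) (x : R) : R :=
  expflat Q (n.+1%:R * (1 - x ^+ 2) - 1).

Definition cutP (L : seq ({poly R} * {poly R})) (al be : R) (n : nat) (x : R) : R :=
  (\sum_(PQ <- L) PQ.1.[x] * cutoff PQ.2 n x) * ((1 - x) `^ al * (1 + x) `^ be).

(** The first half of the list differentiates P times the weight, the second half the cutoff. *)
Definition cut_next (al be : R) (L : seq ({poly R} * {poly R})) :=
  [seq (jac_op al be PQ.1, PQ.2) | PQ <- L] ++
  [seq (- 2%:R *: 'X * PQ.1, ('X + 'X^2) * (PQ.2 - PQ.2^`())) | PQ <- L].

Fixpoint cut_iter (al be : R) m L :=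
  if m is m'.+1 then cut_next (al - m'%:R) (be - m'%:R) (cut_iter al be m' L) else L.

Lemma is_derive_eqR f (x l l' : R) : is_derive x 1 f l -> l = l' -> is_derive x 1 f l'.
Proof. by move=> h <-. Qed.

(** This keeps derivatives of the cutoffs bounded uniformly in n. Differentiating a cutoff produces
    the factor n + 1; lowering the weight exponents frees a factor 1 - x^2, and with t = (n + 1)(1 -
    x^2) - 1 their product is t + 1, absorbed here into a polynomial in 1 / t independent of n. *)
Lemma expflat_shift Q (t : R) :
  (t + 1) * expflat ('X^2 * Q) t = expflat (('X + 'X^2) * Q) t.
Proof.
rewrite /expflat; case: ifP => t0; last by rewrite mulr0.
rewrite !hornerM hornerD !hornerXn hornerX.
set u := Q.[_]; set v := expR _; rewrite !mulrA; congr (_ * _ * _).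
by field; rewrite gt_eqF.
Qed.

Lemma is_derive_cutoff Q n (x : R) : is_derive x 1 (cutoff Q n)
  (expflat ('X^2 * (Q - Q^`())) (n.+1%:R * (1 - x ^+ 2) - 1) * (n.+1%:R * (- (2 * x)))).
Proof.
have hq : is_derive x 1 (fun x : R => n.+1%:R * (1 - x ^+ 2) - 1) (n.+1%:R * (- (2 * x))).
  have e : (fun x : R => n.+1%:R * (1 - x ^+ 2) - 1) =
      horner (n.+1%:R *: (1 - 'X^2) - 1).
    by apply/funext => z; rewrite !hornerE.
  have := is_derive_horner (n.+1%:R *: (1 - 'X^2) - 1) x.
  rewrite -e => /is_derive_eqR; apply.
  rewrite derivB derivZ derivB -!polyC1 !derivC derivXn expr1.
  by rewrite subr0 sub0r hornerZ hornerN hornerMn hornerX; ring.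
have := @is_derive1_comp _ (expflat Q) _ x _ _ (is_derive_expflat Q _) hq.
exact.
Qed.

Lemma is_derive_jacw (al be x : R) : Lam x ->
  is_derive x 1 (fun x => (1 - x) `^ al * (1 + x) `^ be)
   ((be * (1 - x) - al * (1 + x)) * ((1 - x) `^ (al - 1) * (1 + x) `^ (be - 1))).
Proof.
move=> Lx; have := is_deriveMR (is_derive_powRB al (LamB0 Lx)) (is_derive_powRD be (LamD0 Lx)).
move=> /is_derive_eqR; apply.
have -> : (1 - x) `^ al = (1 - x) * (1 - x) `^ (al - 1) by rewrite -powRS ?LamB0// subrK.
have -> : (1 + x) `^ be = (1 + x) * (1 + x) `^ (be - 1) by rewrite -powRS ?LamD0// subrK.
by ring.
Qed.

Lemma is_derive_sumR (I : Type) (r : seq I) (F : I -> R -> R) (dF : I -> R) (x : R) :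
  (forall i, is_derive x 1 (F i) (dF i)) ->
  is_derive x 1 (fun z => \sum_(i <- r) F i z) (\sum_(i <- r) dF i).
Proof.
move=> dr; elim: r => [|i r IH].
  have -> : (fun z => \sum_(i <- [::]) F i z) = cst 0.
    by apply/funext => z; rewrite big_nil.
  by rewrite big_nil; exact: is_derive_cst.
have -> : (fun z => \sum_(j <- i :: r) F j z) = (fun z => F i z + \sum_(j <- r) F j z).
  by apply/funext => z; rewrite big_cons.
by rewrite big_cons; exact: is_deriveD.
Qed.

Lemma is_derive_cutP L al be n (x : R) : Lam x ->
  is_derive x 1 (cutP L al be n) (cutP (cut_next al be L) (al - 1) (be - 1) n x).
Proof.
move=> Lx.
pose E (PQ : {poly R} * {poly R}) := expflat ('X^2 * (PQ.2 - PQ.2^`())) (n.+1%:R * (1 - x ^+ 2) - 1).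
have d1 (PQ : {poly R} * {poly R}) : is_derive x 1 (fun x => PQ.1.[x] * cutoff PQ.2 n x)
    ((PQ.1^`()).[x] * cutoff PQ.2 n x + PQ.1.[x] * (E PQ * (n.+1%:R * (- (2 * x))))).
  exact: (is_deriveMR (is_derive_horner _ _) (is_derive_cutoff _ _ _)).
have := is_deriveMR (is_derive_sumR L d1) (is_derive_jacw al be Lx).
move=> /is_derive_eqR; apply.
have -> : (1 - x) `^ al = (1 - x) * (1 - x) `^ (al - 1) by rewrite -powRS ?LamB0// subrK.
have -> : (1 + x) `^ be = (1 + x) * (1 + x) `^ (be - 1) by rewrite -powRS ?LamD0// subrK.
rewrite /cutP; set u := (1 - x) `^ (al - 1); set v := (1 + x) `^ (be - 1).
rewrite (_ : _ + _ = ((\sum_(i <- L) ((i.1^`()).[x] * cutoff i.2 n x +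
    i.1.[x] * (E i * (n.+1%:R * - (2 * x))))) * ((1 - x) * (1 + x)) +
  (\sum_(i <- L) i.1.[x] * cutoff i.2 n x) * (be * (1 - x) - al * (1 + x))) * (u * v)).
  congr (_ * _); rewrite /cut_next big_cat/= !big_map !mulr_suml -!big_split/=.
  apply: eq_bigr => -[P Q] _ /=.
  rewrite [cutoff (_ * _) _ _]/cutoff -expflat_shift /E/=.
  set e := expflat _ _; set c := cutoff _ _ _; set a := n.+1%:R.
  rewrite /jac_op !(hornerD, hornerM, hornerN, hornerZ, hornerX, hornerXn, hornerC).
  by ring.
by ring.
Qed.

Lemma derive1n_cutP L al be n m (x : R) : Lam x ->
  derive1n m (cutP L al be n) x =
  cutP (cut_iter al be m L) (al - m%:R) (be - m%:R) n x.
Proof.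
elim: m x => [|m IH] x Lx; first by rewrite !subr0.
have fg : {in Lam, derive1n m (cutP L al be n) =1
    cutP (cut_iter al be m L) (al - m%:R) (be - m%:R) n}.
  by move=> y; rewrite inE => Ly; exact: IH.
rewrite derive1nS (derive1_eq_on open_Lam fg (mem_set Lx)).
have h := is_derive_cutP (cut_iter al be m L) (al - m%:R) (be - m%:R) n Lx.
rewrite derive1E (@derive_val _ _ _ _ _ _ _ h)/=.
by rewrite -natr1 !opprD !addrA.
Qed.

Lemma test_cutP L al be n : test_function (cutP L al be n).
Proof.
have [t et] : exists t : R, t = (2 * n.+1%:R)^-1 by exists (2 * n.+1%:R)^-1.
(* The cutoff vanishes where 1 - x^2 <= 1 / (n + 1), and 1 - c^2 = 2 t - t^2 <= 2 t = 1 / (n +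
   1). *)
pose c : R := 1 - t.
have n0 : 0 < (n.+1%:R : R) by rewrite ltr0n.
have i0 : 0 < t by rewrite et invr_gt0 mulr_gt0.
have i1 : t < 1.
  by rewrite et invf_lt1 ?mulr_gt0//; have : 1 <= n.+1%:R :> R; [rewrite ler1n|lra].
have c1 : c < 1 by rewrite /c; lra.
have c0 : 0 < c by rewrite /c; lra.
have Z (x : R) : x \notin `[- c, c] -> cutP L al be n x = 0.
  move=> xc; rewrite /cutP big1 ?mul0r// => PQ _; rewrite /cutoff /expflat ifF ?mulr0//.
  apply/negP/negP; rewrite -leNgt subr_le0 mulrC -ler_pdivlMr// mul1r.
  have cx : c ^+ 2 <= x ^+ 2.
    rewrite -[x ^+ 2]real_normK ?num_real// ler_sqr ?nnegrE ?normr_ge0 ?(ltW c0)//.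
    move: xc; rewrite in_itv/= negb_and -!ltNge => /orP[] h.
      by rewrite ler_normr; apply/orP; right; lra.
    by rewrite ler_normr; apply/orP; left; lra.
  have : 1 - c ^+ 2 <= n.+1%:R^-1.
    have -> : (n.+1%:R : R)^-1 = 2 * t by rewrite et; field; rewrite gt_eqF.
    by rewrite /c; nra.
  by move=> h; apply: le_trans h; rewrite lerD2l lerN2.
split; last by exists (- c), c; split => //; lra.
move=> m x; have [xL|xL] := pselect (Lam x).
  apply: (@derivable_eq_on _ _ (cutP (cut_iter al be m L) (al - m%:R) (be - m%:R) n) _ _ open_Lam _ xL).
    by move=> y; rewrite inE => Ly; rewrite derive1n_cutP.
  exact: (@ex_derive _ _ _ _ _ _ _ (is_derive_cutP _ _ _ _ xL)).
have oU : open (~` `[- c, c]%classic : set R) by apply: closed_openC; exact: interval_closed.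
have xU : (~` `[- c, c]%classic) x by move=> /=; rewrite in_itv/= => h; apply/xL/LamE; lra.
apply: (@derivable_eq_on _ _ (cst 0) _ _ oU _ xU); last exact: derivable_cst.
move=> y; rewrite inE => yU.
rewrite (@derive1n_eq_on _ _ m _ (cst 0) oU _ _ (mem_set yU)).
  have e0 : derive1 (cst 0 : R -> R) = cst 0 by apply/funext => z; rewrite derive1_cst.
  by elim: m => [//|m IH]; rewrite derive1Sn e0.
by move=> z; rewrite inE => zU; apply: Z; apply/negP.
Qed.

Lemma cutoff_bound Q : exists2 C : R, 0 <= C & forall n x, `|cutoff Q n x| <= C.
Proof.
have [C C0 HC] := expflat_le Q 0; exists C => // n x.
by have := HC (n.+1%:R * (1 - x ^+ 2) - 1); rewrite expr0 mulr1.
Qed.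

Lemma horner_Lam_bound P : exists2 C : R, 0 <= C & forall x, Lam x -> `|P.[x]| <= C.
Proof.
have [ub Hub] := poly_itv_bound P (-1) 1.
exists `|ub|; first exact: normr_ge0.
move=> x /LamE Lx; apply: le_trans (ler_norm _).
by apply: Hub; lra.
Qed.

Lemma cutP_bound L al be : exists2 C : R, 0 <= C & forall n x, Lam x ->
  `|cutP L al be n x| <= C * ((1 - x) `^ al * (1 + x) `^ be).
Proof.
have [C C0 HC] : exists2 C : R, 0 <= C & forall n x, Lam x ->
    `|\sum_(PQ <- L) PQ.1.[x] * cutoff PQ.2 n x| <= C.
  elim: L => [|PQ L [C C0 IH]].
    by exists 0 => // n x _; rewrite big_nil normr0.
  have [C1 C10 H1] := horner_Lam_bound PQ.1; have [C2 C20 H2] := cutoff_bound PQ.2.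
  exists (C1 * C2 + C) => [|n x Lx]; first by rewrite addr_ge0// mulr_ge0.
  rewrite big_cons; apply: (le_trans (ler_normD _ _)); apply: lerD; last exact: IH.
  by rewrite normrM; apply: ler_pM => //; exact: H1.
exists C => // n x Lx; rewrite /cutP normrM.
rewrite (ger0_norm (mulr_ge0 (powR_ge0 _ _) (powR_ge0 _ _))).
by apply: ler_wpM2r (HC n x Lx); exact: mulr_ge0 (powR_ge0 _ _) (powR_ge0 _ _).
Qed.

(** On Lambda the argument of the cutoff tends to infinity, so [Q] is evaluated in the limit at
    0. *)
Definition cut_lim (L : seq ({poly R} * {poly R})) : {poly R} :=
  \sum_(PQ <- L) PQ.2.[0] *: PQ.1.

Lemma cutoff_cvg Q (x : R) : Lam x -> cutoff Q n x @[n --> \oo] --> Q.[0].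
Proof.
move=> Lx; pose y : R := 1 - x ^+ 2.
have y0 : 0 < y by move/LamE: Lx => /andP[? ?]; rewrite /y; nra.
pose t n : R := n.+1%:R * y - 1.
have toy : t n @[n --> \oo] --> +oo.
  apply/cvgryPge => A; near=> n; rewrite /t lerBrDr -ler_pdivrMr//.
  have : (A + 1) / y <= n%:R by near: n; exact: nbhs_infty_ger.
  by move=> /le_trans; apply; rewrite ler_nat.
have tp : \forall n \near \oo, 0 < t n by exact: (cvgryPgt t).1 toy 0.
have tv : (t n)^-1 @[n --> \oo] --> (0 : R) by exact/(gtr0_cvgV0 tp)/toy.
have ch (z : R) : {for z, continuous (fun z : R => Q.[z])}.
  by apply: is_derive_continuous (is_derive_horner Q z).
have e1 : Q.[(t n)^-1] * expR (- (t n)^-1) @[n --> \oo] --> Q.[0] * expR (- 0).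
  apply: cvgM; first exact: (continuous_cvg _ (ch 0) tv).
  apply: (continuous_cvg _ (@continuous_expR R _)).
  exact: cvgN.
rewrite oppr0 expR0 mulr1 in e1; apply: cvg_trans e1; apply: near_eq_cvg.
by apply: filterS tp => n tn; rewrite /cutoff /expflat -/y -/(t n) tn.
Unshelve. all: by end_near. Qed.

Lemma cutP_cvg L al be x : Lam x -> cutP L al be n x @[n --> \oo] -->
  (cut_lim L).[x] * ((1 - x) `^ al * (1 + x) `^ be).
Proof.
move=> Lx; apply: cvgMl.
elim: L => [|PQ L IH].
  rewrite /cut_lim big_nil horner0; under eq_fun do rewrite big_nil.
  exact: cvg_cst.
rewrite /cut_lim big_cons hornerD hornerZ; under eq_fun do rewrite big_cons.
apply: cvgD; last exact: IH.
by rewrite mulrC; apply: cvgMr; exact: cutoff_cvg.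
Qed.

(** Terms where a cutoff was differentiated carry the factor X + X^2, which vanishes at 0; only
    derivatives of P times the weight survive. *)
Lemma cut_lim_iter al be m L :
  cut_lim (cut_iter al be m L) = jac_iter al be m (cut_lim L).
Proof.
elim: m => [//|m IH] /=; rewrite -IH.
rewrite /cut_lim /cut_next big_cat/= !big_map/= [X in _ + X]big1 ?addr0; last first.
  by move=> PQ _; rewrite hornerM hornerD hornerXn hornerX expr0n addr0 mul0r scale0r.
rewrite /jac_op linear_sum/= !mulr_suml -big_split/=.
by apply: eq_bigr => PQ _; rewrite derivZ scalerDr !scalerAl.
Qed.

(** The weak derivative is tested with the cut-off q w_m. Uniformly in n, the test function and its
    m-th derivative are dominated by multiples of the weights w_m and w_0, so both sides pass to the
    limit and no boundary term appears. *)
Lemma weighted_by_parts m b g H q : is_weak_derivative m g H ->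
  integL (fun x => g x * (1 + x) `^ b) ->
  integL (fun x => H x * ((1 - x) `^ m%:R * (1 + x) `^ (b + m%:R))) ->
  \int[mu]_(x in Lam) (H x * (q.[x] * ((1 - x) `^ m%:R * (1 + x) `^ (b + m%:R)))) =
  (-1) ^+ m * \int[mu]_(x in Lam)
    (g x * ((jac_iter m%:R (b + m%:R) m q).[x] * (1 + x) `^ b)).
Proof.
move=> [[mg _ _] [mH _ _] wg] ig iH.
pose phi n := cutP [:: (q, 1)] m%:R (b + m%:R) n.
have tphi n : test_function (phi n) by exact: test_cutP.
have l0 : cut_lim [:: (q, 1 : {poly R})] = q by rewrite /cut_lim big_seq1/= hornerC scale1r.
have [C0 C00 hC0] := cutP_bound [:: (q, 1)] m%:R (b + m%:R).
pose Lm := cut_iter m%:R (b + m%:R) m [:: (q, 1 : {poly R})].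
have [C1 C10 hC1] := cutP_bound Lm (m%:R - m%:R) (b + m%:R - m%:R).
have w1 x : (1 - x) `^ (m%:R - m%:R) * (1 + x) `^ (b + m%:R - m%:R) = (1 + x) `^ b :> R.
  by rewrite subrr powRr0 mul1r addrK.
have mq (p : {poly R}) : measurable_fun Lam (fun x : R => p.[x]).
  apply: continuousL_measurable => z.
  by apply: is_derive_continuous (is_derive_horner p z).
have [] := @DCTL R (fun n x => H x * phi n x)
  (fun x => H x * (q.[x] * ((1 - x) `^ m%:R * (1 + x) `^ (b + m%:R))))
  (fun x => C0 * `|H x * ((1 - x) `^ m%:R * (1 + x) `^ (b + m%:R))|).
- by move=> n; apply: measurable_funM => //; exact: test_measurableL.
- apply: measurable_funM; first exact: mH.
  apply: measurable_funM; first exact: mq.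
  by apply: measurable_funM; [exact: measurable_powRB|exact: measurable_powRD].
- apply: aeL_all => x Lx; apply: cvgMr.
  by have := @cutP_cvg [:: (q, 1 : {poly R})] m%:R (b + m%:R) x Lx; rewrite l0.
- exact: (integLZ _ (integL_norm iH)).
- move=> n x Lx; rewrite normrM [in leRHS]normrM mulrCA; apply: ler_wpM2l => //.
  rewrite (ger0_norm (mulr_ge0 (powR_ge0 _ _) (powR_ge0 _ _))).
  exact: hC0.
move=> _ c1.
have [] := @DCTL R (fun n x => g x * derive1n m (phi n) x)
  (fun x => g x * ((jac_iter m%:R (b + m%:R) m q).[x] * (1 + x) `^ b))
  (fun x => C1 * `|g x * (1 + x) `^ b|).
- by move=> n; apply: measurable_funM => //; exact: (test_measurableL (test_derive1n m (tphi n))).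
- apply: measurable_funM; first exact: mg.
  by apply: measurable_funM; [exact: mq|exact: measurable_powRD].
- apply: aeL_all => x Lx; apply: cvgMr.
  under eq_fun do rewrite (derive1n_cutP _ _ _ _ _ Lx).
  have := @cutP_cvg Lm (m%:R - m%:R) (b + m%:R - m%:R) x Lx.
  by rewrite w1 cut_lim_iter l0.
- exact: (integLZ _ (integL_norm ig)).
- move=> n x Lx; rewrite !normrM mulrCA; apply: ler_wpM2l => //.
  rewrite (ger0_norm (powR_ge0 _ _)) -(w1 x) derive1n_cutP//.
  exact: hC1.
move=> _ c2.
have e n : \int[mu]_(x in Lam) (H x * phi n x) =
    (-1) ^+ m * \int[mu]_(x in Lam) (g x * derive1n m (phi n) x).
  by have := wg _ (tphi n); rewrite /inner => ->; rewrite mulrA -expr2 sqrr_sign mul1r.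
have c3 : (-1) ^+ m * \int[mu]_(x in Lam) (g x * derive1n m (phi n) x) @[n --> \oo] -->
   (-1) ^+ m * \int[mu]_(x in Lam)
    (g x * ((jac_iter m%:R (b + m%:R) m q).[x] * (1 + x) `^ b)).
  exact: cvgMr.
by move: c1; under eq_fun do rewrite e; move=> c1; exact: (cvg_unique _ c1 c3).
Qed.

End ByParts.

(** * Sturm-Liouville bounds for polynomials *)

Section PolyForms.
Context {R : realType}.
Implicit Types (p q r t : {poly R}) (B : {poly R} -> {poly R} -> R).

(* The Cauchy-Schwarz inequality replaces definiteness. *)
Definition inner_form B :=
  [/\ forall p q, B p q = B q p,
      forall a p q r, B (a *: p + q) r = a * B p r + B q r,
      forall p, 0 <= B p p & forall p q, B p q ^+ 2 <= B p p * B q q].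

Lemma split_lead (E t : {poly R}) d : (size E <= d.+1)%N -> E`_d = 1 ->
  (size t <= d.+1)%N -> exists2 t' : {poly R}, (size t' <= d)%N & t = t`_d *: E + t'.
Proof.
move=> sE Ed st; exists (t - t`_d *: E); last by rewrite addrC subrK.
apply/leq_sizeP => j; rewrite leq_eqVlt => /orP[/eqP <-|dj].
  by rewrite coefB coefZ Ed mulr1 subrr.
rewrite coefB coefZ (nth_default 0 (leq_trans sE dj)).
by rewrite (nth_default 0 (leq_trans st dj)) mulr0 subrr.
Qed.

Lemma form0 B r : inner_form B -> B 0 r = 0.
Proof. by case=> _ lin _ _; have := lin (-1) 0 0 r; rewrite scaler0 addr0; lra. Qed.

Lemma form_orth_monic B d : inner_form B ->
  (forall p, exists2 r : {poly R}, (size r <= d)%N & forall t, (size t <= d)%N -> B (p - r) t = 0) ->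
  exists E : {poly R}, [/\ (size E <= d.+1)%N, E`_d = 1 & forall t, (size t <= d)%N -> B E t = 0].
Proof.
move=> iB /(_ 'X^d)[e0 se He]; exists ('X^d - e0); split => //.
  rewrite (leq_trans (size_polyD _ _))// geq_max size_polyXn leqnn size_polyN.
  exact: leq_trans se _.
by rewrite coefB coefXn eqxx nth_default// subr0.
Qed.

(** Gram-Schmidt: the projection onto one more degree adds the component along the monic polynomial
    [E] orthogonal to all lower degrees. *)
Lemma form_proj B : inner_form B -> forall d p,
  exists2 r : {poly R}, (size r <= d)%N & forall t, (size t <= d)%N -> B (p - r) t = 0.
Proof.
move=> iB; have [sym lin ge0 cs] := iB; elim=> [|d IH] p.
  exists 0; rewrite ?size_poly0// => t; rewrite size_poly_leq0 => /eqP ->.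
  by rewrite sym form0.
have [r0 s0 H0] := IH p; have [E [sE Ed HE]] := form_orth_monic iB IH.
pose c := B (p - r0) E / B E E; exists (r0 + c *: E).
  rewrite (leq_trans (size_polyD _ _))// geq_max (leq_trans s0)//=.
  exact: leq_trans (size_scale_leq _ _) sE.
move=> t /(split_lead sE Ed)[t' st' ->].
have -> : p - (r0 + c *: E) = (- c) *: E + (p - r0).
  by rewrite scaleNr opprD addrA addrC.
have z : B ((- c) *: E + (p - r0)) t' = 0 by rewrite lin HE// H0// mulr0 addr0.
rewrite sym lin (sym t') z addr0 (sym E) lin.
(* If B E E = 0, the coefficient c is 0 by the convention on division, and Cauchy-Schwarz makes the
   pairing with [E] vanish anyway. *)
have [E0|E0] := eqVneq (B E E) 0; last by rewrite /c; field.
have : B (p - r0) E ^+ 2 <= 0 by have := cs (p - r0) E; rewrite E0 mulr0.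
rewrite le_eqVlt ltNge sqr_ge0 orbF sqrf_eq0 => /eqP ->.
by rewrite E0; ring.
Qed.

(** [L] is symmetric and triangular for the degree, with diagonal entries [lam]. Splitting off the
    monic [E] orthogonal to lower degrees, L E pairs with [E] like lam d E, because the remainder
    has lower degree, and the cross terms vanish by symmetry. Each degree d >= n thus contributes at
    least lam n times its squared norm. *)
Lemma form_spectral B (L : {poly R} -> {poly R}) (lam : nat -> R) : inner_form B ->
  (forall a p q, L (a *: p + q) = a *: L p + L q) ->
  (forall p q, B (L p) q = B p (L q)) ->
  (forall d p, (size p <= d.+1)%N -> (size (L p - lam d *: p)%R <= d)%N) ->
  (forall i j, (i <= j)%N -> lam i <= lam j) ->
  forall n q, (forall t, (size t <= n)%N -> B q t = 0) ->
  lam n * B q q <= B (L q) q.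
Proof.
move=> iB lL sL tL mono n; have [sym lin ge0 cs] := iB.
have L0 : L 0 = 0.
  have := lL (-1) 0 0; rewrite scaler0 addr0 scaleN1r => h.
  by rewrite h addNr.
have szL d p : (size p <= d)%N -> (size (L p) <= d)%N.
  case: d => [|d sp]; first by rewrite size_poly_leq0 => /eqP ->; rewrite L0 size_poly0.
  rewrite -(subrK (lam d *: p) (L p)) (leq_trans (size_polyD _ _))// geq_max.
  by rewrite (leq_trans (tL _ _ sp))//= (leq_trans (size_scale_leq _ _)).
suff H d q : (size q <= d)%N -> (forall t, (size t <= n)%N -> B q t = 0) ->
  lam n * B q q <= B (L q) q by move=> q; apply: H (leqnn _).
elim: d q => [|d IH] q sq qt.
  by move: sq; rewrite size_poly_leq0 => /eqP ->; rewrite L0 !form0// mulr0.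
(* In this case [q] is itself among the polynomials it is orthogonal to, so B q q = 0, and B (L q) q
   = 0 by Cauchy-Schwarz. *)
have [dn|nd] := ltnP d n.
  rewrite qt ?(leq_trans sq)// mulr0; have := cs (L q) q.
  rewrite (qt q) ?(leq_trans sq)// mulr0 le_eqVlt ltNge sqr_ge0 orbF sqrf_eq0.
  by move=> /eqP ->.
have [E [sE Ed HE]] := form_orth_monic iB (form_proj iB d).
have [q' sq' qE] := split_lead sE Ed sq; set c := q`_d in qE.
have q't t : (size t <= n)%N -> B q' t = 0.
  move=> st; have := qt _ st; rewrite qE lin HE ?mulr0 ?add0r//.
  exact: leq_trans st nd.
have LEq : B (L E) q' = 0 by rewrite sL HE// szL.
have LqE : B (L q') E = 0 by rewrite sym HE// szL.
have Eq : B E q' = 0 by rewrite HE.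
have LEE : B (L E) E = lam d * B E E.
  rewrite -{1}(subrK (lam d *: E) (L E)) addrC lin.
  by rewrite (sym (L E - _) E) (HE _ (tL _ _ sE)) addr0.
have iq := IH _ sq' q't.
have exp x y : B (c *: x + y) (c *: E + q') =
    c * (c * B x E + B x q') + (c * B y E + B y q').
  by rewrite lin (sym x) (sym y) !lin (sym E x) (sym q' x) (sym E y) (sym q' y).
rewrite qE lL !exp LEE LEq LqE Eq (sym q' E) Eq.
have h1 : lam n * B E E <= lam d * B E E by apply: ler_wpM2r => //; exact: mono.
have h2 := ler_wpM2l (sqr_ge0 c) h1.
set x := B E E in h2 *; set y := B q' q' in iq *; set z := B (L q') q' in iq *.
by nra.
Qed.

Lemma coef_jac_op (al be : R) p i : (jac_op al be p)`_i.+1 =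
  i.+2%:R * p`_i.+2 + (be - al) * p`_i.+1 - (i%:R + al + be) * p`_i.
Proof.
have -> : jac_op al be p = p^`() - p^`() * 'X * 'X + (be - al) *: p - (al + be) *: (p * 'X).
  rewrite /jac_op -!mul_polyC expr2 polyCB polyCD; ring.
rewrite !coefB !coefD !coefN !coefZ !coefMX/= !coef_deriv.
case: i => [|i]/=.
  by rewrite -[p`_2 *+ _]mulr_natl; ring.
by rewrite -[p`_i.+3 *+ _]mulr_natl -[p`_i.+1 *+ _]mulr_natl -natr1; ring.
Qed.

Lemma jac_opD (al be a : R) p q :
  jac_op al be (a *: p + q) = a *: jac_op al be p + jac_op al be q.
Proof. by rewrite /jac_op derivD derivZ -!mul_polyC; ring. Qed.

Lemma size_jac_op (al be : R) d p : (size p <= d)%N -> (size (jac_op al be p) <= d.+1)%N.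
Proof.
move=> sp; apply/leq_sizeP => -[//|j] dj; rewrite coef_jac_op !nth_default ?mulr0 ?subrr ?addr0//.
- by rewrite subr0.
- by apply: leq_trans sp _; lia.
- by apply: leq_trans sp _; lia.
- by apply: leq_trans sp _; lia.
Qed.

(** Peels off the innermost application; [jac_step] produces its preimage exactly at that end. *)
Lemma jac_iterSr (al be : R) m p :
  jac_iter al be m.+1 p = jac_iter (al - 1) (be - 1) m (jac_op al be p).
Proof.
elim: m => [|m IH]; first by rewrite /= !subr0.
rewrite [LHS]/= -/(jac_iter al be m.+1 p) IH/=.
by congr jac_op; rewrite -natr1; ring.
Qed.

(** On x^d, [jac_op] gives the leading term -(d + al + be) x^(d+1); differentiating and changing the
    sign gives the diagonal entry (d + 1)(d + al + be) of the Jacobi operator. *)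
Lemma jac_eigen (al be : R) d p : (size p <= d.+1)%N ->
  (size (- (jac_op al be p)^`() - (d.+1%:R * (d%:R + al + be)) *: p)%R <= d)%N.
Proof.
move=> sp; apply/leq_sizeP => j dj; rewrite coefB coefN coefZ coef_deriv coef_jac_op.
have z i : (d < i)%N -> p`_i = 0 by move=> di; apply: nth_default; exact: leq_trans sp _.
rewrite (z j.+1) ?(z j.+2)//; last by lia.
move: dj; rewrite leq_eqVlt => /orP[/eqP <-|dj]; rewrite -mulr_natl; first by ring.
by rewrite (z j)//; ring.
Qed.

Lemma poly_antiderivative n t : (size t <= n)%N ->
  exists2 r : {poly R}, (size r <= n.+1)%N & r^`() = t.
Proof.
move=> st; exists (\poly_(i < n.+1) (t`_i.-1 / i%:R)); first exact: size_poly.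
apply/polyP => i; rewrite coef_deriv coef_poly ltnS/=.
have [ni|ni] := ltnP i n; first by rewrite -[LHS]mulr_natr divfK// pnatr_eq0.
by rewrite mul0rn nth_default// (leq_trans st).
Qed.

End PolyForms.

(** * Jacobi inner products on polynomials *)

Section JacobiForms.
Context {R : realType}.
Notation mu := (@lebesgue_measure R).
Notation Lam := (@Lambda R).
Implicit Types (f g h w G H : R -> R) (b al be : R) (p q r t : {poly R}).

Lemma IL_eq0 f : integL f -> (forall x, Lam x -> 0 <= f x) ->
  \int[mu]_(x in Lam) f x = 0 -> aeL (fun x => f x = 0).
Proof.
move=> intf f0 z.
have : (\int[mu]_(x in Lam) `|(f x)%:E| = 0)%E.
  have := EFin_IL intf; rewrite z => /esym; apply: etrans.
  by apply: eq_integral => x /[!inE] Lx; rewrite gee0_abs// lee_fin f0.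
have mf : measurable_fun Lam (fun x : R => (f x)%:E).
  by apply/measurable_EFinP; exact: (integL_meas intf).
move=> /(ae_eq_integral_abs _ measurable_LamR mf); rewrite /ae_eq /aeL.
by apply: (@filterS _ _ (ae_filter_ringOfSetsType mu)) => x h Lx; have [] := h Lx.
Qed.

Lemma weighted_CS2 f g w : measurable_fun Lam f -> measurable_fun Lam g ->
  measurable_fun Lam w -> (forall x, Lam x -> 0 <= w x) ->
  integL (fun x => f x ^+ 2 * w x) -> integL (fun x => g x ^+ 2 * w x) ->
  integL (fun x => f x * g x * w x) /\
  (\int[mu]_(x in Lam) (f x * g x * w x)) ^+ 2 <=
  (\int[mu]_(x in Lam) (f x ^+ 2 * w x)) * (\int[mu]_(x in Lam) (g x ^+ 2 * w x)).
Proof.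
move=> mf mg mw w0 i1 i2.
have ms : measurable_fun Lam (fun y => w y `^ 2^-1).
  by apply: (measurableT_comp (measurable_powR _)).
have sw y : Lam y -> w y `^ 2^-1 * w y `^ 2^-1 = w y.
  by move=> Ly; rewrite powR12_sqrt ?w0// -expr2 sqr_sqrtr ?w0.
have e h y : Lam y -> h y ^+ 2 * w y = (h y * w y `^ 2^-1) ^+ 2.
  by move=> Ly; rewrite exprMn [in RHS]expr2 [in RHS]expr2 sw// expr2.
have e3 y : Lam y -> f y * g y * w y = (f y * w y `^ 2^-1) * (g y * w y `^ 2^-1).
  by move=> Ly; rewrite -[in LHS]sw//; ring.
have [i h] := CauchySchwarzL (measurable_funM mf ms) (measurable_funM mg ms)
  (eq_integL (e f) i1) (eq_integL (e g) i2).
split; first by apply: eq_integL i => y Ly; rewrite e3.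
by rewrite (eq_IL e3) (eq_IL (e f)) (eq_IL (e g)).
Qed.

Lemma measurable_horner p : measurable_fun Lam (fun x : R => p.[x]).
Proof.
apply: continuousL_measurable => z.
by apply: is_derive_continuous (is_derive_horner p z).
Qed.

Lemma measurable_omega al be : measurable_fun Lam (omega al be).
Proof. by apply: measurable_funM; [exact: measurable_powRB|exact: measurable_powRD]. Qed.

Lemma omega_ge0 al be x : 0 <= omega al be x.
Proof. by rewrite /omega mulr_ge0 ?powR_ge0. Qed.

Lemma omega_gt0 al be x : Lam x -> 0 < omega al be x.
Proof. by move=> Lx; rewrite /omega mulr_gt0 ?powR_gt0 ?LamB0 ?LamD0. Qed.

Lemma integL_omega al be : 0 <= al -> -1 < be -> integL (omega al be).
Proof.
move=> al0 be1; apply: (integL_le (measurable_omega _ _) (integLZ (2 `^ al) (integL_powRD be1))).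
move=> x Lx; rewrite ger0_norm ?omega_ge0// /omega ler_wpM2r ?powR_ge0//.
by apply: powR2_le => //; have /andP[h ->] := LamB02 Lx; rewrite ltW.
Qed.

Lemma integL_poly_omega p al be : 0 <= al -> -1 < be ->
  integL (fun x => p.[x] * omega al be x).
Proof.
move=> al0 be1; have [C C0 HC] := horner_Lam_bound p.
have := integLMb (integL_omega al0 be1) (measurable_horner p) HC.
by apply: eq_integL => x _; rewrite mulrC.
Qed.

Definition jac_form al be p q : R :=
  \int[mu]_(x in Lam) (p.[x] * q.[x] * omega al be x).

Lemma jac_formM al be p q : jac_form al be p q =
  \int[mu]_(x in Lam) ((p * q).[x] * omega al be x).
Proof. by apply: eq_IL => x _; rewrite hornerM. Qed.

Lemma jac_inner_form al be : 0 <= al -> -1 < be -> inner_form (jac_form al be).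
Proof.
move=> al0 be1; have ip p := integL_poly_omega p al0 be1; split.
- by move=> p q; rewrite !jac_formM mulrC.
- move=> a p q r; rewrite !jac_formM -ILZl// -ILD//; last exact: integLZ.
  by apply: eq_IL => x _; rewrite mulrDl hornerD -scalerAl hornerZ; ring.
- move=> p; apply: IL_ge0 => x _; rewrite -expr2.
  exact: mulr_ge0 (sqr_ge0 _) (omega_ge0 _ _ _).
- move=> p q.
  have i2 r : integL (fun x => r.[x] ^+ 2 * omega al be x).
    by apply: eq_integL (ip (r ^+ 2)) => x _; rewrite horner_exp.
  have [_ h] := weighted_CS2 (measurable_horner p) (measurable_horner q)
    (measurable_omega al be) (fun x _ => omega_ge0 al be x) (i2 p) (i2 q).
  have e r : jac_form al be r r = \int[mu]_(x in Lam) (r.[x] ^+ 2 * omega al be x).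
    by apply: eq_IL => x _; rewrite expr2.
  by rewrite !e.
Qed.

(** The product p q (1 - x)^al (1 + x)^be vanishes at both ends because al and be are positive, and
    [jac_op] is by construction the derivative of [q] times the weight. *)
Lemma jac_by_parts al be p q : 1 <= al -> 0 < be ->
  jac_form al be p^`() q = - jac_form (al - 1) (be - 1) p (jac_op al be q).
Proof.
move=> al1 be0; have al0 : 0 < al by lra.
have i1 := integL_poly_omega (p^`() * q) (ltW al0) (lt_trans (ltrN10 _) be0).
have i2 : integL (fun x => (p * jac_op al be q).[x] * omega (al - 1) (be - 1) x).
  by apply: integL_poly_omega; lra.
apply/eqP; rewrite -addr_eq0 !jac_formM -(ILD i1 i2); apply/eqP.
pose F (x : R) := (p * q).[x] * omega al be x.
pose dF x := (p * q)^`().[x] * omega al be x +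
   (p * q).[x] * ((be * (1 - x) - al * (1 + x)) * omega (al - 1) (be - 1) x).
have e x : Lam x -> omega al be x = (1 - x) * (1 + x) * omega (al - 1) (be - 1) x.
  move=> Lx; rewrite /omega.
  have -> : (1 - x) `^ al = (1 - x) * (1 - x) `^ (al - 1) by rewrite -powRS ?LamB0// subrK.
  have -> : (1 + x) `^ be = (1 + x) * (1 + x) `^ (be - 1) by rewrite -powRS ?LamD0// subrK.
  by ring.
have dFE x : Lam x -> (p^`() * q).[x] * omega al be x +
    (p * jac_op al be q).[x] * omega (al - 1) (be - 1) x = dF x.
  move=> Lx; rewrite /dF (e _ Lx) derivM /jac_op.
  rewrite !(hornerD, hornerM, hornerN, hornerZ, hornerX, hornerXn, hornerC).
  by ring.
rewrite (eq_IL dFE).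
have idF : integL dF by apply: eq_integL dFE _; exact: integLD.
have ddF x : Lam x -> is_derive x 1 F (dF x).
  by move=> Lx; exact: (is_deriveMR (is_derive_horner _ _) (is_derive_jacw al be Lx)).
have dom al' be' x : Lam x -> {for x, continuous (omega al' be' : R -> R)}.
  by move=> Lx; exact: is_derive_continuous (is_derive_jacw al' be' Lx).
have cp (r : {poly R}) x : {for x, continuous (fun x : R => r.[x])}.
  exact: is_derive_continuous (is_derive_horner r x).
transitivity ((0 : R) - 0); last by rewrite subr0.
apply: (@FTC_open _ _ F) => //.
- move=> x /LamE Lx; apply: cvgD.
    by apply: cvgM; [exact: cp|exact: dom].
  apply: cvgM; first exact: cp.
  apply: cvgM; last exact: dom.
  by apply: cvgB; apply: cvgMr; [exact: (cvgB (cvg_cst _) cvg_id)|exact: (cvgD (cvg_cst _) cvg_id)].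
- rewrite -(mulr0 (p * q).[-1]); apply: cvgM; first exact/cvg_at_right_filter/cp.
  rewrite -(mulr0 ((1 - -1) `^ al)); apply: cvgM.
    by apply: cvg_at_right_filter; apply: powRB_continuous; lra.
  have := @powRD_cvg0 R be (-1) be0; apply: cvg_trans; apply: near_eq_cvg.
  by apply: nearW => x; rewrite opprK addrC.
- rewrite -(mulr0 (p * q).[1]); apply: cvgM; first exact/cvg_at_left_filter/cp.
  rewrite -(mul0r ((1 + 1) `^ be)); apply: cvgM; first exact: powRB_cvg0.
  apply: cvg_at_left_filter.
  have h : 0 < 1 + 1 :> R by lra.
  exact: is_derive_continuous (is_derive_powRD be h).
Qed.

(** [jac_op] raises the degree by exactly one, so its range misses only one dimension; and its range
    has zero mean, by parts against the constant 1. The zero-mean condition on [p] therefore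
    suffices. *)
Lemma jac_surj al be d p : 1 <= al -> 0 < be -> (size p <= d)%N ->
  jac_form (al - 1) (be - 1) p 1 = 0 -> exists q, p = jac_op al be q.
Proof.
move=> al1 be0; have al0 : 0 <= al - 1 by lra.
have be1 : -1 < be - 1 by lra.
have iB := jac_inner_form al0 be1; have [sym lin _ _] := iB.
have j0 : jac_op al be 0 = 0 by rewrite /jac_op deriv0 !mul0r addr0.
have orth q : jac_form (al - 1) (be - 1) (jac_op al be q) 1 = 0.
  have := jac_by_parts 1 q al1 be0; rewrite derivC.
  rewrite (form0 q (jac_inner_form (le_trans al0 _) _)); [|lra|lra].
  by rewrite sym => /esym/eqP; rewrite oppr_eq0 => /eqP.
elim: d p => [|d IH] p sp p1.
  by exists 0; rewrite j0; move: sp; rewrite size_poly_leq0 => /eqP.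
case: d IH sp => [|d] IH sp.
  exists 0; rewrite j0; move: p1; rewrite (size1_polyC sp); set c := p`_0 => h.
  have [->|c0] := eqVneq c 0; first by rewrite polyC0.
  have z : \int[mu]_(x in Lam) (omega (al - 1) (be - 1) x) = 0.
    have : c * \int[mu]_(x in Lam) (omega (al - 1) (be - 1) x) = 0.
      rewrite -(ILZl c (integL_omega al0 be1)) -[RHS]h.
      by apply: eq_IL => x _; rewrite !hornerC mulr1.
    by move/eqP; rewrite mulf_eq0 (negPf c0)/= => /eqP.
  have ae := IL_eq0 (integL_omega al0 be1) (fun x _ => omega_ge0 _ _ x) z.
  have [x [x01 hx]] : exists x, 0 < x < 1 /\ omega (al - 1) (be - 1) x = 0.
    by apply: (aeL_itv_ex ae); lra.
  have : 0 < omega (al - 1) (be - 1) x by apply: omega_gt0; apply/LamE; lra.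
  by rewrite hx ltxx.
pose a := d%:R + al + be; have a0 : a != 0 by rewrite gt_eqF// /a -addrA ltr_wpDl//; lra.
(* The image of X^d has leading coefficient - a, so subtracting c times it removes the top
   coefficient of [p]. *)
pose c := - (p`_d.+1 / a).
have [||q' hq'] := IH (p - c *: jac_op al be 'X^d).
- apply/leq_sizeP => j; rewrite leq_eqVlt => /orP[/eqP <-|dj].
    rewrite coefB coefZ coef_jac_op !coefXn eqxx !gtn_eqF// ?mulr0 ?add0r ?mulr1.
    by rewrite -/a /c; field.
  rewrite coefB coefZ (nth_default 0 (leq_trans sp dj)).
  have sj : (size (jac_op al be 'X^d) <= d.+2)%N by apply: size_jac_op; rewrite size_polyXn.
  by rewrite (nth_default 0 (leq_trans sj dj)) mulr0 subrr.
- by rewrite [p - _]addrC -scaleNr lin p1 addr0 orth mulr0.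
exists (c *: 'X^d + q'); rewrite jac_opD -hq' addrC subrK//.
Qed.

(** Orthogonality passes to [q] by writing [t] as a derivative and integrating by parts. The squared
    norm of jac_op q is the pairing of L q with [q] for L q = - (jac_op q)', so [form_spectral]
    gives the eigenvalue bound. *)
Lemma jac_step al be n p : 1 <= al -> 0 < be ->
  (forall t, (size t <= n.+1)%N -> jac_form (al - 1) (be - 1) p t = 0) ->
  exists q, [/\ p = jac_op al be q,
    forall t, (size t <= n)%N -> jac_form al be q t = 0 &
    n.+1%:R * (n%:R + al + be) * jac_form al be q q <= jac_form (al - 1) (be - 1) p p].
Proof.
move=> al1 be0 pt; have al0 : 0 <= al by lra.
have be1 : -1 < be by lra.
have [sym lin _ _] := jac_inner_form al0 be1.
have al0' : 0 <= al - 1 by lra.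
have be1' : -1 < be - 1 by lra.
have [sym' _ _ _] := jac_inner_form al0' be1'.
have [|q pq] := jac_surj al1 be0 (leqnn (size p)).
  by apply: pt; rewrite size_poly1.
have orth t : (size t <= n)%N -> jac_form al be q t = 0.
  move=> st; have [r sr <-] := poly_antiderivative st.
  by rewrite sym jac_by_parts// -pq sym' pt ?oppr0.
exists q; split => //.
pose L q := - (jac_op al be q)^`().
have LE q1 q2 : jac_form al be (L q1) q2 =
    jac_form (al - 1) (be - 1) (jac_op al be q1) (jac_op al be q2).
  have := lin (-1) (jac_op al be q1)^`() 0 q2.
  rewrite addr0 scaleN1r (form0 q2 (jac_inner_form al0 be1)) addr0 mulN1r /L => ->.
  by rewrite jac_by_parts// opprK.
rewrite pq -LE.
apply: (@form_spectral R _ L (fun n => n.+1%:R * (n%:R + al + be)) (jac_inner_form al0 be1)); last exact: orth.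
- by move=> a q1 q2; rewrite /L jac_opD derivD derivZ opprD scalerN.
- by move=> q1 q2; rewrite LE sym' -LE sym.
- by move=> d q1 sq; exact: jac_eigen.
- move=> i j ij; have ijR : i%:R <= j%:R :> R by rewrite ler_nat.
  have i0 : 0 <= i%:R :> R by [].
  by rewrite -!natr1; nra.
Qed.

Lemma jac_chain b m N p : -1 < b -> (m <= N)%N ->
  (forall t, (size t <= N.+1)%N -> jac_form 0 b p t = 0) ->
  forall i, (i <= m)%N -> exists q, [/\ jac_iter i%:R (b + i%:R) i q = p,
    forall t, (size t <= N.+1 - i)%N -> jac_form i%:R (b + i%:R) q t = 0 &
    ((N%:R / m%:R) ^+ i) ^+ 2 * jac_form i%:R (b + i%:R) q q <= jac_form 0 b p p].
Proof.
move=> b1 mN pt; elim=> [_|i IH im].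
  by exists p; rewrite subn0 expr0 expr1n mul1r addr0; split.
have [q [qp qt qq]] := IH (ltnW im).
have [|||q' [h1 h2 h3]] := @jac_step (i%:R + 1) (b + i%:R + 1) (N - i) q.
- by rewrite lerDr.
- have i0 : 0 <= i%:R :> R by [].
  by clear -i0 b1; lra.
- move=> t st; rewrite !addrK; apply: qt; rewrite (leq_trans st)//; lia.
rewrite !addrK in h3.
have ei : i.+1%:R = i%:R + 1 :> R by rewrite natr1.
exists q'; rewrite ei addrA; split.
- by rewrite jac_iterSr !addrK -h1.
- by move=> t st; apply: h2; rewrite (leq_trans st)//; lia.
apply: le_trans qq; rewrite [(_ / _) ^+ i.+1]exprSr exprMn -mulrA.
apply: ler_wpM2l; first exact: sqr_ge0.
apply: le_trans h3; apply: ler_wpM2r.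
  by apply: IL_ge0 => x _; rewrite -expr2; exact: mulr_ge0 (sqr_ge0 _) (omega_ge0 _ _ _).
have m0 : 0 < m%:R :> R by rewrite ltr0n; exact: leq_trans im.
(* From i < m <= N. The eigenvalue (N - i + 1)(N + i + 2 + b) has both factors at least N - i + 1,
   hence is at least (N / m)^2. *)
have hN : N%:R / m%:R <= (N - i).+1%:R :> R.
  by rewrite ler_pdivrMr// -natrM ler_nat; nia.
have hN0 : 0 <= N%:R / m%:R :> R by rewrite divr_ge0.
have i0 : 0 <= i%:R :> R by [].
have hN1 : (N - i).+1%:R = (N - i)%:R + 1 :> R by rewrite natr1.
rewrite hN1 in hN *; set x := N%:R / m%:R in hN hN0 *; set y := (N - i)%:R in hN *.
by nra.
Qed.

Lemma poly_dual_bound b m N g H p : -1 < b -> (m <= N)%N ->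
  is_weak_derivative m g H ->
  integL (fun x => g x ^+ 2 * (1 + x) `^ b) ->
  integL (fun x => H x ^+ 2 * omega m%:R (b + m%:R) x) ->
  (forall t, (size t <= N.+1)%N -> jac_form 0 b p t = 0) ->
  (\int[mu]_(x in Lam) (g x * (p.[x] * (1 + x) `^ b))) ^+ 2 <=
  (m%:R ^+ m * N%:R ^- m) ^+ 2 *
  \int[mu]_(x in Lam) (H x ^+ 2 * omega m%:R (b + m%:R) x) * jac_form 0 b p p.
Proof.
move=> b1 mN wgH ig iH pt; have [lg lH _] := wgH.
have mg : measurable_fun Lam g by case: lg.
have mH : measurable_fun Lam H by case: lH.
have [q [qp _ qq]] := jac_chain b1 mN pt (leqnn m).
have m0 : 0 <= m%:R :> R by [].
have bm : -1 < b + m%:R by clear -b1 m0; lra.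
have i1 : integL (fun x => g x * (1 + x) `^ b).
  by apply: eq_integL (weighted_integL b1 mg ig) => x _; rewrite mulrC.
have ione al be : 0 <= al -> -1 < be -> integL (fun x : R => 1 ^+ 2 * omega al be x).
  by move=> h1 h2; apply: eq_integL (integL_omega h1 h2) => x _; rewrite expr1n mul1r.
have [i2 _] := weighted_CS2 mH (measurable_cst (1 : R)) (measurable_omega m%:R (b + m%:R))
  (fun x _ => omega_ge0 _ _ x) iH (ione _ _ m0 bm).
have i2' : integL (fun x => H x * ((1 - x) `^ m%:R * (1 + x) `^ (b + m%:R))).
  by apply: eq_integL i2 => x _; rewrite mulr1.
have hbp := weighted_by_parts q wgH i1 i2'; rewrite qp in hbp.
have -> : (\int[mu]_(x in Lam) (g x * (p.[x] * (1 + x) `^ b))) ^+ 2 =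
   (\int[mu]_(x in Lam) (H x * (q.[x] * ((1 - x) `^ m%:R * (1 + x) `^ (b + m%:R))))) ^+ 2.
  by rewrite hbp exprMn sqrr_sign mul1r.
have iq : integL (fun x => q.[x] ^+ 2 * omega m%:R (b + m%:R) x).
  by apply: eq_integL (integL_poly_omega (q ^+ 2) m0 bm) => x _; rewrite horner_exp.
have [_ cs] := weighted_CS2 mH (measurable_horner q) (measurable_omega m%:R (b + m%:R))
  (fun x _ => omega_ge0 _ _ x) iH iq.
rewrite (@eq_IL _ _ (fun x => H x * q.[x] * omega m%:R (b + m%:R) x)); last first.
  by move=> x _; rewrite /omega; ring.
apply: (le_trans cs).
have -> : \int[mu]_(x in Lam) (q.[x] ^+ 2 * omega m%:R (b + m%:R) x) =
    jac_form m%:R (b + m%:R) q q by apply: eq_IL => x _; rewrite expr2.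
rewrite mulrAC; rewrite [leRHS]mulrC; apply: ler_wpM2l.
  by apply: IL_ge0 => x _; exact: mulr_ge0 (sqr_ge0 _) (omega_ge0 _ _ _).
set Q := jac_form _ _ q q in qq *; set P := jac_form _ _ p p in qq *.
(* If N or m is 0 then m = 0, and both factors are 1 by the convention on the zeroth power;
   otherwise N / m can be inverted. *)
have [N0|N0] := posnP N.
  have e0 : m = 0%N by apply/eqP; rewrite -leqn0 -N0.
  by move: qq; rewrite e0 !expr0 !expr1n invr1 !mul1r expr1n mul1r.
case: (posnP m) => [e0|mp].
  by move: qq; rewrite e0 !expr0 !expr1n invr1 !mul1r expr1n mul1r.
have nz (n : nat) : (0 < n)%N -> n%:R != 0 :> R by move=> n0; rewrite pnatr_eq0 -lt0n.
have -> : Q = (m%:R ^+ m * N%:R ^- m) ^+ 2 * (((N%:R / m%:R) ^+ m) ^+ 2 * Q).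
  rewrite mulrA -exprMn expr_div_n; set x := m%:R ^+ m; set y := N%:R ^+ m.
  have x0 : x != 0 by rewrite expf_neq0// nz.
  have y0 : y != 0 by rewrite expf_neq0// nz.
  by field; rewrite x0 y0.
by apply: ler_wpM2l; first exact: sqr_ge0.
Qed.

End JacobiForms.

(** * Density of polynomials in the weighted L^2 space *)

Import HBNNSimple.

Section Density.
Context {R : realType}.
Notation mu := (@lebesgue_measure R).
Notation Lam := (@Lambda R).
Implicit Types (f g h r : R -> R) (b : R) (p q : {poly R}).

Definition poly_closed b f := [/\ measurable_fun Lam f,
  integL (fun x => f x ^+ 2 * omega 0 b x) &
  forall e, 0 < e -> exists p : {poly R},
    \int[mu]_(x in Lam) ((f x - p.[x]) ^+ 2 * omega 0 b x) <= e].

Lemma sqD_bound b f g : measurable_fun Lam f -> measurable_fun Lam g ->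
  integL (fun x => f x ^+ 2 * omega 0 b x) ->
  integL (fun x => g x ^+ 2 * omega 0 b x) ->
  integL (fun x => (f x + g x) ^+ 2 * omega 0 b x) /\
  \int[mu]_(x in Lam) ((f x + g x) ^+ 2 * omega 0 b x) <=
  2 * \int[mu]_(x in Lam) (f x ^+ 2 * omega 0 b x) +
  2 * \int[mu]_(x in Lam) (g x ^+ 2 * omega 0 b x).
Proof.
move=> mf mg i1 i2; have i3 := integLD (integLZ 2 i1) (integLZ 2 i2).
have le x : (f x + g x) ^+ 2 * omega 0 b x <=
    2 * (f x ^+ 2 * omega 0 b x) + 2 * (g x ^+ 2 * omega 0 b x).
  have := omega_ge0 0 b x; set w := omega 0 b x => w0.
  have -> : 2 * (f x ^+ 2 * w) + 2 * (g x ^+ 2 * w) = (2 * f x ^+ 2 + 2 * g x ^+ 2) * w by ring.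
  by apply: ler_wpM2r => //; have := sqr_ge0 (f x - g x); nra.
have i : integL (fun x => (f x + g x) ^+ 2 * omega 0 b x).
  apply: (integL_le _ i3).
    apply: measurable_funM; last exact: measurable_omega.
    by apply: measurable_funX; exact: measurable_funD.
  by move=> x Lx; rewrite ger0_norm//; exact: mulr_ge0 (sqr_ge0 _) (omega_ge0 _ _ _).
split => //; apply: (le_trans (IL_le i i3 (fun x _ => le x))).
by rewrite ILD ?ILZl//; exact: integLZ.
Qed.

Lemma integL_sq_poly b p : -1 < b -> integL (fun x => p.[x] ^+ 2 * omega 0 b x).
Proof.
move=> b1; apply: eq_integL (integL_poly_omega (p ^+ 2) (lexx 0) b1) => x _.
by rewrite horner_exp.
Qed.

Lemma integL_sqB_poly b f p : -1 < b -> measurable_fun Lam f ->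
  integL (fun x => f x ^+ 2 * omega 0 b x) ->
  integL (fun x => (f x - p.[x]) ^+ 2 * omega 0 b x).
Proof.
move=> b1 mf i1; have [i _] := sqD_bound mf (measurable_horner (- p)) i1 (integL_sq_poly (- p) b1).
by apply: eq_integL i => x _; rewrite hornerN.
Qed.

Lemma poly_closed_eq b f g : (forall x, Lam x -> f x = g x) ->
  poly_closed b f -> poly_closed b g.
Proof.
move=> fg [mf i1 H]; split.
- by apply: eq_measurable_fun mf => x /[!inE]; exact: fg.
- by apply: eq_integL i1 => x Lx; rewrite fg.
- move=> e e0; have [p hp] := H e e0; exists p.
  by rewrite -(@eq_IL _ (fun x => (f x - p.[x]) ^+ 2 * omega 0 b x))// => x Lx; rewrite fg.
Qed.

Lemma poly_closed_poly b p : -1 < b -> poly_closed b (horner p).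
Proof.
move=> b1; split; [exact: measurable_horner|exact: integL_sq_poly|].
move=> e e0; exists p; rewrite (@eq_IL _ _ (fun=> 0)) => [|x _].
  by rewrite (@Rintegral_cst _ _ _ mu _ measurable_LamR) mul0r ltW.
by rewrite subrr expr0n mul0r.
Qed.

Lemma poly_closed_lin b a f g : -1 < b -> poly_closed b f -> poly_closed b g ->
  poly_closed b (fun x => a * f x + g x).
Proof.
move=> b1 [mf i1 H1] [mg i2 H2].
have maf (f' : R -> R) : measurable_fun Lam f' -> measurable_fun Lam (fun x => a * f' x).
  by move=> ?; exact: measurable_funM.
have iaf (f' : R -> R) : integL (fun x => f' x ^+ 2 * omega 0 b x) ->
    integL (fun x => (a * f' x) ^+ 2 * omega 0 b x).
  by move=> i; apply: eq_integL (integLZ (a ^+ 2) i) => x _; ring.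
have [i3 _] := sqD_bound (maf _ mf) mg (iaf _ i1) i2.
split => //; first by apply: measurable_funD => //; exact: maf.
move=> e e0; pose d := e / (2 * a ^+ 2 + 2).
have dd : 0 < 2 * a ^+ 2 + 2 by have := sqr_ge0 a; lra.
have [p hp] := H1 d (divr_gt0 e0 dd); have [q hq] := H2 d (divr_gt0 e0 dd).
exists (a *: p + q).
have mfp : measurable_fun Lam (fun x => f x - p.[x]).
  by apply: measurable_funB => //; exact: measurable_horner.
have mgq : measurable_fun Lam (fun x => g x - q.[x]).
  by apply: measurable_funB => //; exact: measurable_horner.
have j1 := integL_sqB_poly p b1 mf i1; have j2 := integL_sqB_poly q b1 mg i2.
have [_ h] := sqD_bound (maf _ mfp) mgq (iaf _ j1) j2.
rewrite (@eq_IL _ _ (fun x => (a * (f x - p.[x]) + (g x - q.[x])) ^+ 2 * omega 0 b x)).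
  apply: (le_trans h).
  rewrite (@eq_IL _ (fun x => (a * (f x - p.[x])) ^+ 2 * omega 0 b x)
    (fun x => a ^+ 2 * ((f x - p.[x]) ^+ 2 * omega 0 b x))); last by move=> x _; ring.
  rewrite ILZl//.
  have -> : e = 2 * (a ^+ 2 * d) + 2 * d by rewrite /d; field; rewrite gt_eqF.
  apply: lerD; apply: ler_wpM2l => //.
  by apply: ler_wpM2l; first exact: sqr_ge0.
by move=> x _; rewrite hornerD hornerZ; congr (_ ^+ 2 * _); ring.
Qed.

(** Dominated convergence with majorant 4 h^2 for (f - f_n)^2, followed by the approximation of one
    f_n. *)
Lemma poly_closed_lim b (f_ : nat -> R -> R) f h : -1 < b ->
  (forall n, poly_closed b (f_ n)) -> measurable_fun Lam f ->
  aeL (fun x => f_ n x @[n --> \oo] --> f x) ->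
  integL (fun x => h x ^+ 2 * omega 0 b x) ->
  (forall n x, Lam x -> `|f_ n x| <= h x) -> (forall x, Lam x -> `|f x| <= h x) ->
  poly_closed b f.
Proof.
move=> b1 Hf mf cf ih fh fh'.
have mf_ n : measurable_fun Lam (f_ n) by have [] := Hf n.
have i_ n : integL (fun x => f_ n x ^+ 2 * omega 0 b x) by have [] := Hf n.
have msq (u : R -> R) : measurable_fun Lam u -> measurable_fun Lam (fun x => u x ^+ 2 * omega 0 b x).
  move=> mu'; apply: measurable_funM; last exact: measurable_omega.
  exact: measurable_funX.
have sqle (u v : R) x : `|u| <= v -> u ^+ 2 * omega 0 b x <= v ^+ 2 * omega 0 b x.
  move=> uv; apply: ler_wpM2r; first exact: omega_ge0.
  rewrite -[u ^+ 2]real_normK ?num_real// ler_sqr ?nnegrE//.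
  exact: le_trans uv.
have i1 : integL (fun x => f x ^+ 2 * omega 0 b x).
  apply: (integL_le (msq _ mf) ih) => x Lx.
  rewrite ger0_norm; last exact: mulr_ge0 (sqr_ge0 _) (omega_ge0 _ _ _).
  exact: sqle (fh' x Lx).
split => // e e0.
have mB n : measurable_fun Lam (fun x => f x - f_ n x) by exact: measurable_funB.
have [] := @DCTL R (fun n x => (f x - f_ n x) ^+ 2 * omega 0 b x) (fun=> 0)
  (fun x => 4 * (h x ^+ 2 * omega 0 b x)).
- by move=> n; exact: msq.
- exact: measurable_cst.
- apply: aeL_imp cf => x Lx cx.
  rewrite -[X in _ --> X](mul0r (omega 0 b x)); apply: cvgMl.
  have -> : 0 = (f x - f x) ^+ 2 by rewrite subrr expr0n.
  by rewrite expr2; apply: cvgM; apply: cvgB => //; exact: cvg_cst.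
- exact: integLZ.
- move=> n x Lx; rewrite ger0_norm; last exact: mulr_ge0 (sqr_ge0 _) (omega_ge0 _ _ _).
  have -> : 4 * (h x ^+ 2 * omega 0 b x) = (2 * h x) ^+ 2 * omega 0 b x by ring.
  apply: sqle; apply: (le_trans (ler_normB _ _)).
  by have := fh n x Lx; have := fh' x Lx; lra.
move=> _; rewrite (@Rintegral_cst _ _ _ mu _ measurable_LamR) mul0r => c0.
have e4 : 0 < e / 4 by lra.
have [n hn] : exists n, \int[mu]_(x in Lam) ((f x - f_ n x) ^+ 2 * omega 0 b x) <= e / 4.
  have /cvgrPdist_le/(_ _ e4)[n _ /(_ n (leqnn n))] := c0.
  rewrite /= sub0r normrN => hn; exists n; exact: le_trans (ler_norm _) hn.
have [_ _ Hn] := Hf n; have [p hp] := Hn _ e4; exists p.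
have j2 := integL_sqB_poly p b1 (mf_ n) (i_ n).
have j1 : integL (fun x => (f x - f_ n x) ^+ 2 * omega 0 b x).
  have iN : integL (fun x => (- f_ n x) ^+ 2 * omega 0 b x).
    by apply: eq_integL (i_ n) => x _; rewrite sqrrN.
  have mN : measurable_fun Lam (fun x => - f_ n x) by exact: measurableT_comp (mf_ n).
  by have [] := sqD_bound mf mN i1 iN.
have mnp : measurable_fun Lam (fun x => f_ n x - p.[x]).
  by apply: measurable_funB => //; exact: measurable_horner.
have [_ hh] := sqD_bound (mB n) mnp j1 j2.
rewrite (@eq_IL _ _ (fun x => (f x - f_ n x + (f_ n x - p.[x])) ^+ 2 * omega 0 b x)).
  by apply: (le_trans hh); lra.
by move=> x _; rewrite addrA subrK.
Qed.

Lemma poly_closed_sum b (I : Type) (s : seq I) (F : I -> R -> R) : -1 < b ->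
  (forall i, poly_closed b (F i)) -> poly_closed b (fun x => \sum_(i <- s) F i x).
Proof.
move=> b1 H; elim: s => [|i s IH].
  by apply: (poly_closed_eq _ (poly_closed_poly 0 b1)) => x _; rewrite big_nil horner0.
apply: (poly_closed_eq _ (poly_closed_lin 1 b1 (H i) IH)) => x _.
by rewrite big_cons mul1r.
Qed.

Lemma integL_sq_cst b c : -1 < b -> integL (fun x => c ^+ 2 * omega 0 b x).
Proof.
by move=> b1; apply: eq_integL (integL_sq_poly c%:P b1) => x _; rewrite hornerC.
Qed.

Lemma bernoulli_le (a : R) n : 0 <= a <= 1 -> 1 - n%:R * a <= (1 - a) ^+ n.
Proof.
move=> /andP[a0 a1]; elim: n => [|n IH]; first by rewrite mul0r subr0 expr0.
have n0 : 0 <= n%:R :> R by [].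
rewrite exprS -natr1; apply: (@le_trans _ _ ((1 - a) * (1 - n%:R * a))); last first.
  by apply: ler_wpM2l => //; lra.
have : 0 <= n%:R * (a * a) by rewrite mulr_ge0// mulr_ge0.
lra.
Qed.

(** Polynomials in t approximating the step at 1/2, as in the elementary proof of the
    Stone-Weierstrass theorem. Bernoulli's inequality gives the lower bound 1 - (2 t)^n for t < 1/2;
    for t > 1/2, with a = t^n and k = 2^n, (1 - a)^k <= 1 / (1 + a)^k <= 1 / (k a) = (2 t)^(-n). *)
Lemma pow_step_cvg (t : R) : 0 <= t <= 1 -> t != 2^-1 ->
  (1 - t ^+ n) ^+ (2 ^ n) @[n --> \oo] --> ((t < 2^-1)%R%:R : R).
Proof.
move=> /andP[t0 t1] th.
have tn n : 0 <= t ^+ n <= 1 by rewrite exprn_ge0//= exprn_ile1.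
have tk n k : 0 <= (1 - t ^+ n) ^+ k <= 1.
  have /andP[? ?] := tn n; apply/andP; split; first by apply: exprn_ge0; lra.
  by apply: exprn_ile1; lra.
have e n : (2 ^ n)%:R * t ^+ n = (2 * t) ^+ n :> R by rewrite natrX exprMn.
have [lt|ge] := ltP t 2^-1.
  rewrite [X in _ --> X](_ : _ = 1 - 0); last by rewrite subr0.
  apply: (@squeeze_cvgr _ _ _ _ (fun n => 1 - (2 * t) ^+ n) (cst 1)).
  - by near=> n; rewrite -e bernoulli_le//=; have /andP[] := tk n (2 ^ n)%N.
  - apply: cvgB; first exact: cvg_cst.
    by apply: cvg_expr; rewrite ger0_norm; lra.
  - by rewrite subr0; exact: cvg_cst.
have gt : 2^-1 < t by rewrite lt_neqAle eq_sym th.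
apply: (@squeeze_cvgr _ _ _ _ (cst 0) (fun n => (2 * t)^-1 ^+ n)).
- near=> n; have /andP[-> _] := tk n (2 ^ n)%N; rewrite /= exprVn -e.
  have p0 : 0 < (2 ^ n)%:R * t ^+ n by rewrite e exprn_gt0//; lra.
  set a := t ^+ n in p0 *; set k := (2 ^ n)%N in p0 *.
  have /andP[a0 a1] : 0 <= a <= 1 := tn n.
  rewrite -[leRHS]mul1r ler_pdivlMr//.
  have h : 1 + k%:R * a <= (1 + a) ^+ k.
    elim: (k) => [|j IH]; first by rewrite mul0r addr0 expr0.
    have j0 : 0 <= j%:R * (a * a) by rewrite !mulr_ge0.
    rewrite exprS -natr1; apply: (@le_trans _ _ ((1 + a) * (1 + j%:R * a))); first lra.
    by apply: ler_wpM2l => //; lra.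
  have q0 : 0 <= (1 - a) ^+ k by apply: exprn_ge0; lra.
  apply: (@le_trans _ _ ((1 - a) ^+ k * (1 + a) ^+ k)).
    by apply: ler_wpM2l => //; lra.
  rewrite -exprMn; apply: exprn_ile1; first by apply: mulr_ge0; lra.
  by nra.
- exact: cvg_cst.
- apply: cvg_expr; rewrite ger0_norm; last by rewrite invr_ge0; lra.
  by rewrite invf_lt1; lra.
Unshelve. all: by end_near. Qed.

Lemma poly_closed_ray b (c : R) : -1 < b -> poly_closed b \1_(`]c, +oo[ : set R).
Proof.
move=> b1.
have E x : (\1_(`]c, +oo[ : set R) x : R) = (c < x)%R%:R.
  rewrite indicE; have -> // : (x \in `]c, +oo[%classic) = (c < x).
  by apply/idP/idP; rewrite inE/= in_itv/= andbT.
have [c1|c1] := ltP c (-1).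
  apply: (poly_closed_eq _ (poly_closed_poly 1 b1)) => x /LamE/andP[x1 _].
  by rewrite E hornerC (lt_trans c1 x1).
have [c2|c2] := ltP 1 c.
  apply: (poly_closed_eq _ (poly_closed_poly 0 b1)) => x /LamE/andP[_ x1].
  by rewrite E horner0 ltNge ltW// (lt_trans x1 c2).
(* A decreasing affine map sending c to 1/2 and, as c lies in [-1, 1], Lambda into [0, 1]. *)
pose t x := 2^-1 - (x - c) / 4.
pose P n : {poly R} := (1 - ((2^-1 + c / 4)%:P - 4^-1 *: 'X) ^+ n) ^+ (2 ^ n).
have PE n x : (P n).[x] = (1 - t x ^+ n) ^+ (2 ^ n).
  rewrite /P horner_exp hornerD hornerN horner_exp hornerD hornerN hornerZ !hornerC hornerX.
  by rewrite /t; congr ((1 - _ ^+ _) ^+ _); field.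
have t01 x : Lam x -> 0 <= t x <= 1.
  by move=> /LamE/andP[? ?]; rewrite /t; apply/andP; split; lra.
apply: (@poly_closed_lim b (fun n x => (P n).[x]) _ (fun=> 1)) => //.
- by move=> n; exact: poly_closed_poly.
- apply: aeL_imp (aeL_neq c) => x Lx xc; rewrite E; under eq_fun do rewrite PE.
  have -> : (c < x) = (t x < 2^-1) by rewrite /t; apply/idP/idP; lra.
  apply: pow_step_cvg; first exact: t01.
  apply: contra xc => /eqP h; apply/eqP; move: h; rewrite /t; lra.
- exact: integL_sq_cst.
- move=> n x Lx; rewrite PE; have /andP[? ?] := t01 x Lx.
  have /andP[? ?] : 0 <= t x ^+ n <= 1 by rewrite exprn_ge0//= exprn_ile1.
  by rewrite ger0_norm ?exprn_ge0 ?exprn_ile1//; lra.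
- by move=> x _; rewrite E; case: (c < x); rewrite ?normr1 ?normr0.
Qed.

(** Dynkin's theorem: open rays are stable under intersection and generate the Borel sets, and the
    class is closed under complements and countable disjoint unions, whose partial sums are
    dominated by 1. *)
Lemma poly_closed_indic b (A : set R) : -1 < b -> measurable A -> poly_closed b \1_A.
Proof.
move=> b1 mA.
have : (@ocitv R).-sigma.-measurable A := mA.
rewrite RGenOInfty.measurableE; move: A {mA}.
apply: (@dynkin_induction _ (measurableTypeR R) (@RGenOInfty.G R) (fun A => poly_closed b \1_A)).
- exact: RGenOInfty.measurableE.
- move=> _ _ [x ->] [y ->]; exists (Order.max x y).
  apply/seteqP; split => z; rewrite /= !in_itv/= !andbT gt_max.
    by move=> [-> ->].
  by move=> /andP[].
- by apply: (poly_closed_eq _ (poly_closed_poly 1 b1)) => x _; rewrite hornerC indicT.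
- by move=> _ [x ->]; exact: poly_closed_ray.
- move=> S mS HS.
  apply: (poly_closed_eq _ (poly_closed_lin (-1) b1 HS (poly_closed_poly 1 b1))) => x _.
  rewrite hornerC !indicE in_setC; case: (x \in S) => /=; ring.
- move=> F mF tF HF.
  have S0 n x : (forall k, ~ F k x) -> \sum_(0 <= k < n) (\1_(F k) x : R) = 0.
    by move=> nF; apply: big1 => k _; rewrite indicE memNset.
  have S1 n x j : F j x -> \sum_(0 <= k < n) (\1_(F k) x : R) = (j < n)%:R.
    move=> Fj; have one k : (\1_(F k) x : R) = (k == j)%:R.
      rewrite indicE; have [->|kj] := eqVneq k j; first by rewrite mem_set.
      rewrite memNset// => Fk; move/eqP: kj; apply; apply: (tF k j) => //.
      by exists x.
    elim: n => [|n IH]; first by rewrite big_nil.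
    rewrite big_nat_recr//= IH one ltnS; case: ltngtP => _; rewrite ?addr0 ?add0r//.
  apply: (@poly_closed_lim b (fun n x => \sum_(0 <= k < n) \1_(F k) x) _ (fun=> 1)) => //.
  + by move=> n; apply: poly_closed_sum.
  + by apply: measurable_indic; apply: bigcup_measurable => k _; exact: mF.
  + apply: aeL_all => x _; have [[j _ Fj]|nF] := pselect ((\bigcup_k F k) x).
      rewrite indicE mem_set; last by exists j.
      apply: cvg_near_cst; near=> n; rewrite (S1 _ _ _ Fj) (_ : (j < n)%N)//.
      by near: n; exact: nbhs_infty_gt.
    rewrite indicE memNset//; apply: cvg_near_cst; apply: nearW => n.
    by rewrite S0// => k Fk; apply: nF; exists k.
  + exact: integL_sq_cst.
  + move=> n x _; have [[j _ Fj]|nF] := pselect ((\bigcup_k F k) x).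
      by rewrite (S1 _ _ _ Fj); case: (j < n)%N; rewrite ?normr1 ?normr0.
    by rewrite S0 ?normr0// => k Fk; apply: nF; exists k.
  + by move=> x _; rewrite indicE; case: (x \in _); rewrite ?normr1 ?normr0.
Unshelve. all: by end_near. Qed.

(** Simple functions increasing to [f] are finite combinations of indicators, and [f] itself
    dominates them. *)
Lemma poly_closed_pos b f : -1 < b -> measurable_fun setT f -> (forall x, 0 <= f x) ->
  integL (fun x => f x ^+ 2 * omega 0 b x) -> poly_closed b f.
Proof.
move=> b1 mf f0 i1.
have mfE : measurable_fun (setT : set (measurableTypeR R)) (EFin \o f).
  by apply/measurable_EFinP.
pose hb n := nnsfun_approx measurableT mfE n; pose h n : R -> R := hb n.
have hc x : h n x @[n --> \oo] --> f x.
  have := @cvg_nnsfun_approx _ _ R setT measurableT _ mfE (fun x _ => f0 x) x I.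
  by move/fine_cvg.
have hle n x : h n x <= f x.
  have nd : nondecreasing_seq (fun n => h n x).
    by move=> i j ij; have /lefP := nd_nnsfun_approx measurableT mfE ij; apply.
  have := nondecreasing_cvgn_le nd (cvgP _ (hc x)) n.
  by rewrite (cvg_lim _ (hc x)).
apply: (@poly_closed_lim b h _ f) => //.
- move=> n; apply: (@poly_closed_eq b _ (h n) (fun x _ => esym (fimfunEord (hb n) x))).
  apply: poly_closed_sum => // i; set y := _`_i.
  have mA : measurable (h n @^-1` [set y]) by exact: (measurable_funPTI (hb n) (measurable_set1 y)).
  apply: (poly_closed_eq _ (poly_closed_lin y b1 (poly_closed_indic b1 mA) (poly_closed_poly 0 b1))).
  by move=> x _; rewrite horner0 addr0.
- exact: measurable_funTS.
- by apply: aeL_all => x _; exact: hc.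
- by move=> n x _; rewrite ger0_norm// hle.
- by move=> x _; rewrite ger0_norm.
Qed.

Lemma poly_closedP b f : -1 < b -> measurable_fun Lam f ->
  integL (fun x => f x ^+ 2 * omega 0 b x) -> poly_closed b f.
Proof.
move=> b1 mf i1; have mF := measurable_restrL mf.
have H (g : R -> R) : measurable_fun setT g -> (forall x, 0 <= g x) ->
    (forall x, Lam x -> g x <= `|f x|) -> poly_closed b g.
  move=> mg g0 gf; apply: poly_closed_pos => //.
  apply: (integL_le _ i1).
    apply: measurable_funM; last exact: measurable_omega.
    by apply: measurable_funX; exact: measurable_funTS.
  move=> x Lx; rewrite ger0_norm; last exact: mulr_ge0 (sqr_ge0 _) (omega_ge0 _ _ _).
  apply: ler_wpM2r; first exact: omega_ge0.
  by rewrite -[f x ^+ 2]real_normK ?num_real// ler_sqr ?nnegrE// gf.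
pose fp x := Order.max ((f \_ Lam) x) 0; pose fm x := Order.max (- (f \_ Lam) x) 0.
have Hp : poly_closed b fp.
  apply: H; first exact: measurable_maxr.
    by move=> x; rewrite /fp le_max lexx orbT.
  by move=> x Lx; rewrite /fp restrLE// ge_max ler_norm normr_ge0.
have Hm : poly_closed b fm.
  apply: H; first by apply: measurable_maxr => //; exact: measurableT_comp.
    by move=> x; rewrite /fm le_max lexx orbT.
  by move=> x Lx; rewrite /fm restrLE// ge_max -normrN ler_norm normr_ge0.
apply: (poly_closed_eq _ (poly_closed_lin (-1) b1 Hm Hp)) => x Lx.
by rewrite /fp /fm restrLE// /Order.max; case: ltP => h1; case: ltP => h2; lra.
Qed.

(* With [X = |r|^2], [Y = <r, p>] and [|r - p|^2 <= e], the hypothesis on [p] reads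
   [(Y - C)^2 <= C (e - (X - C))], which is absurd for [e < X - C]. *)
Lemma poly_dual_norm b r C : -1 < b -> measurable_fun Lam r ->
  integL (fun x => r x ^+ 2 * omega 0 b x) -> 0 <= C ->
  (forall p, (\int[mu]_(x in Lam) (r x * (p.[x] * (1 + x) `^ b))) ^+ 2 <=
     C * jac_form 0 b p p) ->
  \int[mu]_(x in Lam) (r x ^+ 2 * omega 0 b x) <= C.
Proof.
move=> b1 mr i1 C0 H; rewrite leNgt; apply/negP.
set X := \int[mu]_(x in Lam) (r x ^+ 2 * omega 0 b x) => CX.
have [_ _ cl] := poly_closedP b1 mr i1.
have e0 : 0 < (X - C) / 2 by lra.
have [p hp] := cl _ e0; have := H p.
have ip := integL_sq_poly p b1.
have [irp _] := weighted_CS2 mr (measurable_horner p) (measurable_omega 0 b)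
  (fun x _ => omega_ge0 0 b x) i1 ip.
set Y := \int[mu]_(x in Lam) _; set Z := jac_form 0 b p p => YZ.
have ZE : Z = \int[mu]_(x in Lam) (p.[x] ^+ 2 * omega 0 b x).
  by apply: eq_IL => x _; rewrite expr2.
have Z0 : 0 <= Z by rewrite ZE; apply: IL_ge0 => x _; exact: mulr_ge0 (sqr_ge0 _) (omega_ge0 _ _ _).
have YE : Y = \int[mu]_(x in Lam) (r x * p.[x] * omega 0 b x).
  by apply: eq_IL => x _; rewrite /omega powRr0 mul1r mulrA.
have e : \int[mu]_(x in Lam) ((r x - p.[x]) ^+ 2 * omega 0 b x) = X + (-2 * Y + Z).
  rewrite YE ZE -ILZl// -(ILD (integLZ _ irp) ip).
  rewrite -(ILD i1 (integLD (integLZ _ irp) ip)).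
  by apply: eq_IL => x _; ring.
rewrite e in hp.
have h1 : C * Z <= C * ((X - C) / 2 - X + 2 * Y) by apply: ler_wpM2l => //; lra.
have [C00|C00] := eqVneq C 0.
  rewrite C00 mul0r in YZ; have Y0 : Y = 0.
    by apply/eqP; rewrite -sqrf_eq0 eq_le YZ sqr_ge0.
  by rewrite Y0 C00 in hp CX; lra.
have Cp : 0 < C by rewrite lt_neqAle eq_sym C00.
by have := sqr_ge0 (Y - C); nra.
Qed.

End Density.

(** * Trial and test functions *)

Section ClassicalDerivatives.
Context {R : realType}.
Notation mu := (@lebesgue_measure R).
Notation Lam := (@Lambda R).
Implicit Types (f g h r : R -> R) (b : R) (p q : {poly R}).

Lemma continuousL_locint f : (forall x, Lam x -> {for x, continuous f}) ->
  locally_integrable Lam f.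
Proof.
move=> cf; split; [|exact: open_Lam|].
  by apply: open_continuous_measurable_fun; [exact: open_Lam|move=> x /[!inE]; exact: cf].
move=> K KL cK.
have := @continuous_compact_integrable R f K cK.
have h : {within K, continuous f}.
  by apply: continuous_in_subspaceT => x /[!inE] Kx; exact/cf/KL.
by move=> /(_ h)/integrableP[].
Qed.

(** The fundamental theorem of calculus for f phi, which vanishes near both ends; [f] may be
    singular there. *)
Lemma derive_weak f g : (forall x, Lam x -> is_derive x 1 f (g x)) ->
  (forall x, Lam x -> {for x, continuous g}) -> is_weak_derivative 1 f g.
Proof.
move=> df cg; have cf x : Lam x -> {for x, continuous f}.
  by move=> Lx; exact: is_derive_continuous (df x Lx).
have lf := continuousL_locint cf; have lg := continuousL_locint cg.
split => // phi tp; have [dp [a [b [a1 b1 H]]]] := tp.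
have tp' := test_derive1 tp.
have i1 := locint_test lg tp; have i2 := locint_test lf tp'.
rewrite /inner expr1 mulN1r; apply/eqP; rewrite -addr_eq0 -(ILD i2 i1); apply/eqP.
have dphi (x : R) : is_derive x 1 phi (derive1 phi x).
  by rewrite derive1E; apply/derivableP; exact: (dp 0%N x).
pose F x := f x * phi x.
transitivity ((0 : R) - 0); last by rewrite subr0.
have ab : a < b \/ b <= a by have [|] := ltP a b; [left|right].
have Fz x : x < a \/ b < x -> F x = 0.
  move=> xab; rewrite /F H ?mulr0// in_itv/=.
  by case: xab => h; rewrite negb_and -!ltNge h ?orbT.
apply: (@FTC_open _ _ F (-1) 1) => //.
- move=> x /LamE Lx; apply: cvgD; apply: cvgM; [exact: cf| |exact: cg|exact: (test_continuous tp)].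
  exact: (test_continuous tp').
- move=> x /LamE Lx; apply: (is_derive_eqR (is_deriveMR (df x Lx) (dphi x))).
  by rewrite addrC.
- apply: cvg_near_cst; near=> x; apply: Fz; left.
  by near: x; exact: nbhs_right_lt.
- apply: cvg_near_cst; near=> x; apply: Fz; right.
  by near: x; exact: nbhs_left_gt.
- exact: (integLD i2 i1).
Unshelve. all: by end_near. Qed.

Lemma continuous_polyw p (al be x : R) : Lam x ->
  {for x, continuous (fun x : R => p.[x] * omega al be x)}.
Proof.
move=> Lx; apply: cvgM.
  by apply: is_derive_continuous (is_derive_horner p x).
exact: is_derive_continuous (is_derive_jacw al be Lx).
Qed.

Lemma polyw_weak j (al be : R) p : is_weak_derivative j
  (fun x => p.[x] * omega al be x)
  (fun x => (jac_iter al be j p).[x] * omega (al - j%:R) (be - j%:R) x).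
Proof.
elim: j => [|j IH].
  rewrite !subr0; apply: weak_derivative0; apply: continuousL_locint => x Lx.
  exact: continuous_polyw.
rewrite -addn1; apply: (weak_derivative_comp IH); rewrite addn1.
apply: derive_weak => x Lx; last exact: continuous_polyw.
have := is_deriveMR (is_derive_horner (jac_iter al be j p) x)
  (is_derive_jacw (al - j%:R) (be - j%:R) Lx).
move=> /is_derive_eqR; apply.
rewrite -natr1 !opprD !addrA /=.
set A := al - j%:R; set B := be - j%:R; set P := jac_iter _ _ _ _.
rewrite /omega.
have -> : (1 - x) `^ A = (1 - x) * (1 - x) `^ (A - 1) by rewrite -powRS ?LamB0// subrK.
have -> : (1 + x) `^ B = (1 + x) * (1 + x) `^ (B - 1) by rewrite -powRS ?LamD0// subrK.
rewrite /jac_op !(hornerD, hornerM, hornerN, hornerZ, hornerX, hornerXn, hornerC).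
by ring.
Qed.

Lemma poly_weak j p : is_weak_derivative j (horner p) (horner p^`(j)).
Proof.
have ch (r : {poly R}) x : {for x, continuous (horner r)}.
  exact: is_derive_continuous (is_derive_horner r x).
elim: j => [|j IH]; first by apply: weak_derivative0; apply: continuousL_locint.
rewrite -addn1; apply: (weak_derivative_comp IH); rewrite addn1 derivnS.
by apply: derive_weak => x _; exact: ch.
Qed.

Lemma test_weak j (phi : R -> R) : test_function phi -> is_weak_derivative j phi (derive1n j phi).
Proof.
move=> tp; elim: j => [|j IH].
  apply: weak_derivative0; apply: continuousL_locint => x _; exact: test_continuous.
rewrite -addn1; apply: (weak_derivative_comp IH); rewrite addn1 derive1nS.
have tj := test_derive1n j tp; apply: derive_weak => x _.
  by rewrite derive1E; apply/derivableP; case: tj => dp _; exact: (dp 0%N x).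
exact: (test_continuous (test_derive1 tj)).
Qed.

Lemma derivn_XsubC_mul (a : R) q l :
  (('X - a%:P) * q)^`(l.+1) = ('X - a%:P) * q^`(l.+1) + q^`(l) *+ l.+1.
Proof.
elim: l => [|l IH].
  by rewrite !derivn1 derivn0 derivM derivXsubC mul1r mulr1n addrC.
rewrite derivnS IH derivD derivM derivXsubC mul1r derivMn -!derivnS.
by rewrite [q^`(l.+1) + _]addrC -addrA -mulrS.
Qed.

Lemma derivn_root_factor (a : R) k p : (forall l, (l < k)%N -> (p^`(l)).[a] = 0) ->
  exists q, p = ('X - a%:P) ^+ k * q.
Proof.
elim: k p => [|k IH] p H; first by exists p; rewrite expr0 mul1r.
have /factor_theorem[q pq] : root p a by rewrite /root; have := H 0%N isT; rewrite derivn0 => ->.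
rewrite mulrC in pq.
have [|q' qE] := IH q.
  move=> l lk; have := H l.+1 lk; rewrite pq derivn_XsubC_mul hornerD hornerM hornerMn hornerXsubC subrr mul0r add0r.
  by move/eqP; rewrite mulrn_eq0/= => /eqP.
by exists q'; rewrite pq qE exprS mulrA.
Qed.

Lemma derivn_root_mul (a : R) k q l : (l < k)%N ->
  ((('X - a%:P) ^+ k * q)^`(l)).[a] = 0.
Proof.
elim: k l q => [//|k IH] l q lk; rewrite exprS -mulrA.
case: l lk => [|l] lk; first by rewrite derivn0 hornerM hornerXsubC subrr mul0r.
by rewrite derivn_XsubC_mul hornerD hornerM hornerXsubC subrr mul0r add0r hornerMn IH// mul0rn.
Qed.

(** Each inversion of [jac_op] uses up one degree of the orthogonality, so orthogonality to degrees
    below M allows exactly M of them. *)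
Lemma jac_surj_iter b M p : -1 < b ->
  (forall t : {poly R}, (size t <= M)%N -> jac_form 0 b p t = 0) ->
  exists q, jac_iter M%:R (b + M%:R) M q = p.
Proof.
move=> b1 pt; suff : forall i, (i <= M)%N -> exists2 q, jac_iter i%:R (b + i%:R) i q = p &
    forall t : {poly R}, (size t <= M - i)%N -> jac_form i%:R (b + i%:R) q t = 0.
  by move=> /(_ _ (leqnn M))[q <- _]; exists q.
elim=> [_|i IH iM]; first by exists p; rewrite ?subn0 ?addr0.
have [q <- qt] := IH (ltnW iM); have i0 : 0 <= i%:R :> R by [].
have [|||q' [h1 h2 _]] := @jac_step R (i%:R + 1) (b + i%:R + 1) (M - i.+1) q.
- by rewrite lerDr.
- lra.
- by move=> t st; rewrite !addrK; apply: qt; rewrite (leq_trans st)//; lia.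
exists q'; rewrite -natr1 addrA//; by rewrite jac_iterSr !addrK -h1.
Qed.

Lemma size_jac_op_eq (al be : R) p : 0 < al + be -> p != 0 ->
  size (jac_op al be p) = (size p).+1.
Proof.
move=> ab p0; apply/eqP; rewrite eqn_leq size_jac_op//= ltnNge; apply/negP => h.
have sp : size p = (size p).-1.+1 by rewrite prednK// lt0n size_poly_eq0.
set n := (size p).-1 in sp.
have z1 : p`_n.+1 = 0 by apply: nth_default; rewrite sp.
have z2 : p`_n.+2 = 0 by apply: nth_default; rewrite sp.
have : (jac_op al be p)`_n.+1 = 0 by apply: nth_default; rewrite -sp.
rewrite coef_jac_op z1 z2 !mulr0 addr0 sub0r => /eqP.
rewrite oppr_eq0 mulf_eq0 -lead_coefE lead_coef_eq0 (negPf p0) orbF.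
by rewrite -addrA gt_eqF// ltr_wpDl.
Qed.

Lemma size_jac_iter (al be : R) m p : m%:R <= al -> m%:R - 1 < be -> p != 0 ->
  size (jac_iter al be m p) = (size p + m)%N.
Proof.
elim: m => [|m IH]; first by rewrite addn0.
rewrite -natr1 => ha hb p0.
have sm : size (jac_iter al be m p) = (size p + m)%N by apply: IH => //; lra.
rewrite /= size_jac_op_eq ?sm ?addnS//; first lra.
by rewrite -size_poly_eq0 sm addn_eq0 size_poly_eq0 (negPf p0).
Qed.

(** An infinite integral would be read as 0, so finiteness is needed besides positivity. The
    majorant is a Beta integrand near 0 plus the exponential density; the lower bound e^(-1) comes
    from ]0, 1[. *)
Lemma Gamma_neq0 (a : R) : 0 < a < 1 -> Gamma a != 0.
Proof.
move=> /andP[a0 a1]; pose F (t : R) := t `^ (a - 1) * expR (- t).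
have F0 t : 0 <= F t by rewrite /F mulr_ge0 ?powR_ge0 ?expR_ge0.
have mF : measurable_fun setT F.
  apply: measurable_funM; first exact: measurable_powR.
  by apply: continuous_measurable_fun => t; apply: continuous_comp; [exact: oppr_continuous|exact: continuous_expR].
have mO : measurable (`]0, +oo[%classic : set R) by exact: measurable_itv.
pose G1 (t : R) := tpow (a - 1) t * tpow 0 (1 - t); pose G2 := @exponential_pdf R 1.
have G10 t : 0 <= G1 t by rewrite mulr_ge0 ?tpow_ge0.
have G20 t : 0 <= G2 t by apply: exponential_pdf_ge0.
have mG1 : measurable_fun setT G1.
  apply: measurable_funM; first exact: measurable_tpow.
  by apply: measurable_tpow_comp; exact: measurable_funB.
have mG2 : measurable_fun setT G2 by exact: measurable_exponential_pdf.
have mG12 := measurable_funD mG1 mG2.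
have fin : (\int[mu]_(t in `]0%R, +oo[) (F t)%:E < +oo)%E.
  apply: (@le_lt_trans _ _ (\int[mu]_t ((G1 t)%:E + (G2 t)%:E))%E).
    apply: (@le_trans _ _ (\int[mu]_(t in `]0%R, +oo[) ((G1 t)%:E + (G2 t)%:E))%E).
      apply: ge0_le_integral => //.
      - by move=> t _; rewrite lee_fin.
      - by apply/measurable_EFinP; exact: measurable_funTS mF.
      - by apply/measurable_EFinP; exact: measurable_funTS mG12.
      - move=> t; rewrite /= in_itv/= andbT => t0; rewrite -EFinD lee_fin.
        have g2 : G2 t = expR (- t).
          by rewrite /G2 /exponential_pdf patchE mem_set/= ?in_itv/= ?andbT ?(ltW t0)// mul1r mulN1r.
        have [t1|t1] := ltP t 1.
          rewrite /G1 !tpowE ?subr_gt0// powRr0 mulr1.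
          apply: (@le_trans _ _ (t `^ (a - 1))); last by rewrite lerDl.
          by apply: ler_piMr; [exact: powR_ge0|rewrite expR_le1 oppr_le0 ltW].
        apply: (@le_trans _ _ (G2 t)); last by rewrite lerDr.
        rewrite g2 /F; apply: ler_piMl; first exact: expR_ge0.
        rewrite -[leRHS](powRr0 t); apply: ler_powR => //; lra.
    apply: ge0_subset_integral => //.
      by apply/measurable_EFinP; exact: mG12.
    by move=> t _; rewrite -EFinD lee_fin addr_ge0.
  rewrite ge0_integralD//.
  - rewrite EFin_beta; [|lra|lra].
    by rewrite integral_exponential_pdf// -EFinD ltry.
  - by move=> t _; rewrite lee_fin.
  - by apply/measurable_EFinP; exact: mG1.
  - by move=> t _; rewrite lee_fin.
  - by apply/measurable_EFinP; exact: mG2.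
have low : ((expR (-1))%:E <= \int[mu]_(t in `]0%R, +oo[) (F t)%:E)%E.
  apply: (@le_trans _ _ (\int[mu]_(t in `]0%R, 1%R[) (F t)%:E)%E).
    have -> : (expR (-1))%:E = (\int[mu]_(t in `]0%R, 1%R[) (expR (-1))%:E)%E.
      rewrite integral_cst//= lebesgue_measure_itv/= lte_fin ltr01.
      by rewrite oppr0 adde0 mule1.
    apply: ge0_le_integral => //.
    - by apply/measurable_EFinP; exact: measurable_funTS mF.
    - move=> t; rewrite /= in_itv/= => /andP[t0 t1]; rewrite lee_fin /F.
      apply: (@le_trans _ _ (expR (- t))); first by rewrite ler_expR; lra.
      apply: ler_peMl; first exact: expR_ge0.
      have -> : a - 1 = - (1 - a) by ring.
      rewrite powRN invf_ge1 ?powR_gt0//.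
      have e1 : 1 `^ (1 - a) = 1 :> R by rewrite powR1.
      rewrite -[leRHS]e1.
      by apply: ge0_ler_powR; rewrite ?nnegrE; lra.
  apply: ge0_subset_integral => //.
  - by apply/measurable_EFinP; exact: measurable_funTS mF.
  - by move=> t _; rewrite lee_fin.
  - by move=> t; rewrite /= !in_itv/= => /andP[-> _].
rewrite /Gamma /Rintegral gt_eqF// fine_gt0// fin andbT.
by apply: lt_le_trans low; rewrite lte_fin expR_gt0.
Qed.

Lemma RL_orderE k (s : R) (l : nat) : (0 < k)%N -> k%:R - 1 < s < k%:R ->
  RL_order (s + l%:R) = (k + l)%N.
Proof.
move=> k0 /andP[s1 s2]; rewrite /RL_order.
have -> : Num.truncn (s + l%:R) = (k.-1 + l)%N.
  have kk : k%:R = k.-1%:R + 1 :> R by rewrite natr1 prednK.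
  have k10 : 0 <= k.-1%:R :> R by [].
  have l0 : 0 <= l%:R :> R by [].
  apply/eqP; rewrite truncn_eq; last by lra.
  by rewrite -natr1 natrD; apply/andP; split; lra.
by rewrite -addSn prednK.
Qed.

(** The exponent depends only on sigma minus its order, which is s - k for every sigma = s + l: all
    the fractional derivatives involved are weak derivatives of one function, of order k + l. *)
Lemma RL_integralE k (s : R) (l : nat) v x : (0 < k)%N -> k%:R - 1 < s < k%:R -> Lam x ->
  RL_integral (s + l%:R) v x = Jr (- (s - k%:R) - 1) v x.
Proof.
move=> k0 hs Lx; rewrite /RL_integral (RL_orderE l k0 hs) natrD.
rewrite (_ : s + l%:R - (k%:R + l%:R) + 1 = s - k%:R + 1); last by ring.
have x1 : -1 <= x by move/LamE: Lx => /andP[? _]; exact: ltW.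
rewrite -IL_tpow0_right//; apply: eq_IL => y Ly.
have [xy|yx] := ltP x y; last by rewrite !tpow0 ?subr_le0// !mul0r.
rewrite !tpowE ?subr_gt0// powRr0 mul1r -powRN mulrC; congr (_ `^ _ * _); ring.
Qed.

(** Expand [p] in powers of 1 - x; each term (1 - y)^(s+i) is mapped to a Beta constant times (1 -
    x)^(c+s+1+i), an integer power because c + s + 1 = k. *)
Lemma Jr_powRB_poly (c s : R) k p x : -1 < c -> 0 < s -> c + s + 1 = k%:R -> Lam x ->
  Jr c (fun y => (1 - y) `^ s * p.[y]) x =
  (\sum_(i < size p) ((p \Po (1 - 'X))`_i * betaf c (s + i%:R)) *: (1 - 'X) ^+ (k + i)).[x].
Proof.
move=> c1 s0 csk Lx.
have pE y : p.[y] = \sum_(i < size p) (p \Po (1 - 'X))`_i * (1 - y) ^+ i.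
  have -> : p.[y] = (p \Po (1 - 'X)).[1 - y].
    rewrite horner_comp !(hornerD, hornerN, hornerX, hornerC); congr (p.[_]); ring.
  apply: horner_coef_wide; rewrite size_comp_poly2//.
  by rewrite addrC size_polyDl ?size_polyN ?size_polyX ?size_poly1.
have s1 (i : nat) : -1 < s + i%:R by apply: lt_le_trans (_ : s <= _); [lra|rewrite lerDl].
have x1 : -1 <= x by move/LamE: Lx => /andP[? _]; exact: ltW.
have LB := LamB0 Lx.
have ii (i : nat) : integL (fun y => tpow c (y - x) * tpow (s + i%:R) (1 - y)).
  apply: integL_ge0.
  - apply: measurable_funM; first exact: measurable_tpowB.
    by apply: measurable_tpow_comp; exact: measurable_funB.
  - by move=> y _; rewrite mulr_ge0 ?tpow_ge0.
  - by rewrite tpow_conv// ltry.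
have e i : \int[mu]_(y in Lam) (tpow c (y - x) * tpow (s + i%:R) (1 - y)) =
    betaf c (s + i%:R) * (1 - x) ^+ (k + i).
  rewrite /Rintegral tpow_conv//= tpowE// -powR_mulrn ?(ltW LB)//.
  by congr (_ * _ `^ _); rewrite natrD -csk; ring.
rewrite horner_sum /Jr.
rewrite (@eq_IL _ _ (fun y => \sum_(i < size p) (p \Po (1 - 'X))`_i *
   (tpow c (y - x) * tpow (s + i%:R) (1 - y)))).
  rewrite IL_sum => [|i]; last exact: integLZ.
  apply: eq_bigr => i _; rewrite ILZl// e hornerZ horner_exp.
  by rewrite !(hornerD, hornerN, hornerX, hornerC) mulrA.
move=> y Ly; have Ly0 := LamB0 Ly; rewrite pE mulr_sumr mulr_sumr; apply: eq_bigr => i _.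
rewrite [tpow (s + i%:R) _]tpowE// powRD ?(gt_eqF Ly0) ?implybT// powR_mulrn ?(ltW Ly0)//.
by ring.
Qed.

End ClassicalDerivatives.

(** * Discrete spaces and fractional derivatives in terms of Abel operators *)

Section Spaces.
Context {R : realType}.
Notation mu := (@lebesgue_measure R).
Notation Lam := (@Lambda R).
Implicit Types (u v f g h w phi : R -> R) (s b : R) (p q t : {poly R}).

Lemma weak_derivative_meas j w g : is_weak_derivative j w g -> measurable_fun Lam g.
Proof. by move=> [_ [mg _ _] _]; exact: mg. Qed.

Lemma omega0E b x : omega 0 b x = (1 + x) `^ b.
Proof. by rewrite /omega powRr0 mul1r. Qed.

Lemma omegaNK (al be x : R) : Lam x -> omega al be x * omega (- al) (- be) x = 1.
Proof.
move=> Lx; rewrite /omega !powRN.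
have h1 : (1 - x) `^ al != 0 by rewrite gt_eqF// powR_gt0// LamB0.
have h2 : (1 + x) `^ be != 0 by rewrite gt_eqF// powR_gt0// LamD0.
by field; rewrite h1 h2.
Qed.

Lemma normw_sq (al be : R) u :
  normw (omega al be) u ^+ 2 = \int[mu]_(x in Lam) (u x ^+ 2 * omega al be x).
Proof.
rewrite /normw sqr_sqrtr//; apply: IL_ge0 => x _.
exact: mulr_ge0 (sqr_ge0 _) (omega_ge0 _ _ _).
Qed.

Lemma normUE k s u : normU k s u =
  Num.sqrt (\int[mu]_(x in Lam) (u x ^+ 2 * omega (- s) (- k%:R) x) +
    \int[mu]_(x in Lam) (RL_derivative s u x ^+ 2 * omega 0 (s - k%:R) x)).
Proof. by rewrite /normU !normw_sq. Qed.

Lemma L2w_integL (al be : R) u : 0 <= al -> 0 <= be ->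
  L2w (omega (- al) (- be)) u -> integL u.
Proof.
move=> a0 b0 [mu' iu]; pose c := 2 `^ al * 2 `^ be : R.
apply: (integL_le mu' (integLD (integL_cst 1) (integLZ c iu))) => x Lx.
have h : 1 <= c * omega (- al) (- be) x.
  rewrite -(omegaNK al be Lx); apply: ler_wpM2r; first exact: omega_ge0.
  rewrite /omega /c; apply: ler_pM; rewrite ?powR_ge0//; apply: powR2_le => //.
    by have /andP[h ->] := LamB02 Lx; rewrite ltW.
  by have /andP[h ->] := LamD02 Lx; rewrite ltW.
have h2 := ler_wpM2l (sqr_ge0 (u x)) h.
rewrite mulr1 mulrCA in h2.
apply: (@le_trans _ _ (1 + u x ^+ 2)); last by rewrite lerD2l.
rewrite -[u x ^+ 2]real_normK ?num_real//.
by set z := `|u x|; have := sqr_ge0 (z - 1); have := sqr_ge0 z; nra.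
Qed.

Lemma L2w_polyw (al be : R) q : 0 <= al -> 0 <= be ->
  L2w (omega (- al) (- be)) (fun x => q.[x] * omega al be x).
Proof.
move=> a0 b0; split.
  by apply: measurable_funM; [exact: measurable_horner|exact: measurable_omega].
apply: eq_integL (integL_poly_omega (q ^+ 2) a0 (lt_le_trans (ltrN10 _) b0)) => x Lx.
rewrite horner_exp; set z := omega (- al) _ x; set y := omega al be x.
have yz : y * z = 1 by exact: omegaNK.
have -> : (q.[x] * y) ^+ 2 * z = q.[x] ^+ 2 * y * (y * z) by ring.
by rewrite yz mulr1.
Qed.

Lemma L2w_ae (w u u' : R -> R) : measurable_fun Lam w -> measurable_fun Lam u' ->
  aeL (fun x => u x = u' x) -> L2w w u -> L2w w u'.
Proof.
move=> mw mu' e [mu1 i]; split => //; apply: aeL_integL i.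
  by apply: measurable_funM => //; exact: measurable_funX.
by apply: aeL_imp e => x _ ->.
Qed.

Lemma polyw_cvg0 (al be : R) q : 0 < al -> 0 < be ->
  q.[x] * omega al be x @[x --> (-1)^'+] --> (0 : R) /\
  q.[x] * omega al be x @[x --> 1^'-] --> (0 : R).
Proof.
move=> a0 b0; have cp (x : R) : {for x, continuous (fun x : R => q.[x])}.
  exact: is_derive_continuous (is_derive_horner q x).
split.
- rewrite -(mulr0 q.[-1]); apply: cvgM; first exact/cvg_at_right_filter/cp.
  rewrite -(mulr0 ((1 - -1) `^ al)); apply: cvgM.
    by apply: cvg_at_right_filter; apply: powRB_continuous; lra.
  have := @powRD_cvg0 R be (-1) b0; apply: cvg_trans; apply: near_eq_cvg.
  by apply: nearW => x; rewrite opprK addrC.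
- rewrite -(mulr0 q.[1]); apply: cvgM; first exact/cvg_at_left_filter/cp.
  rewrite -(mul0r ((1 + 1) `^ be)); apply: cvgM; first exact: powRB_cvg0.
  apply: cvg_at_left_filter.
  have h : 0 < 1 + 1 :> R by lra.
  exact: is_derive_continuous (is_derive_powRD be h).
Qed.

Lemma size_derivn_leq q n d : (size q <= n + d)%N -> (size (q^`(n))%R <= d)%N.
Proof.
move=> sq; apply/leq_sizeP => j dj; rewrite coef_derivn nth_default ?mul0rn//.
by rewrite (leq_trans sq)// leq_add2l.
Qed.

(** A trial function is (1 - x)^s (1 + x)^k q. By [Jr_powRB_poly] its Abel integral is a polynomial
    of degree at most N + k, so its fractional derivative is, up to a constant, a polynomial of
    degree at most N. *)
Lemma Fplus_facts k s N uN : (0 < k)%N -> k%:R - 1 < s < k%:R -> Fplus k s N uN ->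
  [/\ integL uN, L2w (omega (- s) (- k%:R)) uN, boundary_conditions k uN &
   exists2 P : {poly R}, (size P <= N.+1)%N &
     is_weak_derivative k (Jr (- (s - k%:R) - 1) uN) (horner P)].
Proof.
move=> k0 /andP[s1 s2] [psi [spsi psi0 uE]].
have kR1 : 1 <= k%:R :> R by rewrite ler1n.
have kR0 : 0 < k%:R :> R by lra.
have s0 : 0 < s by lra.
have [q pq] := derivn_root_factor psi0.
have uq x : Lam x -> q.[x] * omega s k%:R x = uN x.
  move=> Lx; rewrite uE// pq hornerM horner_exp hornerXsubC opprK /omega.
  by rewrite powR_mulrn ?(ltW (LamD0 Lx))// [1 + x]addrC; ring.
have [mq iq] := L2w_polyw q (ltW s0) (ltW kR0).
have iF := integL_poly_omega q (ltW s0) (lt_trans (ltrN10 _) kR0).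
have iu : integL uN by exact: eq_integL uq iF.
split=> //.
- split; first exact: (integL_meas iu).
  by apply: eq_integL iq => x Lx; rewrite uq.
(* The l-th derivative keeps the factor (1 - x)^(s-l) (1 + x)^(k-l), with both exponents positive
   since l <= k - 1 < s. *)
- move=> l lk; exists (fun x => (jac_iter s k%:R l q).[x] * omega (s - l%:R) (k%:R - l%:R) x).
  have lk1 : l%:R + 1 <= k%:R :> R by rewrite natr1 ler_nat.
  have wl := polyw_weak l s k%:R q.
  have [||c1 c2] := @polyw_cvg0 (s - l%:R) (k%:R - l%:R) (jac_iter s k%:R l q); [lra|lra|].
  split => //; apply: (weak_derivative_ae_eq wl).
  + exact: integL_locint.
  + by have [] := wl.
  + exact: aeL_all.
  + exact: aeL_all.
- have c1 : -1 < - (s - k%:R) - 1 by lra.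
  have csk : - (s - k%:R) - 1 + s + 1 = k%:R by ring.
  pose Q : {poly R} := \sum_(i < size psi) ((psi \Po (1 - 'X))`_i *
    betaf (- (s - k%:R) - 1) (s + i%:R)) *: (1 - 'X) ^+ (k + i).
  have sQ : (size Q <= k + N.+1)%N.
    apply: (leq_trans (size_sum _ _ _)); apply/bigmax_leqP => i _.
    apply: (leq_trans (size_scale_leq _ _)); apply: (leq_trans (size_poly_exp_leq _ _)).
    have -> : size (1 - 'X : {poly R}) = 2%N.
      by rewrite addrC size_polyDl ?size_polyN ?size_polyX ?size_poly1.
    by rewrite mul1n -addnS leq_add2l (leq_trans (ltn_ord i)).
  exists Q^`(k); first exact: size_derivn_leq.
  have wQ := poly_weak k Q; apply: (weak_derivative_ae_eq wQ).
  + by apply: integL_locint; have [] := Jr_integL c1 iu.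
  + by have [] := wQ.
  + apply: aeL_all => x Lx; rewrite -(Jr_powRB_poly psi c1 s0 csk Lx).
    by apply: eq_IL => y Ly; rewrite uE.
  + exact: aeL_all.
Qed.

Lemma Fminus_test k s N t : (0 < k)%N -> k%:R - 1 < s < k%:R -> (size t <= N.+1)%N ->
  (forall r : {poly R}, (size r <= k)%N -> jac_form 0 (s - k%:R) t r = 0) ->
  exists v, [/\ Fminus k s N v, V k s v &
    aeL (fun x => weak_derivative k v x = t.[x] * (1 + x) `^ (s - k%:R))].
Proof.
move=> k0 /andP[s1 s2] st tr.
have kR1 : 1 <= k%:R :> R by rewrite ler1n.
have kR0 : 0 <= k%:R :> R by lra.
have s0 : 0 < s by lra.
have b1 : -1 < s - k%:R by lra.
have [q] := jac_surj_iter b1 tr; rewrite subrK => qt.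
pose v x := q.[x] * omega k%:R s x.
have wv : is_weak_derivative k v (fun x => t.[x] * (1 + x) `^ (s - k%:R)).
  have := polyw_weak k k%:R s q; rewrite qt subrr.
  rewrite (_ : (fun x => _ * omega 0 _ x) = (fun x => t.[x] * (1 + x) `^ (s - k%:R)))//.
  by apply/funext => x; rewrite omega0E.
have wd := weakly_derivableP (ex_intro _ _ wv).
have wdE := weak_derivative_ae wv.
have mwd : measurable_fun Lam (weak_derivative k v) by exact: (weak_derivative_meas wd).
exists v; split => //.
(* The sign turns (1 - x)^k into the monic factor (x - 1)^k. The degree is right because each of the
   k applications of [jac_op] raised the degree of [q] by one. *)
- exists (('X - 1%:P) ^+ k * ((-1) ^+ k *: q)); split.
  + have [->|q0] := eqVneq q 0; first by rewrite scaler0 mulr0 size_poly0.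
    apply: (leq_trans (size_polyMleq _ _)); rewrite size_exp_XsubC/=.
    have := @size_jac_iter R k%:R s k q (lexx _) s1 q0; rewrite qt => h.
    by rewrite (leq_trans _ st)// h addnC leq_add2r size_scale_leq.
  + by move=> l lk; exact: derivn_root_mul.
  + move=> x Lx; rewrite /v /omega hornerM horner_exp hornerXsubC hornerZ.
    rewrite powR_mulrn ?(ltW (LamB0 Lx))//.
    have -> : (1 - x) ^+ k = (x - 1) ^+ k * (-1) ^+ k by rewrite -exprMn mulrN1 opprB.
    by ring.
- split; [exact: L2w_polyw (ltW s0)|by exists (fun x => t.[x] * (1 + x) `^ (s - k%:R))|].
  apply: (@L2w_ae _ (fun x => t.[x] * (1 + x) `^ (s - k%:R))) => //.
  + exact: measurable_omega.
  + by apply: aeL_imp wdE => x _ ->.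
  split; first by apply: measurable_funM; [exact: measurable_horner|exact: measurable_powRD].
  apply: eq_integL (integL_poly_omega (t ^+ 2) (lexx 0) b1) => x Lx.
  rewrite horner_exp !omega0E -[k%:R - s]opprB powRN.
  have h : (1 + x) `^ (s - k%:R) != 0 by rewrite gt_eqF// powR_gt0// LamD0.
  by field.
Qed.

(** Weights are harmless on functions vanishing near both ends. This makes the weak equation
    available in the sense of distributions, which identifies derivatives of [D_+^s u] with those of
    [f]. *)
Lemma test_V k s phi : test_function phi -> V k s phi.
Proof.
move=> tp; have wp := test_weak k tp.
have tk := test_derive1n k tp.
have L2t (al be : R) psi : test_function psi -> L2w (omega al be) psi.
  move=> tpsi; split; first exact: test_measurableL.
  have lo : locally_integrable Lam (fun x => psi x * omega al be x).
    apply: continuousL_locint => x Lx; apply: cvgM; first exact: test_continuous.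
    exact: is_derive_continuous (is_derive_jacw al be Lx).
  by apply: eq_integL (locint_test lo tpsi) => x _; ring.
split; [exact: L2t|by exists (derive1n k phi)|].
have wd := weakly_derivableP (ex_intro _ _ wp).
apply: (@L2w_ae _ (derive1n k phi)).
- exact: measurable_omega.
- exact: (weak_derivative_meas wd).
- by apply: aeL_imp (weak_derivative_ae wp) => x _ ->.
- exact: L2t.
Qed.

Lemma locintZ f c : locally_integrable Lam f -> locally_integrable Lam (fun x => c * f x).
Proof.
move=> lf; have := locintD (c - 1) lf lf.
by rewrite (_ : (fun x => _ + _) = fun x => c * f x)//; apply/funext => x; ring.
Qed.

Lemma weak_derivative_eqL j w w' g : (forall x, Lam x -> w x = w' x) ->
  is_weak_derivative j w g -> locally_integrable Lam w' -> is_weak_derivative j w' g.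
Proof.
move=> ww' h lw'; apply: (weak_derivative_ae_eq h) => //; last exact: aeL_all.
  by have [] := h.
exact: aeL_all.
Qed.

Lemma RL_weak k s l u : (0 < k)%N -> k%:R - 1 < s < k%:R -> integL u ->
  RL_derivable (s + l%:R) u ->
  is_weak_derivative (k + l) (Jr (- (s - k%:R) - 1) u)
    (weak_derivative (k + l) (RL_integral (s + l%:R) u)).
Proof.
move=> k0 hs iu; rewrite /RL_derivable (RL_orderE l k0 hs) => /weakly_derivableP wd.
apply: (weak_derivative_eqL _ wd) => [x Lx|]; first exact: RL_integralE.
have c1 : -1 < - (s - k%:R) - 1 by move/andP: hs => [? ?]; lra.
by apply: integL_locint; have [] := Jr_integL c1 iu.
Qed.

Lemma weak_RL k s u g : (0 < k)%N -> k%:R - 1 < s < k%:R ->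
  is_weak_derivative k (Jr (- (s - k%:R) - 1) u) g ->
  measurable_fun Lam (RL_derivative s u) /\
  aeL (fun x => RL_derivative s u x = (-1) ^+ k / Gamma (k%:R - s) * g x).
Proof.
move=> k0 hs wg.
have e := RL_orderE 0 k0 hs; rewrite addr0 addn0 in e.
have -> : RL_derivative s u = fun x => (-1) ^+ k / Gamma (k%:R - s) *
    weak_derivative k (RL_integral s u) x.
  by apply/funext => x; rewrite /RL_derivative e.
have [[mw oL wK] _ _] := wg.
have eqL x : Lam x -> Jr (- (s - k%:R) - 1) u x = RL_integral s u x.
  by move=> Lx; have := RL_integralE 0 u k0 hs Lx; rewrite addr0.
have lw : locally_integrable Lam (RL_integral s u).
  split; [by apply: eq_measurable_fun mw => x /[!inE]; exact: eqL|exact: oL|].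
  move=> K KL cK; have := wK K KL cK.
  by under eq_integral => x /[!inE] Kx do rewrite (eqL _ (KL _ Kx)).
have wI := weak_derivative_eqL eqL wg lw; split.
  apply: measurable_funM => //.
  exact: (weak_derivative_meas (weakly_derivableP (ex_intro _ _ wI))).
by apply: aeL_imp (weak_derivative_ae wI) => x _ ->.
Qed.

(** The Gamma argument k - s does not change with l, so raising the order contributes only a
    sign. *)
Lemma RL_derivativeE k s l u x : (0 < k)%N -> k%:R - 1 < s < k%:R ->
  RL_derivative (s + l%:R) u x = (-1) ^+ l * ((-1) ^+ k / Gamma (k%:R - s)) *
    weak_derivative (k + l) (RL_integral (s + l%:R) u) x.
Proof.
move=> k0 hs; rewrite /RL_derivative (RL_orderE l k0 hs) natrD exprD.
rewrite (_ : k%:R + l%:R - (s + l%:R) = k%:R - s); last by ring.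
by ring.
Qed.

End Spaces.

(** * Error estimate *)

Section Galerkin.
Context {R : realType}.
Notation mu := (@lebesgue_measure R).
Notation Lam := (@Lambda R).
Implicit Types (u v f g h w phi E G H : R -> R) (s b : R) (p q t : {poly R}).

Lemma integL_mul_poly b E t : -1 < b -> measurable_fun Lam E ->
  integL (fun x => E x ^+ 2 * omega 0 b x) ->
  integL (fun x => E x * t.[x] * omega 0 b x).
Proof.
move=> b1 mE iE; have [] := weighted_CS2 mE (measurable_horner t) (measurable_omega 0 b)
  (fun x _ => omega_ge0 0 b x) iE (integL_sq_poly t b1).
by [].
Qed.

Lemma pairing_lin b E a t r : -1 < b -> measurable_fun Lam E ->
  integL (fun x => E x ^+ 2 * omega 0 b x) ->
  \int[mu]_(x in Lam) (E x * (a *: t + r).[x] * omega 0 b x) =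
  a * \int[mu]_(x in Lam) (E x * t.[x] * omega 0 b x) +
  \int[mu]_(x in Lam) (E x * r.[x] * omega 0 b x).
Proof.
move=> b1 mE iE; have it := integL_mul_poly t b1 mE iE; have ir := integL_mul_poly r b1 mE iE.
rewrite -(ILZl a it) -(ILD (integLZ a it) ir); apply: eq_IL => x _.
by rewrite hornerD hornerZ; ring.
Qed.

Lemma moments_orth k b E t : -1 < b -> measurable_fun Lam E ->
  integL (fun x => E x ^+ 2 * omega 0 b x) ->
  (forall i, (i < k)%N -> \int[mu]_(y in Lam) ((1 + y) `^ (b + i%:R) * E y) = 0) ->
  (size t <= k)%N -> \int[mu]_(x in Lam) (E x * t.[x] * omega 0 b x) = 0.
Proof.
move=> b1 mE iE mom st.
(* Expansion of [t] at the point -1: the weighted powers of 1 + x are those of the vanishing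
   moments. *)
have tE : t = \sum_(i < size t) (t \Po ('X - 1%:P))`_i *: ('X + 1%:P) ^+ i.
  transitivity (t \Po (('X - 1%:P) \Po ('X + 1%:P))).
    by rewrite comp_polyB comp_polyX comp_polyC addrK comp_polyXr.
  by rewrite comp_polyA comp_polyE size_comp_poly2 ?size_XsubC.
pose l (r : {poly R}) := \int[mu]_(x in Lam) (E x * r.[x] * omega 0 b x).
have l0 : l 0 = 0.
  by have := pairing_lin (-1) 0 0 b1 mE iE; rewrite scaler0 addr0 -/(l 0); lra.
rewrite -/(l t) tE; apply: (big_ind (fun r => l r = 0)) => //.
  move=> r1 r2 h1 h2; have := pairing_lin 1 r1 r2 b1 mE iE.
  by rewrite scale1r -/(l _) -/(l r1) -/(l r2) h1 h2 mulr0 addr0.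
move=> i _; have := pairing_lin (t \Po ('X - 1%:P))`_i (('X + 1%:P) ^+ i) 0 b1 mE iE.
rewrite addr0 -/(l _) -/(l 0) l0 addr0 => ->.
rewrite (@eq_IL _ _ (fun y => (1 + y) `^ (b + i%:R) * E y)).
  by rewrite mom ?mulr0// (leq_trans (ltn_ord i)).
move=> x Lx; have x0 := LamD0 Lx; rewrite horner_exp hornerD hornerX hornerC omega0E.
rewrite powRD ?(gt_eqF x0) ?implybT// powR_mulrn ?(ltW x0)// [x + 1]addrC.
by ring.
Qed.

(** By duality it suffices to pair [E] with polynomials p. With r the projection of p on degrees at
    most N, [E] annihilates r and P is orthogonal to p - r, so the pairing is that of [G] with p -
    r; and p - r is no longer than p. *)
Lemma error_bound b m N G E H (P : {poly R}) : -1 < b -> (m <= N)%N ->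
  is_weak_derivative m G H -> integL (fun x => G x ^+ 2 * omega 0 b x) ->
  integL (fun x => H x ^+ 2 * omega m%:R (b + m%:R) x) ->
  (size P <= N.+1)%N -> (forall x, E x = G x - P.[x]) ->
  (forall t, (size t <= N.+1)%N -> \int[mu]_(x in Lam) (E x * t.[x] * omega 0 b x) = 0) ->
  \int[mu]_(x in Lam) (E x ^+ 2 * omega 0 b x) <=
  (m%:R ^+ m * N%:R ^- m) ^+ 2 * \int[mu]_(x in Lam) (H x ^+ 2 * omega m%:R (b + m%:R) x).
Proof.
move=> b1 mN wH iG iH sP EE orth.
have mG : measurable_fun Lam G by have [[]] := wH.
have mE : measurable_fun Lam E.
  have -> : E = fun x => G x - P.[x] by apply/funext.
  by apply: measurable_funB => //; exact: measurable_horner.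
have iE : integL (fun x => E x ^+ 2 * omega 0 b x).
  by apply: eq_integL (integL_sqB_poly P b1 mG iG) => x _; rewrite EE.
have iB := jac_inner_form (lexx 0) b1; have [sym lin ge0 _] := iB.
have X0 : 0 <= \int[mu]_(x in Lam) (H x ^+ 2 * omega m%:R (b + m%:R) x).
  by apply: IL_ge0 => x _; exact: mulr_ge0 (sqr_ge0 _) (omega_ge0 _ _ _).
apply: poly_dual_norm => //; first exact: mulr_ge0 (sqr_ge0 _) X0.
move=> p; have [r sr Hr] := form_proj iB N.+1 p.
have e1 : \int[mu]_(x in Lam) (E x * (p.[x] * (1 + x) `^ b)) =
    \int[mu]_(x in Lam) (G x * ((p - r).[x] * (1 + x) `^ b)).
  transitivity (\int[mu]_(x in Lam) (E x * (p - r).[x] * omega 0 b x)).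
    have := pairing_lin 1 (p - r) r b1 mE iE; rewrite (orth r sr) mul1r addr0 scale1r subrK => <-.
    by apply: eq_IL => x _; rewrite omega0E mulrA.
  have iGp := integL_mul_poly (p - r) b1 mG iG.
  have iPp : integL (fun x => (P * (p - r)).[x] * omega 0 b x) by exact: integL_poly_omega.
  rewrite (@eq_IL _ _ (fun x => G x * (p - r).[x] * omega 0 b x -
     (P * (p - r)).[x] * omega 0 b x)); last by move=> x _; rewrite EE hornerM; ring.
  rewrite (ILB iGp iPp) -jac_formM sym Hr// subr0.
  by apply: eq_IL => x _; rewrite omega0E mulrA.
rewrite e1.
have iG' : integL (fun x => G x ^+ 2 * (1 + x) `^ b).
  by apply: eq_integL iG => x _; rewrite omega0E.
apply: (le_trans (poly_dual_bound b1 mN wH iG' iH Hr)).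
apply: ler_wpM2l; first exact: mulr_ge0 (sqr_ge0 _) X0.
have z : jac_form 0 b (p - r) r = 0 by exact: Hr.
have := lin 1 (p - r) r p; rewrite scale1r subrK mul1r => ->.
have h1 : jac_form 0 b (p - r) p = jac_form 0 b (p - r) (p - r).
  by rewrite (sym _ p) -{1}(subrK r p) -[p - r + r]addrC -{1}[r]scale1r lin (sym r) z mulr0 add0r.
have h2 : jac_form 0 b r p = jac_form 0 b r r.
  by rewrite (sym r p) -{1}(subrK r p) -{1}[p - r]scale1r lin z mulr0 add0r.
by rewrite h1 h2 lerDl; exact: ge0.
Qed.

(** The factor by which [D_+^s] differs from the k-th weak derivative of the unnormalized Abel
    integral. *)
Definition cRL (k : nat) s : R := (-1) ^+ k / Gamma (k%:R - s).

Lemma cRL_neq0 k s : k%:R - 1 < s < k%:R -> cRL k s != 0.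
Proof.
move=> /andP[s1 s2]; rewrite /cRL mulf_neq0 ?signr_eq0// invr_eq0 Gamma_neq0//.
by apply/andP; split; lra.
Qed.

(** The regularity enters as an m-th weak derivative [H] of the unnormalized fractional derivative,
    a form shared by the two estimates of the theorem. *)
Lemma energy_bound k s m : (0 < k)%N -> k%:R - 1 < s < k%:R ->
  exists2 K : R, 0 < K & forall f u uN N H, (m <= N)%N ->
    weak_solution k s f u -> discrete_solution k s f N uN ->
    is_weak_derivative m (weak_derivative k (RL_integral s u)) H ->
    integL (fun x => H x ^+ 2 * omega m%:R (s - k%:R + m%:R) x) ->
    normU k s (fun x => u x - uN x) <= K * N%:R ^- m *
      normw (omega m%:R (s - k%:R + m%:R)) (fun x => cRL k s * H x).
Proof.
move=> k0 hs; have /andP[s1 s2] := hs; set b := s - k%:R.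
have b10 : -1 < b < 0 by apply/andP; split; rewrite /b; lra.
have /andP[b1 b0] := b10.
have kR1 : 1 <= k%:R :> R by rewrite ler1n.
have [C C0 HC] := coercivity k0 b10.
have cg0 := cRL_neq0 hs; set cg := cRL k s in cg0 *.
have cg2 : 0 < cg ^+ 2 by rewrite exprn_even_gt0.
(* The squared norm of the error is at most (C + cg^2) times that of [E]; the denominator cg^2
   compensates for measuring cg H instead of [H]. *)
pose K0 : R := Num.sqrt ((C + cg ^+ 2) / cg ^+ 2).
have K00 : 0 < K0 by rewrite sqrtr_gt0 divr_gt0// ltr_wpDl.
have mm : 0 < (m%:R ^+ m : R).
  by case: m => [|n]; [rewrite expr0|rewrite exprn_gt0// ltr0n].
exists (K0 * m%:R ^+ m); first exact: mulr_gt0.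
move=> f u uN N H mN [[Uu RLu URu] bcu wsu] [FN dsN] wH iH.
have iu : integL u by apply: (L2w_integL _ _ Uu); lra.
have [iN UN bcN [P sP wP]] := Fplus_facts k0 hs FN.
have RLu0 : RL_derivable (s + 0%:R) u by rewrite addr0.
have wG := RL_weak k0 hs iu RLu0; rewrite addn0 addr0 in wG.
set G := weak_derivative k (RL_integral s u) in wH wG.
have mG : measurable_fun Lam G by exact: (weak_derivative_meas wG).
have [_ uG] := weak_RL k0 hs wG; rewrite -/(cRL k s) -/cg in uG.
have [mRN nG] := weak_RL k0 hs wP; rewrite -/(cRL k s) -/cg in nG.
have iG : integL (fun x => G x ^+ 2 * omega 0 b x).
  have [mRL iRL] := URu.
  apply: (@aeL_integL _ (fun x => (cg ^+ 2)^-1 * (RL_derivative s u x ^+ 2 * omega 0 (s - k%:R) x))).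
  - by apply: measurable_funM; [exact: measurable_funX|exact: measurable_omega].
  - by apply: aeL_imp uG => x _ ->; rewrite -/b; field.
  - exact: integLZ.
pose e x := u x - uN x; pose E x := G x - P.[x].
have bce : boundary_conditions k e.
  move=> l lk; have [w1 [h1 h2 h3]] := bcu l lk; have [w2 [h4 h5 h6]] := bcN l lk.
  exists (fun x => w1 x - w2 x); split.
  - have := weak_derivativeD (-1) h1 h4.
    rewrite (_ : (fun x => u x + _) = e); last by apply/funext => x; rewrite mulN1r.
    by rewrite (_ : (fun x => w1 x + _) = (fun x => w1 x - w2 x))//; apply/funext => x; rewrite mulN1r.
  - by rewrite -(subr0 (0 : R)); exact: cvgB.
  - by rewrite -(subr0 (0 : R)); exact: cvgB.
have ie : integL e by exact: integLB.
have c1 : -1 < - b - 1 by lra.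
have wE : is_weak_derivative k (Jr (- b - 1) e) E.
  have wd := weak_derivativeD (-1) wG wP; have [_ lE _] := wd.
  have [aeu _] := Jr_integL c1 iu; have [aeN _] := Jr_integL c1 iN.
  have [_ iJe] := Jr_integL c1 ie.
  have -> : E = fun x => G x + -1 * P.[x] by apply/funext => x; rewrite mulN1r.
  apply: (weak_derivative_ae_eq wd) => //; first exact: integL_locint.
    apply: aeL_imp (aeL_and aeu aeN) => x Lx [i1 i2].
    rewrite mulN1r /Jr -(ILB i1 i2); apply: eq_IL => y _; rewrite /e; ring.
  exact: aeL_all.
have mE : measurable_fun Lam E by exact: (weak_derivative_meas wE).
have iE : integL (fun x => E x ^+ 2 * omega 0 b x) by exact: integL_sqB_poly.
have Ue : L2w (omega (- s) (- k%:R)) e.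
  have [mu1 iu1] := Uu; have [mu2 iu2] := UN; split; first exact: measurable_funB.
  apply: (@integL_le _ _ (fun x => 2 * (u x ^+ 2 * omega (- s) (- k%:R) x) +
     2 * (uN x ^+ 2 * omega (- s) (- k%:R) x))).
  - by apply: measurable_funM; [apply: measurable_funX; exact: measurable_funB|exact: measurable_omega].
  - by apply: integLD; exact: integLZ.
  move=> x _; have := omega_ge0 (- s) (- k%:R) x; set w := omega _ _ x => w0.
  rewrite ger0_norm; last exact: mulr_ge0 (sqr_ge0 _) w0.
  have -> : 2 * (u x ^+ 2 * w) + 2 * (uN x ^+ 2 * w) = (2 * u x ^+ 2 + 2 * uN x ^+ 2) * w by ring.
  apply: ler_wpM2r => //; rewrite /e; clear.
  by have := sqr_ge0 (u x + uN x); nra.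
have iE' : integL (fun y => E y ^+ 2 * (1 + y) `^ b).
  by apply: eq_integL iE => x _; rewrite omega0E.
have bk : b + k%:R = s by rewrite /b subrK.
have iee : integL (fun x => e x ^+ 2 * ((1 - x) `^ (- (b + k%:R)) * (1 + x) `^ (- k%:R))).
  by rewrite bk; case: Ue.
have [mom coer] := HC e E bce ie mE iE' wE iee.
have orthk := moments_orth b1 mE iE mom.
have orth t : (size t <= N.+1)%N -> \int[mu]_(x in Lam) (E x * t.[x] * omega 0 b x) = 0.
  (* Degrees below k are covered by the moments. For larger ones the projection on degrees below k
     is subtracted, which makes t - r the derivative factor of a discrete test function. *)
  move=> st; have [sk|sk] := leqP (size t) k; first exact: orthk.
  have [r sr Hr] := form_proj (jac_inner_form (lexx 0) b1) k t.
  have := pairing_lin 1 (t - r) r b1 mE iE.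
  rewrite scale1r subrK mul1r (orthk r sr) addr0 => ->.
  have str : (size (t - r)%R <= N.+1)%N.
    rewrite (leq_trans (size_polyD _ _))// geq_max st size_polyN.
    exact: leq_trans sr (leq_trans (ltnW sk) st).
  have [v [Fv Vv vE]] := Fminus_test k0 hs str Hr.
  have [_ wuv] := wsu v Vv; have wNv := dsN v Fv.
  have mwd : measurable_fun Lam (weak_derivative k v).
    by have [_ /weakly_derivableP wd _] := Vv; exact: (weak_derivative_meas wd).
  have iGt := integL_mul_poly (t - r) b1 mG iG.
  have iPt := integL_poly_omega (P * (t - r)) (lexx 0) b1.
  have eG : inner (RL_derivative s u) (weak_derivative k v) =
      cg * \int[mu]_(x in Lam) (G x * (t - r).[x] * omega 0 b x).
    have [mRL _] := URu; rewrite -(ILZl cg iGt) /inner; apply: aeL_IL.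
    - exact: measurable_funM.
    - exact: (integL_meas (integLZ cg iGt)).
    - by apply: aeL_imp (aeL_and uG vE) => x _ [-> ->]; rewrite omega0E; ring.
  have eP : inner (RL_derivative s uN) (weak_derivative k v) =
      cg * \int[mu]_(x in Lam) ((P * (t - r)).[x] * omega 0 b x).
    rewrite -(ILZl cg iPt) /inner.
    apply: aeL_IL.
    - exact: measurable_funM.
    - exact: (integL_meas (integLZ cg iPt)).
    - by apply: aeL_imp (aeL_and nG vE) => x _ [-> ->]; rewrite omega0E hornerM; ring.
  (* Galerkin orthogonality: the continuous and the discrete equation have the same right-hand side
     for this [v], and cg is cancelled. *)
  have AB := mulfI cg0 (etrans (etrans (esym eG) wuv) (esym (etrans (esym eP) wNv))).
  apply: (etrans _ (etrans (ILB iGt iPt) _)); last by apply/eqP; rewrite subr_eq0; apply/eqP.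
  by apply: eq_IL => x _; rewrite /E hornerM; ring.
have main := error_bound b1 mN wH iG iH sP (fun x => erefl) orth.
set XE := \int[mu]_(x in Lam) (E x ^+ 2 * omega 0 b x) in main.
set XH := \int[mu]_(x in Lam) (H x ^+ 2 * omega m%:R (b + m%:R) x) in main.
have XH0 : 0 <= XH.
  by apply: IL_ge0 => x _; exact: mulr_ge0 (sqr_ge0 _) (omega_ge0 _ _ _).
have [mRe eE] := weak_RL k0 hs wE; rewrite -/(cRL k s) -/cg in eE.
have RE : \int[mu]_(x in Lam) (RL_derivative s e x ^+ 2 * omega 0 b x) = cg ^+ 2 * XE.
  rewrite -(ILZl (cg ^+ 2) iE); apply: aeL_IL.
  - by apply: measurable_funM; [exact: measurable_funX|exact: measurable_omega].
  - exact: (integL_meas (integLZ (cg ^+ 2) iE)).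
  - by apply: aeL_imp eE => x _ ->; ring.
have NH : normw (omega m%:R (b + m%:R)) (fun x => cg * H x) = `|cg| * Num.sqrt XH.
  rewrite /normw (@eq_IL _ _ (fun x => cg ^+ 2 * (H x ^+ 2 * omega m%:R (b + m%:R) x))).
    by rewrite ILZl// sqrtrM ?sqr_ge0// sqrtr_sqr.
  by move=> x _; ring.
have -> : normU k s (fun x => u x - uN x) =
    Num.sqrt (\int[mu]_(x in Lam) (e x ^+ 2 * omega (- s) (- k%:R) x) + cg ^+ 2 * XE).
  by rewrite -RE; exact: normUE.
rewrite NH.
have coer' : \int[mu]_(x in Lam) (e x ^+ 2 * omega (- s) (- k%:R) x) <= C * XE.
  have -> : XE = \int[mu]_(y in Lam) (E y ^+ 2 * (1 + y) `^ b).
    by apply: eq_IL => x _; rewrite omega0E.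
  by move: coer; rewrite bk.
apply: (@le_trans _ _ (Num.sqrt ((C + cg ^+ 2) * ((m%:R ^+ m * N%:R ^- m) ^+ 2 * XH)))).
  apply: ler_wsqrtr; apply: (@le_trans _ _ ((C + cg ^+ 2) * XE)).
    by rewrite mulrDl lerD2r.
  by apply: ler_wpM2l main; rewrite addr_ge0 ?sqr_ge0.
have Nm0 : 0 <= (m%:R ^+ m * N%:R ^- m : R).
  by rewrite mulr_ge0 ?invr_ge0 ?exprn_ge0.
have Cc : 0 <= C + cg ^+ 2 by rewrite addr_ge0 ?sqr_ge0.
rewrite sqrtrM// sqrtrM ?sqr_ge0// sqrtr_sqr (ger0_norm Nm0).
have -> : Num.sqrt (C + cg ^+ 2) = K0 * `|cg|.
  rewrite -sqrtr_sqr /K0 -sqrtrM; last by rewrite divr_ge0 ?sqr_ge0.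
  by congr Num.sqrt; field.
rewrite le_eqVlt; apply/orP; left; apply/eqP; ring.
Qed.

End Galerkin.

Theorem theorem4 (R : realType) (k : nat) (s : R)
    (hk : (0 < k)%N) (hs : k%:R - 1 < s < k%:R) (m : nat) :
  exists c : R, 0 < c /\
    forall (f u uN : R -> R) (N : nat),
      (m <= N)%N ->
      weak_solution k s f u ->
      discrete_solution k s f N uN ->
      (Bplus m k s u ->
        normU k s (fun x => u x - uN x) <=
          c * N%:R ^- m *
          normw (omega m%:R (s - k%:R + m%:R)) (RL_derivative (s + m%:R) u)) /\
      ((k <= m)%N ->
       weakly_derivable (m - k) f ->
       L2w (omega m%:R (s - k%:R + m%:R)) (weak_derivative (m - k) f) ->
        normU k s (fun x => u x - uN x) <=
          c * N%:R ^- m *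
          normw (omega m%:R (s - k%:R + m%:R)) (weak_derivative (m - k) f)).
Proof.
have [c c0 hc] := energy_bound m hk hs; exists c; split => // f u uN N mN wu dN.
have [cg cgE] : exists cg, cg = cRL k s by exists (cRL k s).
have cg0 : cg != 0 by rewrite cgE; exact: cRL_neq0.
rewrite -cgE in hc.
have sgn2 (j : nat) : ((-1) ^+ j : R) ^+ 2 = 1 by exact: sqrr_sign.
(* Only squares enter the norm, so a sign between h and cg H is immaterial; both estimates reduce to
   exhibiting such an [H]. *)
have bound (h H : R -> R) : is_weak_derivative m (weak_derivative k (RL_integral s u)) H ->
    L2w (omega m%:R (s - k%:R + m%:R)) h ->
    (forall x, h x ^+ 2 = (cg * H x) ^+ 2) ->
    normU k s (fun x => u x - uN x) <=
      c * N%:R ^- m * normw (omega m%:R (s - k%:R + m%:R)) h.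
  move=> wH [_ ih] hE.
  have iH : integL (fun x => H x ^+ 2 * omega m%:R (s - k%:R + m%:R) x).
    apply: eq_integL (integLZ (cg ^+ 2)^-1 ih) => x _.
    rewrite hE exprMn; set w := omega _ _ _; have := expf_neq0 2 cg0.
    by set a := cg ^+ 2 => a0; rewrite -[a * _ * w]mulrA mulKf.
  have := hc f u uN N H mN wu dN wH iH.
  by rewrite /normw -(eq_IL (fun x _ => congr1 (fun z => z * _) (hE x))).
have [[Uu RLu URu] bcu wsu] := wu.
have s0 : 0 <= s by have /andP[s1 _] := hs; have : 1 <= k%:R :> R; [rewrite ler1n|lra].
have iu : integL u by apply: (L2w_integL _ _ Uu).
have RLu0 : RL_derivable (s + 0%:R) u by rewrite addr0.
have wG := RL_weak hk hs iu RLu0; rewrite addn0 addr0 in wG.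
split.
- move=> [_ /(_ m (leqnn m))[RLm Lm]].
  have wH := weak_derivative_quot wG (RL_weak hk hs iu RLm).
  apply: (bound _ _ wH Lm) => x; rewrite (RL_derivativeE m u x hk hs) -/(cRL k s) -cgE.
  by rewrite !exprMn sgn2 mul1r.
- move=> km wf Lf; set F := weak_derivative (m - k) f in Lf *.
  have wF := weakly_derivableP wf; rewrite -/F in wF; have [lf lF HF] := wF.
  suff wH : is_weak_derivative m (weak_derivative k (RL_integral s u))
      (fun x => (-1) ^+ k / cg * F x).
    apply: (bound _ _ wH Lf) => x.
    by rewrite mulrA [cg * _]mulrC divfK// exprMn sgn2 mul1r.
  (* For a test function phi, v = phi^(m-k) is admissible in the weak equation and its k-th
     derivative is phi^(m). This transfers m - k derivatives to [f]; the leftover sign (-1)^k is the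
     one in [H]. *)
  have [_ lG _] := wG; split; [exact: lG|exact: locintZ|].
  move=> phi tp; have tv := test_derive1n (m - k) tp.
  have [_ e1] := wsu _ (test_V k s tv).
  have tm := test_derive1n m tp.
  have wv := test_weak k tv; have wvE := weak_derivative_ae wv.
  have [_ uG] := weak_RL hk hs wG; rewrite -/(cRL k s) -cgE in uG.
  have iGm := locint_test lG tm; have iFp := locint_test lF tp.
  have e2 : inner (RL_derivative s u) (weak_derivative k (derive1n (m - k) phi)) =
      cg * inner (weak_derivative k (RL_integral s u)) (derive1n m phi).
    rewrite /inner -(ILZl cg iGm); apply: aeL_IL.
    - apply: measurable_funM; first by case: URu.
      exact: (weak_derivative_meas (weakly_derivableP (ex_intro _ _ wv))).
    - exact: (integL_meas (integLZ cg iGm)).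
    - apply: aeL_imp (aeL_and uG wvE) => x _ [-> ->].
      by rewrite derive1nD subnK// mulrA.
  have e3 := etrans (esym e2) (etrans e1 (HF _ tp)).
  have e4 : inner (fun x => (-1) ^+ k / cg * F x) phi = (-1) ^+ k / cg * inner F phi.
    rewrite /inner -(ILZl _ iFp); apply: eq_IL => x _; ring.
  rewrite e4; apply: (mulfI cg0); apply: (etrans e3).
  rewrite -{2}(subnK km) exprD; set z := inner F phi.
  have := sgn2 k; set a := (-1) ^+ k => a2; set d := (-1) ^+ (m - k).
  have -> : cg * (d * a * (a / cg * z)) = a ^+ 2 * (d * z) by field.
  by rewrite a2 mul1r.
Qed.
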